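(* Let $k$ be a field, $R=k[[t]]$, and let $B$ be a finite dimensional selfinjective $k$-algebra. Put $$A:=B\otimes_k\begin{bmatrix}R&R\\ tR&R\end{bmatrix},\qquad e:=\begin{bmatrix}1&0\\0&0\end{bmatrix}\in A.$$ Then $A$ is a Gorenstein $R$-order, and there is an equivalence of exact categories $(\operatorname{CM}_eA)/[Ae]\cong\operatorname{mod}B$, which induces a triangle equivalence $\underline{\operatorname{CM}}_eA\cong\underline{\operatorname{mod}}\,B$ between stable categories.
   Context: The element $e$ of $A$ means $1_B\otimes\begin{bmatrix}1&0\\0&0\end{bmatrix}$. An $R$-order is an $R$-algebra free of finite rank as an $R$-module; it is Gorenstein if $\operatorname{Hom}_R(A,R)$ is projective as an $A$-module. Modules are finitely generated left modules. $\operatorname{CM}_eA$ is the category of $A$-modules $X$ that are free of finite rank over $R$ with $eX\in\operatorname{proj}(eAe)$, with exact structure induced from $\operatorname{mod}A$. $(\operatorname{CM}_eA)/[Ae]$ is the quotient by the ideal of morphisms factoring through $\operatorname{add}Ae$; its exact structure consists of the pairs of morphisms isomorphic to images of short exact sequences of $\operatorname{CM}_eA$. An equivalence of exact categories is an equivalence that is exact and induces isomorphisms on $\operatorname{Ext}^1$. $\underline{\operatorname{CM}}_eA=(\operatorname{CM}_eA)/[A]$ and $\underline{\operatorname{mod}}\,B=(\operatorname{mod}B)/[B]$ are the stable categories of Frobenius categories. *)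

(* Defs.v *)
From HB Require Import structures.
From mathcomp Require Import all_boot all_order all_algebra all_field.
From mathcomp Require Import boolp.

Set Implicit Arguments.
Unset Strict Implicit.
Unset Printing Implicit Defensive.

Import GRing.Theory.
Local Open Scope ring_scope.

Section LinearMaps.
Variables (A : pzRingType) (M N : lmodType A).

Definition lhom : Type := {linear M -> N}.
Definition lhom_fun (f : lhom) : M -> N := f.

Definition mklhom (f : M -> N) (fL : linear f) : lhom :=
  HB.pack f (GRing.isLinear.Build A M N *:%R f fL).

Lemma lhomP (f : lhom) : linear (lhom_fun f).
Proof. exact: linearP. Qed.

Lemma lhom_ext (f g : lhom) : lhom_fun f =1 lhom_fun g -> f = g.
Proof.
case: f g => [f cf] [g cg] /= /funext efg.
rewrite /lhom_fun /= in efg; subst g; congr GRing.Linear.Pack.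
case: cf cg => [[a1] [b1] ] [[a2] [b2]].
by rewrite (Prop_irrelevance a1 a2) (Prop_irrelevance b1 b2).
Qed.

HB.instance Definition _ := gen_eqMixin lhom.
HB.instance Definition _ := gen_choiceMixin lhom.

Fact lhom_zeroP : linear (fun _ : M => 0 : N).
Proof. by move=> a x y; rewrite scaler0 addr0. Qed.
Fact lhom_oppP (f : lhom) : linear (fun x => - lhom_fun f x).
Proof. by move=> a x y; rewrite lhomP opprD scalerN. Qed.
Fact lhom_addP (f g : lhom) : linear (fun x => lhom_fun f x + lhom_fun g x).
Proof. by move=> a x y; rewrite !lhomP scalerDr addrACA. Qed.

Definition lhom_zero := mklhom lhom_zeroP.
Definition lhom_opp f := mklhom (lhom_oppP f).
Definition lhom_add f g := mklhom (lhom_addP f g).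

Fact lhom_addA : associative lhom_add.
Proof. by move=> f g h; apply: lhom_ext => x; apply: addrA. Qed.
Fact lhom_addC : commutative lhom_add.
Proof. by move=> f g; apply: lhom_ext => x; apply: addrC. Qed.
Fact lhom_add0 : left_id lhom_zero lhom_add.
Proof. by move=> f; apply: lhom_ext => x; apply: add0r. Qed.
Fact lhom_addN : left_inverse lhom_zero lhom_opp lhom_add.
Proof. by move=> f; apply: lhom_ext => x; apply: addNr. Qed.

HB.instance Definition _ :=
  GRing.isZmodule.Build lhom lhom_addA lhom_addC lhom_add0 lhom_addN.

End LinearMaps.

Section Composition.
Variable A : pzRingType.

Fact lhom_idP (M : lmodType A) : linear (fun x : M => x).
Proof. by []. Qed.
Definition lhom_id M := mklhom (@lhom_idP M).

Fact lhom_compP (L M N : lmodType A) (g : lhom M N) (f : lhom L M) :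
  linear (fun x => lhom_fun g (lhom_fun f x)).
Proof. by move=> a x y; rewrite !lhomP. Qed.
Definition lhom_comp L M N (g : lhom M N) (f : lhom L M) : lhom L N :=
  mklhom (lhom_compP g f).

End Composition.

Section Modules.
Variable A : pzRingType.

Definition fin_gen (M : lmodType A) : Prop :=
  exists n (x : 'I_n -> M), forall m : M,
    exists c : 'I_n -> A, m = \sum_i c i *: x i.

Definition free_fin_rank (M : lmodType A) : Prop :=
  exists n (b : 'I_n -> M), forall m : M,
    exists! c : {ffun 'I_n -> A}, m = \sum_i c i *: b i.

Definition projective_module (P : lmodType A) : Prop :=
  forall (M N : lmodType A) (g : lhom M N) (f : lhom P N),
    (forall y, exists x, lhom_fun g x = y) ->
    exists h : lhom P M, lhom_comp g h = f.

Definition injective_module (I : lmodType A) : Prop :=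
  forall (M N : lmodType A) (i : lhom M N) (f : lhom M I),
    injective (lhom_fun i) ->
    exists h : lhom N I, lhom_comp h i = f.

(* proj A *)
Definition fg_projective (P : lmodType A) : Prop :=
  fin_gen P /\ projective_module P.

(* add M: direct summands of finite direct powers of M *)
Definition in_add (M X : lmodType A) : Prop :=
  exists n (s : lhom X {ffun 'I_n -> M}) (r : lhom {ffun 'I_n -> M} X),
    lhom_comp r s = lhom_id X.

Definition short_exact (L M N : lmodType A) (f : lhom L M) (g : lhom M N) :=
  [/\ injective (lhom_fun f),
      forall z, exists y, lhom_fun g y = z &
      forall y, lhom_fun g y = 0 <-> exists x, lhom_fun f x = y].

End Modules.

Definition selfinjective (B : nzRingType) : Prop := injective_module (B^o : lmodType B).

Definition restr (R : pzRingType) (A : lalgType R) (X : lmodType A) : Type := X.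

Section Restriction.
Variables (R : pzRingType) (A : lalgType R) (X : lmodType A).

HB.instance Definition _ := GRing.Zmodule.on (@restr R A X).

Definition restr_scale (r : R) (x : restr X) : restr X := (r%:A : A) *: (x : X).

Fact restr_scaleA r s x : restr_scale r (restr_scale s x) = restr_scale (r * s) x.
Proof. by rewrite /restr_scale scalerA -scalerAl mul1r scalerA. Qed.
Fact restr_scale1 : left_id 1 restr_scale.
Proof. by move=> x; rewrite /restr_scale !scale1r. Qed.
Fact restr_scaleDr : right_distributive restr_scale +%R.
Proof. by move=> r x y; apply: scalerDr. Qed.
Fact restr_scaleDl x : {morph restr_scale^~ x : r s / r + s}.
Proof. by move=> r s; rewrite /restr_scale !scalerDl. Qed.

HB.instance Definition _ := GRing.Zmodule_isLmodule.Build R (restr X)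
  restr_scaleA restr_scale1 restr_scaleDr restr_scaleDl.

End Restriction.

Definition Rdual (R : comNzRingType) (A : algType R) : Type := @lhom R A R^o.

Section Dual.
Variables (R : comNzRingType) (A : algType R).

HB.instance Definition _ := GRing.Zmodule.on (Rdual A).

(* Hom_R(A,R) as a left A-module: (a f)(x) = f (x a) *)
Fact Rdual_scaleP (a : A) (f : Rdual A) :
  linear (fun x : A => lhom_fun f (x * a) : R^o).
Proof. by move=> r x y; rewrite mulrDl -scalerAl lhomP. Qed.
Definition Rdual_scale (a : A) (f : Rdual A) : Rdual A := mklhom (Rdual_scaleP a f).

Fact Rdual_scaleA a b f : Rdual_scale a (Rdual_scale b f) = Rdual_scale (a * b) f.
Proof. by apply: lhom_ext => x; rewrite /lhom_fun /= /lhom_fun /= mulrA. Qed.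
Fact Rdual_scale1 : left_id 1 Rdual_scale.
Proof. by move=> f; apply: lhom_ext => x; rewrite /lhom_fun /= /lhom_fun mulr1. Qed.
Fact Rdual_scaleDr : right_distributive Rdual_scale +%R.
Proof. by move=> a f g; apply: lhom_ext => x. Qed.
Fact Rdual_scaleDl f : {morph Rdual_scale^~ f : a b / a + b}.
Proof.
by move=> a b; apply: lhom_ext => x; rewrite /lhom_fun /= /lhom_fun mulrDr linearD.
Qed.

HB.instance Definition _ := GRing.Zmodule_isLmodule.Build A (Rdual A)
  Rdual_scaleA Rdual_scale1 Rdual_scaleDr Rdual_scaleDl.

End Dual.

Definition is_order (R : comNzRingType) (A : algType R) : Prop :=
  free_fin_rank (A : lmodType R).

Definition Gorenstein_order (R : comNzRingType) (A : algType R) : Prop :=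
  is_order A /\ projective_module (Rdual A : lmodType A).

Record idem_elt (A : pzRingType) := IdemElt {
  idem_val : A;
  idemK : idem_val * idem_val = idem_val }.

Section Corner.
Variables (A : pzRingType) (eI : idem_elt A).
Local Notation e := (idem_val eI).

(* eAe = {a | e a = a = a e} *)
Definition corner_pred : {pred A} := [pred a | (e * a == a) && (a * e == a)].
Record corner : Type := Corner { corner_val : A; _ : corner_val \in corner_pred }.

HB.instance Definition _ := [isSub of corner for corner_val].
HB.instance Definition _ := [Choice of corner by <:].

Fact corner_zmod_closed : zmod_closed corner_pred.
Proof.
split; first by rewrite inE mulr0 mul0r eqxx.
move=> a b /andP[/eqP ea /eqP ae] /andP[/eqP eb /eqP be].
by rewrite inE mulrBr mulrBl ea ae eb be eqxx.
Qed.
HB.instance Definition _ := GRing.isZmodClosed.Build A corner_pred corner_zmod_closed.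
HB.instance Definition _ := [SubChoice_isSubZmodule of corner by <:].

Lemma corner_l (a : corner) : e * val a = val a.
Proof. by case: a => a /= /andP[/eqP]. Qed.
Lemma corner_r (a : corner) : val a * e = val a.
Proof. by case: a => a /= /andP[_ /eqP]. Qed.

Fact corner_one_in : e \in corner_pred.
Proof. by rewrite inE idemK eqxx. Qed.
Fact corner_mul_in (a b : corner) : val a * val b \in corner_pred.
Proof. by rewrite inE mulrA corner_l -mulrA corner_r eqxx. Qed.

Definition corner_one := Corner corner_one_in.
Definition corner_mul a b := Corner (corner_mul_in a b).

Fact corner_mulA : associative corner_mul.
Proof. by move=> a b c; apply: val_inj; apply: mulrA. Qed.
Fact corner_mul1 : left_id corner_one corner_mul.
Proof. by move=> a; apply: val_inj; apply: corner_l. Qed.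
Fact corner_mulr1 : right_id corner_one corner_mul.
Proof. by move=> a; apply: val_inj; apply: corner_r. Qed.
Fact corner_mulDl : left_distributive corner_mul +%R.
Proof. by move=> a b c; apply: val_inj; apply: mulrDl. Qed.
Fact corner_mulDr : right_distributive corner_mul +%R.
Proof. by move=> a b c; apply: val_inj; apply: mulrDr. Qed.

HB.instance Definition _ := GRing.Zmodule_isPzRing.Build corner
  corner_mulA corner_mul1 corner_mulr1 corner_mulDl corner_mulDr.

Section CornerModule.
Variable X : lmodType A.

(* eX = {x | e x = x} *)
Definition emod_pred : {pred X} := [pred x | e *: x == x].
Record emod : Type := Emod { emod_val : X; _ : emod_val \in emod_pred }.

HB.instance Definition _ := [isSub of emod for emod_val].
HB.instance Definition _ := [Choice of emod by <:].

Fact emod_zmod_closed : zmod_closed emod_pred.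
Proof.
split; first by rewrite inE scaler0.
by move=> x y /eqP ex /eqP ey; rewrite inE scalerBr ex ey.
Qed.
HB.instance Definition _ := GRing.isZmodClosed.Build X emod_pred emod_zmod_closed.
HB.instance Definition _ := [SubChoice_isSubZmodule of emod by <:].

Fact emod_scale_in (a : corner) (x : emod) : val a *: val x \in emod_pred.
Proof. by rewrite inE scalerA corner_l. Qed.
Definition emod_scale a x := Emod (emod_scale_in a x).

Fact emod_scaleA a b x : emod_scale a (emod_scale b x) = emod_scale (a * b) x.
Proof. by apply: val_inj; apply: scalerA. Qed.
Fact emod_scale1 : left_id 1 emod_scale.
Proof. by move=> x; apply: val_inj; case: x => x /= /eqP. Qed.
Fact emod_scaleDr : right_distributive emod_scale +%R.
Proof. by move=> a x y; apply: val_inj; apply: scalerDr. Qed.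
Fact emod_scaleDl x : {morph emod_scale^~ x : a b / a + b}.
Proof. by move=> a b; apply: val_inj; apply: scalerDl. Qed.

HB.instance Definition _ := GRing.Zmodule_isLmodule.Build corner emod
  emod_scaleA emod_scale1 emod_scaleDr emod_scaleDl.

End CornerModule.

(* Ae = {a | a e = a}, a left ideal of A *)
Definition lideal_pred : {pred A^o} := [pred a : A^o | (a : A) * e == a].
Record lideal : Type := Lideal { lideal_val : A^o; _ : lideal_val \in lideal_pred }.

HB.instance Definition _ := [isSub of lideal for lideal_val].
HB.instance Definition _ := [Choice of lideal by <:].

Fact lideal_submod_closed : submod_closed lideal_pred.
Proof.
split; first by rewrite inE mul0r.
move=> a x y /eqP xe /eqP ye; rewrite inE.
by rewrite mulrDl -[(a *: x) * _]mulrA xe ye.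
Qed.
HB.instance Definition _ :=
  GRing.isSubmodClosed.Build A A^o lideal_pred lideal_submod_closed.
HB.instance Definition _ := [SubChoice_isSubLmodule of lideal by <:].

End Corner.

Record fps (S : Type) : Type := Fps { fcoef : nat -> S }.

HB.instance Definition _ S := gen_eqMixin (fps S).
HB.instance Definition _ S := gen_choiceMixin (fps S).

Lemma fps_ext S (f g : fps S) : fcoef f =1 fcoef g -> f = g.
Proof. by case: f g => [f] [g] /= /funext ->. Qed.

Section PowerSeries.
Variable S : nzRingType.
Implicit Types f g h : fps S.

Definition fps_zero : fps S := Fps (fun _ => 0).
Definition fps_opp f : fps S := Fps (fun n => - fcoef f n).
Definition fps_add f g : fps S := Fps (fun n => fcoef f n + fcoef g n).

Fact fps_addA : associative fps_add.
Proof. by move=> f g h; apply: fps_ext => n; apply: addrA. Qed.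
Fact fps_addC : commutative fps_add.
Proof. by move=> f g; apply: fps_ext => n; apply: addrC. Qed.
Fact fps_add0 : left_id fps_zero fps_add.
Proof. by move=> f; apply: fps_ext => n; apply: add0r. Qed.
Fact fps_addN : left_inverse fps_zero fps_opp fps_add.
Proof. by move=> f; apply: fps_ext => n; apply: addNr. Qed.

HB.instance Definition _ :=
  GRing.isZmodule.Build (fps S) fps_addA fps_addC fps_add0 fps_addN.

Definition fps_const (a : S) : fps S := Fps (fun n => if n == 0%N then a else 0).
Definition fps_one : fps S := fps_const 1.
Definition fps_mul f g : fps S :=
  Fps (fun n => \sum_(i < n.+1) fcoef f i * fcoef g (n - i)).

Let trunc n f : {poly S} := \poly_(i < n.+1) fcoef f i.

Let coef_trunc n f i : (i <= n)%N -> (trunc n f)`_i = fcoef f i.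
Proof. by move=> le_in; rewrite coef_poly ltnS le_in. Qed.

Let coef_mul m f g n : (n <= m)%N -> fcoef (fps_mul f g) n = (trunc m f * trunc m g)`_n.
Proof.
move=> le_nm; rewrite coefM; apply: eq_bigr => i _.
have le_in : (i <= n)%N by rewrite -ltnS.
by rewrite !coef_trunc ?(leq_trans _ le_nm) ?leq_subr.
Qed.

Fact fps_mulA : associative fps_mul.
Proof.
move=> f g h; apply: fps_ext => n; rewrite !(coef_mul _ _ (leqnn n)).
transitivity ((trunc n f * (trunc n g * trunc n h))`_n).
  rewrite !coefM; apply: eq_bigr => i _; congr (_ * _).
  by rewrite coef_trunc ?leq_subr // (coef_mul _ _ (leq_subr i n)).
rewrite mulrA !coefM; apply: eq_bigr => i _; congr (_ * _).
have le_in : (i <= n)%N by rewrite -ltnS.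
by rewrite coef_trunc // (coef_mul _ _ le_in).
Qed.

Lemma fps_constM a f : fps_mul (fps_const a) f = Fps (fun n => a * fcoef f n).
Proof.
apply: fps_ext => n /=; rewrite big_ord_recl /= subn0 big1 ?addr0 // => i _.
by rewrite mul0r.
Qed.

Lemma fps_Mconst f a : fps_mul f (fps_const a) = Fps (fun n => fcoef f n * a).
Proof.
apply: fps_ext => n /=; rewrite big_ord_recr /= subnn big1 ?add0r // => i _.
by rewrite subn_eq0 leqNgt ltn_ord /= mulr0.
Qed.

Fact fps_mul1 : left_id fps_one fps_mul.
Proof. by move=> f; rewrite fps_constM; apply: fps_ext => n /=; rewrite mul1r. Qed.
Fact fps_mulr1 : right_id fps_one fps_mul.
Proof. by move=> f; rewrite fps_Mconst; apply: fps_ext => n /=; rewrite mulr1. Qed.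
Fact fps_mulDl : left_distributive fps_mul +%R.
Proof.
move=> f g h; apply: fps_ext => n /=; rewrite -big_split /=.
by apply: eq_bigr => i _; rewrite mulrDl.
Qed.
Fact fps_mulDr : right_distributive fps_mul +%R.
Proof.
move=> f g h; apply: fps_ext => n /=; rewrite -big_split /=.
by apply: eq_bigr => i _; rewrite mulrDr.
Qed.
Fact fps_one_neq0 : fps_one != 0.
Proof.
by apply/eqP => /(congr1 (fun f => fcoef f 0)) /= /eqP; rewrite oner_eq0.
Qed.

HB.instance Definition _ := GRing.Zmodule_isNzRing.Build (fps S)
  fps_mulA fps_mul1 fps_mulr1 fps_mulDl fps_mulDr fps_one_neq0.

Lemma fcoefM f g n : fcoef (f * g) n = \sum_(i < n.+1) fcoef f i * fcoef g (n - i).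
Proof. by []. Qed.

End PowerSeries.

Section PowerSeriesCom.
Variable S : comNzRingType.

Fact fps_mulC : commutative (@GRing.mul (fps S)).
Proof.
move=> f g; apply: fps_ext => n; rewrite !fcoefM.
rewrite (reindex_inj rev_ord_inj) /=; apply: eq_bigr => i _.
by rewrite mulrC subSS subKn // -ltnS.
Qed.
HB.instance Definition _ := GRing.PzRing_hasCommutativeMul.Build (fps S) fps_mulC.

End PowerSeriesCom.

(* k[[t]] -> B[[t]], the coefficientwise image of scalars *)
Section ScalarSeries.
Variables (k : comNzRingType) (B : algType k).

Definition fps_in (r : fps k) : fps B := Fps (fun n => (fcoef r n)%:A).

Fact fps_in_zmod : zmod_morphism fps_in.
Proof. by move=> r s; apply: fps_ext => n; apply: scalerBl. Qed.
Fact fps_in_monoid : monoid_morphism fps_in.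
Proof.
split; first by apply: fps_ext => -[|n] /=; rewrite ?scale1r ?scale0r.
move=> r s; apply: fps_ext => n; rewrite [LHS]/= fcoefM scaler_suml.
by apply: eq_bigr => i _ /=; rewrite -scalerAl mul1r scalerA.
Qed.
HB.instance Definition _ := GRing.isZmodMorphism.Build _ _ fps_in fps_in_zmod.
HB.instance Definition _ := GRing.isMonoidMorphism.Build _ _ fps_in fps_in_monoid.

Lemma fps_in_central r f : fps_in r * f = f * fps_in r.
Proof.
apply: fps_ext => n; rewrite !fcoefM.
rewrite (reindex_inj rev_ord_inj) /=; apply: eq_bigr => i _.
by rewrite subSS subKn ?mulr_algl ?mulr_algr // -ltnS.
Qed.

End ScalarSeries.

(* [S[[t]] S[[t]]; tS[[t]] S[[t]]]: the series in tS[[t]] are those with zero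
   constant coefficient. *)
Section HereditaryShape.
Variable S : nzRingType.

Definition hord_pred : {pred 'M[fps S]_2} := [pred a : 'M[fps S]_2 | fcoef (a 1 0) 0 == 0].
Record hord : Type := Hord { hord_val : 'M[fps S]_2; _ : hord_val \in hord_pred }.

HB.instance Definition _ := [isSub of hord for hord_val].
HB.instance Definition _ := [Choice of hord by <:].

Fact hord_subring_closed : subring_closed hord_pred.
Proof.
split; first by rewrite inE mxE.
- by move=> a b /eqP a0 /eqP b0; rewrite inE !mxE /= a0 b0 subr0.
move=> a b /eqP a0 /eqP b0; rewrite inE mxE !big_ord_recl big_ord0 /=.
rewrite !big_ord_recl !big_ord0 /= !addr0 /=.
have -> : lift ord0 ord0 = 1 :> 'I_2 by apply: val_inj.
by rewrite a0 b0 mul0r mulr0 addr0.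
Qed.
HB.instance Definition _ :=
  GRing.isSubringClosed.Build 'M[fps S]_2 hord_pred hord_subring_closed.
HB.instance Definition _ := [SubChoice_isSubNzRing of hord by <:].

Fact hord_e11_in : (delta_mx 0 0 : 'M[fps S]_2) \in hord_pred.
Proof. by rewrite inE mxE. Qed.
Definition hord_e11 : hord := Hord hord_e11_in.

End HereditaryShape.

Arguments hord_pred S _ : clear implicits.

(* Since B is finite dimensional over k, B ⊗_k k[[t]] = B[[t]], and hence
   B ⊗_k [R R; tR R] is the matrix ring [B[[t]] B[[t]]; tB[[t]] B[[t]]];
   [tens_universal] below checks the universal property. *)
Definition tord (k : comNzRingType) (B : algType k) : Type := hord B.

Section TensorOrder.
Variables (k : comNzRingType) (B : algType k).

HB.instance Definition _ := GRing.NzRing.on (tord B).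

Fact tord_scale_in (r : fps k) (a : tord B) :
  (fps_in B r)%:M *m val a \in hord_pred B.
Proof.
rewrite inE mul_scalar_mx mxE fcoefM big_ord1 subn0.
by case: a => a /= /eqP ->; rewrite mulr0.
Qed.
Definition tord_scale r a : tord B := Hord (tord_scale_in r a).

Fact tord_scaleA r s a : tord_scale r (tord_scale s a) = tord_scale (r * s) a.
Proof. by apply: val_inj; rewrite /= mulmxA -scalar_mxM -rmorphM. Qed.
Fact tord_scale1 : left_id 1 tord_scale.
Proof. by move=> a; apply: val_inj; rewrite /= rmorph1 mul1mx. Qed.
Fact tord_scaleDr : right_distributive tord_scale +%R.
Proof. by move=> r a b; apply: val_inj; rewrite /= mulmxDr. Qed.
Fact tord_scaleDl a : {morph tord_scale^~ a : r s / r + s}.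
Proof. by move=> r s; apply: val_inj; rewrite /= rmorphD raddfD mulmxDl. Qed.
HB.instance Definition _ := GRing.Zmodule_isLmodule.Build (fps k) (tord B)
  tord_scaleA tord_scale1 tord_scaleDr tord_scaleDl.

Fact tord_scaleAl r (a b : tord B) : r *: (a * b) = (r *: a) * b.
Proof. by apply: val_inj; apply: mulmxA. Qed.
HB.instance Definition _ :=
  GRing.Lmodule_isLalgebra.Build (fps k) (tord B) tord_scaleAl.

Fact tord_scaleAr r (a b : tord B) : r *: (a * b) = a * (r *: b).
Proof.
apply: val_inj; rewrite /= -[RHS]/(val a *m ((fps_in B r)%:M *m val b)).
rewrite -[LHS]/((fps_in B r)%:M *m (val a *m val b)) !mulmxA; congr (_ *m _).
apply/matrixP => i j; rewrite mul_scalar_mx !mxE.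
rewrite (bigD1 j) //= big1 ?addr0 => [|l ne_lj].
  by rewrite mxE eqxx mulr1n fps_in_central.
by rewrite mxE (negbTE ne_lj) mulr0n mulr0.
Qed.
HB.instance Definition _ :=
  GRing.Lalgebra_isAlgebra.Build (fps k) (tord B) tord_scaleAr.

End TensorOrder.

Section Tensors.
Variables (k : comNzRingType) (B : algType k).

(* b ⊗ l, for l in [R R; tR R] *)
Fact tens_in (b : B) (l : tord k^o) :
  (\matrix_(i, j) Fps (fun n => (fcoef (val l i j) n : k) *: b)) \in hord_pred B.
Proof. by rewrite inE mxE /=; case: l => l /= /eqP ->; rewrite scale0r. Qed.
Definition tens b l : tord B := Hord (tens_in b l).

Lemma tens_mul (b c : B) (l m : tord k^o) : tens b l * tens c m = tens (b * c) (l * m).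
Proof.
apply: val_inj; apply/matrixP => i j; apply: fps_ext => n.
rewrite [in RHS]mxE /= [in LHS]mxE [in RHS]mxE !big_ord_recl !big_ord0 !mxE /=.
rewrite !addr0 !scalerDl !scaler_suml.
by congr (_ + _); apply: eq_bigr => p _; rewrite -scalerAl -scalerAr scalerA.
Qed.

Lemma tens1 : tens 1 1 = 1.
Proof.
apply: val_inj; apply/matrixP => i j; apply: fps_ext => n; rewrite !mxE /=.
by case: (i == j); case: n => [|n] /=; rewrite ?scale1r ?scale0r.
Qed.

Lemma tens_scale (b : B) (r : fps k) (l : tord k^o) : tens b (r *: l) = r *: tens b l.
Proof.
apply: val_inj; apply/matrixP => i j; apply: fps_ext => n.
rewrite -[val (r *: tens b l)]/((fps_in B r)%:M *m val (tens b l)) mul_scalar_mx.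
have -> : val (tens b (r *: l)) i j =
    Fps (fun n => (fcoef (((fps_in k^o r)%:M *m val l) i j) n : k) *: b) by rewrite mxE.
rewrite [fcoef (Fps _) n]/= mul_scalar_mx !mxE !fcoefM scaler_suml.
apply: eq_bigr => p _; rewrite [fcoef (fps_in B r) p]/= [fcoef (fps_in k^o r) p]/=.
rewrite [fcoef (Fps _) _]/= [in RHS]mulr_algl scalerA; congr (_ *: _).
by rewrite -[(_ *: 1) : k^o]/(fcoef r p * 1) mulr1.
Qed.

Definition e11 : idem_elt (tord B).
Proof.
exists (tens 1 (hord_e11 k^o)); rewrite tens_mul mulr1; congr (tens _ _).
by apply: val_inj; apply: mul_delta_mx.
Defined.

End Tensors.

Lemma tord_constZ (k : comNzRingType) (B : algType k) c (a : tord B) i j n :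
  fcoef (val (fps_const c *: a) i j) n = c *: fcoef (val a i j) n.
Proof.
rewrite -[val (_ *: a)]/((fps_in B (fps_const c))%:M *m val a) mul_scalar_mx mxE.
have -> : fps_in B (fps_const c) = fps_const c%:A.
  by apply: fps_ext => -[|m] //=; rewrite scale0r.
by rewrite [X in fcoef X n]fps_constM /= mulr_algl.
Qed.

(* k acts on the R-modules [tord k^o] and [tord B] through constant series. *)
Lemma tens_universal (k : fieldType) (B : falgType k) (V : lmodType k)
    (f : B -> tord k^o -> V) :
  (forall l, linear (f^~ l)) ->
  (forall b, zmod_morphism (f b)) ->
  (forall b c l, f b (fps_const c *: l) = c *: f b l) ->
  exists! g : tord B -> V,
    [/\ zmod_morphism g,
        forall c a, g (fps_const c *: a) = c *: g a &
        forall b l, g (tens b l) = f b l].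
Proof.
move=> fL fD fZ; pose X := vbasis {:B}.
have co_in i (a : tord B) :
    (\matrix_(x, y) Fps (fun n => coord X i (fcoef (val a x y) n) : k^o)
      : 'M[fps k^o]_2) \in hord_pred k^o.
  by rewrite inE mxE /=; case: a => a /= /eqP ->; rewrite linear0.
pose co i a : tord k^o := Hord (co_in i a).
have tens_co a : a = \sum_(i < \dim {:B}) tens X`_i (co i a).
  apply: val_inj; apply/matrixP => x y; apply: fps_ext => n.
  have valD (I : Type) (r : seq I) (F : I -> tord B) :
      fcoef (val (\sum_(i <- r) F i) x y) n = \sum_(i <- r) fcoef (val (F i) x y) n.
    elim: r => [|i r IHr]; first by rewrite !big_nil mxE.
    by rewrite !big_cons -IHr mxE.
  rewrite valD {1}(coord_vbasis (memvf (fcoef (val a x y) n))).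
  by apply: eq_bigr => i _; rewrite !mxE.
have f0 b : f b 0 = 0 by rewrite -(subrr 0) fD subrr.
have co_tens i b l : co i (tens b l) = fps_const (coord X i b) *: l.
  apply: val_inj; apply/matrixP => x y; apply: fps_ext => n.
  rewrite tord_constZ mxE /= mxE /= linearZ /=.
  by rewrite -[RHS]/(coord X i b * _) mulrC.
have coB i a b : co i (a - b) = co i a - co i b.
  apply: val_inj; apply/matrixP => x y; apply: fps_ext => n.
  by rewrite !mxE /= linearB.
have coZ i c a : co i (fps_const c *: a) = fps_const c *: co i a.
  apply: val_inj; apply/matrixP => x y; apply: fps_ext => n.
  rewrite tord_constZ [val (co i a) x y]mxE [val (co i (_ *: _)) x y]mxE /=.
  by rewrite tord_constZ linearZ.
exists (fun a => \sum_(i < \dim {:B}) f X`_i (co i a)); split; [split|].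
- move=> a b; rewrite -sumrB; apply: eq_bigr => i _.
  by rewrite coB fD.
- move=> c a; rewrite scaler_sumr; apply: eq_bigr => i _.
  by rewrite coZ fZ.
- move=> b l; rewrite {2}(coord_vbasis (memvf b)).
  pose fl := mklhom (fL l).
  rewrite -[RHS]/(fl _) linear_sum; apply: eq_bigr => i _.
  by rewrite co_tens fZ linearZ.
move=> g [gB gZ gT]; apply/funext => a; rewrite [in RHS](tens_co a).
pose gm : {additive tord B -> V} :=
  HB.pack g (GRing.isZmodMorphism.Build _ _ g gB).
rewrite -[g]/(gm : _ -> _) raddf_sum; apply: eq_bigr => i _.
exact/esym/gT.
Qed.

Record pacat := Pacat {
  obj :> Type;
  hom : obj -> obj -> zmodType;
  idm : forall X, hom X X;
  cmp : forall X Y Z, hom Y Z -> hom X Y -> hom X Z;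
  cmpA : forall W X Y Z (h : hom Y Z) (g : hom X Y) (f : hom W X),
    cmp h (cmp g f) = cmp (cmp h g) f;
  cmp1m : forall X Y (f : hom X Y), cmp (idm Y) f = f;
  cmpm1 : forall X Y (f : hom X Y), cmp f (idm X) = f;
  cmpDl : forall X Y Z (g h : hom Y Z) (f : hom X Y),
    cmp (g + h) f = cmp g f + cmp h f;
  cmpDr : forall X Y Z (h : hom Y Z) (f g : hom X Y),
    cmp h (f + g) = cmp h f + cmp h g }.

Arguments hom {p} _ _.
Arguments idm {p} X.
Arguments cmp {p X Y Z} _ _.
Notation "g \oo f" := (cmp g f) (at level 40, left associativity).

Section CategoryNotions.
Variable C : pacat.

Lemma cmpB X Y Z (h g : @hom C Y Z) (f : hom X Y) : (h - g) \oo f = h \oo f - g \oo f.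
Proof. by apply: (addIr (g \oo f)); rewrite -cmpDl !subrK. Qed.
Lemma cmpBr X Y Z (h : @hom C Y Z) (f g : hom X Y) : h \oo (f - g) = h \oo f - h \oo g.
Proof. by apply: (addIr (h \oo g)); rewrite -cmpDr !subrK. Qed.

Definition is_iso (X Y : C) (f : hom X Y) : Prop :=
  exists g : hom Y X, g \oo f = idm X /\ f \oo g = idm Y.

Definition is_kernel (X Y Z : C) (f : hom X Y) (g : hom Y Z) : Prop :=
  g \oo f = 0 /\
  forall W (h : hom W Y), g \oo h = 0 -> exists! l : hom W X, f \oo l = h.

Definition is_cokernel (X Y Z : C) (g : hom Y Z) (f : hom X Y) : Prop :=
  g \oo f = 0 /\
  forall W (h : hom Y W), h \oo f = 0 -> exists! l : hom Z W, l \oo g = h.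

Definition is_pushout (X Y Y' W : C)
    (f : hom X Y) (f' : hom X Y') (g : hom Y W) (g' : hom Y' W) : Prop :=
  g \oo f = g' \oo f' /\
  forall V (h : hom Y V) (h' : hom Y' V), h \oo f = h' \oo f' ->
    exists! l : hom W V, l \oo g = h /\ l \oo g' = h'.

Definition is_pullback (W Y Y' X : C)
    (g : hom W Y) (g' : hom W Y') (f : hom Y X) (f' : hom Y' X) : Prop :=
  f \oo g = f' \oo g' /\
  forall V (h : hom V Y) (h' : hom V Y'), f \oo h = f' \oo h' ->
    exists! l : hom V W, g \oo l = h /\ g' \oo l = h'.

Definition is_biproduct (X Y W : C) (i : hom X W) (j : hom Y W)
    (p : hom W X) (q : hom W Y) : Prop :=
  [/\ p \oo i = idm X, q \oo j = idm Y, p \oo j = 0, q \oo i = 0 &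
      i \oo p + j \oo q = idm W].

Definition is_additive : Prop :=
  (exists Z : C, idm Z = 0) /\
  forall X Y : C, exists W i j p q, @is_biproduct X Y W i j p q.

End CategoryNotions.

Record functor (C D : pacat) := Functor {
  fobj :> C -> D;
  fmap : forall X Y, hom X Y -> hom (fobj X) (fobj Y);
  fmap1 : forall X, fmap (idm X) = idm (fobj X);
  fmapM : forall X Y Z (g : hom Y Z) (f : hom X Y), fmap (g \oo f) = fmap g \oo fmap f;
  fmapD : forall X Y (f g : hom X Y), fmap (f + g) = fmap f + fmap g }.

Arguments fmap {C D} _ {X Y} _.

Section Functors.

Definition fid (C : pacat) : functor C C :=
  @Functor C C id (fun X Y f => f) (fun=> erefl)
    (fun X Y Z g f => erefl) (fun X Y f g => erefl).

Variables (C D E : pacat) (G : functor D E) (F : functor C D).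

Let fcomp_map X Y (f : hom X Y) := fmap G (fmap F f).
Fact fcomp1 X : fcomp_map (idm X) = idm (G (F X)).
Proof. by rewrite /fcomp_map !fmap1. Qed.
Fact fcompM X Y Z (g : hom Y Z) (f : hom X Y) :
  fcomp_map (g \oo f) = fcomp_map g \oo fcomp_map f.
Proof. by rewrite /fcomp_map !fmapM. Qed.
Fact fcompD X Y (f g : hom X Y) : fcomp_map (f + g) = fcomp_map f + fcomp_map g.
Proof. by rewrite /fcomp_map !fmapD. Qed.
Definition fcomp : functor C E := Functor fcomp1 fcompM fcompD.

End Functors.

Definition nat_iso (C D : pacat) (F G : functor C D) : Prop :=
  exists eta : forall X, hom (F X) (G X),
    (forall X, is_iso (eta X)) /\
    forall X Y (f : hom X Y), eta Y \oo fmap F f = fmap G f \oo eta X.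

Definition is_equivalence (C D : pacat) (F : functor C D) : Prop :=
  exists G : functor D C, nat_iso (fcomp G F) (fid C) /\ nat_iso (fcomp F G) (fid D).

Record ideal (C : pacat) := Ideal {
  imem : forall X Y : C, hom X Y -> Prop;
  imem0 : forall X Y, imem (0 : hom X Y);
  imemB : forall X Y (f g : hom X Y), imem f -> imem g -> imem (f - g);
  imem_l : forall X Y Z (g : hom Y Z) (f : hom X Y), imem f -> imem (g \oo f);
  imem_r : forall X Y Z (g : hom Y Z) (f : hom X Y), imem g -> imem (g \oo f) }.

Arguments imem {C} _ {X Y} _.

Section QuotientCategory.
Variables (C : pacat) (I : ideal C).

Definition ipred (X Y : C) : {pred hom X Y} := fun f => `[< imem I f >].
Arguments ipred X Y _ : clear implicits.

Fact ipred_zmod_closed X Y : zmod_closed (ipred X Y).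
Proof.
split; first exact/asboolP/imem0.
by move=> f g /asboolP If /asboolP Ig; apply/asboolP/imemB.
Qed.
HB.instance Definition _ X Y :=
  GRing.isZmodClosed.Build (@hom C X Y) (ipred X Y) (ipred_zmod_closed X Y).

Definition qhom (X Y : C) : zmodType := Quotient.quot (ipred X Y).
Definition qpi X Y (f : hom X Y) : qhom X Y := (\pi f)%qT.
Definition qrepr X Y (f : qhom X Y) : hom X Y := repr f.

Lemma qreprK X Y : cancel (@qrepr X Y) (@qpi X Y).
Proof. by move=> f; apply: reprK. Qed.
Lemma qpi_eq X Y (f g : hom X Y) : qpi f = qpi g <-> imem I (f - g).
Proof.
rewrite (rwP eqP) /qpi -Quotient.idealrBE; split; first by move/asboolP.
by move=> h; apply/asboolP.
Qed.
Lemma qpiD X Y (f g : hom X Y) : qpi (f + g) = qpi f + qpi g.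
Proof. by rewrite /qpi !piE. Qed.

Definition qcmp X Y Z (g : qhom Y Z) (f : qhom X Y) : qhom X Z :=
  qpi (qrepr g \oo qrepr f).

Lemma qpiM X Y Z (g : hom Y Z) (f : hom X Y) : qpi (g \oo f) = qcmp (qpi g) (qpi f).
Proof.
apply/qpi_eq; set g' := qrepr _; set f' := qrepr _.
have Ig : imem I (g - g') by apply/qpi_eq; rewrite qreprK.
have If : imem I (f - f') by apply/qpi_eq; rewrite qreprK.
have -> : g \oo f - g' \oo f' = (g - g') \oo f - g' \oo (f' - f).
  by rewrite cmpB cmpBr opprB addrA subrK.
apply: imemB; [exact: imem_r | apply: imem_l].
by rewrite -opprB -sub0r; apply: imemB => //; apply: imem0.
Qed.

Fact qcmpA W X Y Z (h : qhom Y Z) (g : qhom X Y) (f : qhom W X) :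
  qcmp h (qcmp g f) = qcmp (qcmp h g) f.
Proof. by rewrite -[h]qreprK -[g]qreprK -[f]qreprK -!qpiM cmpA. Qed.
Fact qcmp1m X Y (f : qhom X Y) : qcmp (qpi (idm Y)) f = f.
Proof. by rewrite -[f]qreprK -qpiM cmp1m. Qed.
Fact qcmpm1 X Y (f : qhom X Y) : qcmp f (qpi (idm X)) = f.
Proof. by rewrite -[f]qreprK -qpiM cmpm1. Qed.
Fact qcmpDl X Y Z (g h : qhom Y Z) (f : qhom X Y) :
  qcmp (g + h) f = qcmp g f + qcmp h f.
Proof. by rewrite -[g]qreprK -[h]qreprK -[f]qreprK -qpiD -!qpiM -qpiD cmpDl. Qed.
Fact qcmpDr X Y Z (h : qhom Y Z) (f g : qhom X Y) :
  qcmp h (f + g) = qcmp h f + qcmp h g.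
Proof. by rewrite -[g]qreprK -[h]qreprK -[f]qreprK -qpiD -!qpiM -qpiD cmpDr. Qed.

Definition qcat : pacat := @Pacat C qhom (fun X => qpi (idm X)) qcmp
  qcmpA qcmp1m qcmpm1 qcmpDl qcmpDr.

Definition qfun : functor C qcat :=
  @Functor C qcat id qpi (fun=> erefl) qpiM qpiD.

End QuotientCategory.

(* [confl f g] : the pair X --f--> Y --g--> Z is a conflation (a short exact
   sequence of the exact structure). *)
Record excat := Excat {
  ecat :> pacat;
  confl : forall X Y Z : ecat, hom X Y -> hom Y Z -> Prop }.

Arguments confl {e X Y Z} _ _.

Section ExactCategories.
Variable E : excat.

Definition inflation (X Y : E) (f : hom X Y) : Prop := exists Z (g : hom Y Z), confl f g.
Definition deflation (Y Z : E) (g : hom Y Z) : Prop := exists X (f : hom X Y), confl f g.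

(* Quillen's axioms *)
Record exact_axioms : Prop := {
  ex_additive : is_additive E;
  ex_kercok : forall (X Y Z : E) (f : hom X Y) (g : hom Y Z),
    confl f g -> is_kernel f g /\ is_cokernel g f;
  ex_iso : forall (X Y Z X' Y' Z' : E) (f : hom X Y) (g : hom Y Z)
      (f' : hom X' Y') (g' : hom Y' Z') (a : hom X X') (b : hom Y Y') (c : hom Z Z'),
    is_iso a -> is_iso b -> is_iso c ->
    b \oo f = f' \oo a -> c \oo g = g' \oo b -> confl f g -> confl f' g';
  ex_infl_id : forall X : E, inflation (idm X);
  ex_defl_id : forall X : E, deflation (idm X);
  ex_infl_cmp : forall (X Y Z : E) (g : hom Y Z) (f : hom X Y),
    inflation g -> inflation f -> inflation (g \oo f);
  ex_defl_cmp : forall (X Y Z : E) (g : hom Y Z) (f : hom X Y),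
    deflation g -> deflation f -> deflation (g \oo f);
  ex_pushout : forall (X Y X' : E) (f : hom X Y) (a : hom X X'), inflation f ->
    exists W (b : hom Y W) (f' : hom X' W), is_pushout f a b f' /\ inflation f';
  ex_pullback : forall (Y Z Z' : E) (g : hom Y Z) (a : hom Z' Z), deflation g ->
    exists W (b : hom W Y) (g' : hom W Z'), is_pullback b g' g a /\ deflation g' }.

(* Conflations Y -> W -> X and Y -> W' -> X with the same class in Ext^1(X,Y) *)
Definition ext1_eq (Y W W' X : E) (f : hom Y W) (g : hom W X)
    (f' : hom Y W') (g' : hom W' X) : Prop :=
  exists h : hom W W', [/\ is_iso h, h \oo f = f' & g' \oo h = g].

Definition ex_projective (P : E) : Prop :=
  forall (X Y Z : E) (f : hom X Y) (g : hom Y Z), confl f g ->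
  forall h : hom P Z, exists l : hom P Y, g \oo l = h.

Definition ex_injective (I : E) : Prop :=
  forall (X Y Z : E) (f : hom X Y) (g : hom Y Z), confl f g ->
  forall h : hom X I, exists l : hom Y I, l \oo f = h.

Record Frobenius : Prop := {
  frob_exact : exact_axioms;
  frob_projE : forall P : E, ex_projective P <-> ex_injective P;
  frob_enough_proj : forall X : E, exists (K P : E) (f : hom K P) (g : hom P X),
    ex_projective P /\ confl f g;
  frob_enough_inj : forall X : E, exists (I K : E) (f : hom X I) (g : hom I K),
    ex_injective I /\ confl f g }.

End ExactCategories.

(* C/I with conflations the pairs of morphisms isomorphic to images of conflations *)
Definition qexcat (E : excat) (I : ideal E) : excat :=
  @Excat (qcat I) (fun X Y Z (f : @hom (qcat I) X Y) (g : @hom (qcat I) Y Z) =>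
    exists (X' Y' Z' : E) (f' : hom X' Y') (g' : hom Y' Z'),
      confl f' g' /\
      exists (a : @hom (qcat I) X' X) (b : @hom (qcat I) Y' Y) (c : @hom (qcat I) Z' Z),
        [/\ is_iso a, is_iso b, is_iso c,
            b \oo fmap (qfun I) f' = f \oo a & c \oo fmap (qfun I) g' = g \oo b]).

Section ExactFunctors.
Variables (E E' : excat) (F : functor E E').

Definition is_exact_functor : Prop :=
  forall (X Y Z : E) (f : hom X Y) (g : hom Y Z), confl f g -> confl (fmap F f) (fmap F g).

(* The map Ext^1(X,Y) -> Ext^1(FX,FY) induced by the exact functor F is bijective;
   it is automatically additive for the Baer sum. *)
Definition ext1_iso : Prop :=
  forall X Y : E,
  (forall (W W' : E) (f : hom Y W) (g : hom W X) (f' : hom Y W') (g' : hom W' X),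
     confl f g -> confl f' g' ->
     ext1_eq (fmap F f) (fmap F g) (fmap F f') (fmap F g') -> ext1_eq f g f' g') /\
  (forall (V : E') (u : hom (F Y) V) (v : hom V (F X)), confl u v ->
     exists (W : E) (f : hom Y W) (g : hom W X),
       confl f g /\ ext1_eq (fmap F f) (fmap F g) u v).

Record exact_equivalence : Prop := {
  eeq_dom : exact_axioms E;
  eeq_cod : exact_axioms E';
  eeq_equiv : is_equivalence F;
  eeq_exact : is_exact_functor;
  eeq_ext1 : ext1_iso }.

End ExactFunctors.

(* Says that E/I is the stable category of a Frobenius category; the notions of
   suspension and distinguished triangle below presuppose this. *)
Definition stable_ideal (E : excat) (I : ideal E) : Prop :=
  Frobenius E /\
  forall (X Y : E) (f : hom X Y), imem I f <->
    exists (P : E) (g : hom P Y) (h : hom X P), ex_projective P /\ f = g \oo h.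

(* A choice of conflations X -> I(X) -> X[1], on which the triangulated structure
   of the stable category depends only up to isomorphism *)
Record suspension (E : excat) := Suspension {
  susp :> E -> E;
  susp_inj : E -> E;
  susp_in : forall X, hom X (susp_inj X);
  susp_out : forall X, hom (susp_inj X) (susp X);
  susp_confl : forall X, confl (susp_in X) (susp_out X);
  susp_injP : forall X, ex_injective (susp_inj X) }.

Section Triangles.
Variables (E : excat) (I : ideal E) (S : suspension E).
Local Notation "[ f ]" := (fmap (qfun I) f).

(* The graph of the suspension functor of E/I: g = f[1]. The morphism g exists and
   is unique when E/I is the stable category of E. *)
Definition susp_mor (X Y : E) (f : @hom (qcat I) X Y) (g : @hom (qcat I) (S X) (S Y)) :=
  exists (f0 : hom X Y) (h : hom (susp_inj S X) (susp_inj S Y)) (g0 : hom (S X) (S Y)),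
    [/\ f = [f0], g = [g0], h \oo susp_in S X = susp_in S Y \oo f0 &
        g0 \oo susp_out S X = susp_out S Y \oo h].

(* Standard triangles: C is the pushout (cone) of u and X -> I(X) *)
Definition std_triangle (X Y C : E) (u : hom X Y) (v : hom Y C) (w : hom C (S X)) :=
  exists q : hom (susp_inj S X) C,
    [/\ is_pushout (susp_in S X) u q v, w \oo q = susp_out S X & w \oo v = 0].

Definition dist_triangle (X Y Z : E) (u : @hom (qcat I) X Y) (v : @hom (qcat I) Y Z)
    (w : @hom (qcat I) Z (S X)) : Prop :=
  exists (X' Y' Z' : E) (u' : hom X' Y') (v' : hom Y' Z') (w' : hom Z' (S X')),
  std_triangle u' v' w' /\
  exists (a : @hom (qcat I) X X') (b : @hom (qcat I) Y Y') (c : @hom (qcat I) Z Z')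
         (a1 : @hom (qcat I) (S X) (S X')),
    [/\ is_iso a, is_iso b, is_iso c & susp_mor a a1] /\
    [/\ b \oo u = [u'] \oo a, c \oo v = [v'] \oo b & a1 \oo w = [w'] \oo c].

End Triangles.

Section TriangleFunctors.
Variables (E : excat) (I : ideal E) (S : suspension E).
Variables (E' : excat) (I' : ideal E') (S' : suspension E').
Variable G : functor (qcat I) (qcat I').

Definition is_triangle_functor : Prop :=
  exists phi : forall X : E, @hom (qcat I') (G (S X)) (S' (G X)),
    [/\ forall X, is_iso (phi X),
        forall (X Y : E) (f : @hom (qcat I) X Y) g g',
          susp_mor f g -> susp_mor (fmap G f) g' -> g' \oo phi X = phi Y \oo fmap G g &
        forall (X Y Z : E) (u : @hom (qcat I) X Y) (v : @hom (qcat I) Y Z)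
            (w : @hom (qcat I) Z (S X)),
          dist_triangle u v w ->
          @dist_triangle E' I' S' (G X) (G Y) (G Z)
            (fmap G u) (fmap G v) (phi X \oo fmap G w)].

Definition triangle_equivalence : Prop := is_equivalence G /\ is_triangle_functor.

End TriangleFunctors.

Section ModuleCategories.
Variables (A : pzRingType) (P : lmodType A -> Prop).

Let Pobj : Type := {M : lmodType A | P M}.

Fact lhom_cmpA (L M N K : Pobj) (h : lhom (sval N) (sval K))
    (g : lhom (sval M) (sval N)) (f : lhom (sval L) (sval M)) :
  lhom_comp h (lhom_comp g f) = lhom_comp (lhom_comp h g) f.
Proof. exact: lhom_ext. Qed.
Fact lhom_cmp1m (M N : Pobj) (f : lhom (sval M) (sval N)) :
  lhom_comp (lhom_id (sval N)) f = f.
Proof. exact: lhom_ext. Qed.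
Fact lhom_cmpm1 (M N : Pobj) (f : lhom (sval M) (sval N)) :
  lhom_comp f (lhom_id (sval M)) = f.
Proof. exact: lhom_ext. Qed.
Fact lhom_cmpDl (L M N : Pobj) (g h : lhom (sval M) (sval N))
    (f : lhom (sval L) (sval M)) :
  lhom_comp (g + h) f = lhom_comp g f + lhom_comp h f.
Proof. exact: lhom_ext. Qed.
Fact lhom_cmpDr (L M N : Pobj) (h : lhom (sval M) (sval N))
    (f g : lhom (sval L) (sval M)) :
  lhom_comp h (f + g) = lhom_comp h f + lhom_comp h g.
Proof. by apply: lhom_ext => x; apply: (raddfD (h : {linear _ -> _})). Qed.

(* The full subcategory of A-modules satisfying P, with the exact structure
   induced from the category of all A-modules *)
Definition modcat : excat :=
  @Excat
    (@Pacat Pobj (fun M N => lhom (sval M) (sval N)) (fun M => lhom_id (sval M))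
      (fun L M N g f => lhom_comp g f)
      lhom_cmpA lhom_cmp1m lhom_cmpm1 lhom_cmpDl lhom_cmpDr)
    (fun L M N f g => short_exact f g).

Definition factors_add (M X Y : lmodType A) (f : lhom X Y) : Prop :=
  exists (Q : lmodType A) (g : lhom Q Y) (h : lhom X Q), in_add M Q /\ f = lhom_comp g h.

Variable M : lmodType A.

Fact in_add0 : in_add M {ffun 'I_0 -> M}.
Proof. by exists 0%N, (lhom_id _), (lhom_id _); apply: lhom_ext. Qed.

Fact in_addD (Q Q' : lmodType A) : in_add M Q -> in_add M Q' -> in_add M (Q * Q')%type.
Proof.
move=> [n [s [r rs]]] [n' [s' [r' rs']]].
pose sf (x : Q * Q') : {ffun 'I_(n + n') -> M} := [ffun i => match split i with
  | inl j => (lhom_fun s x.1 : {ffun _ -> _}) j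
  | inr j => (lhom_fun s' x.2 : {ffun _ -> _}) j end].
have sfL : linear sf.
  move=> a x y; apply/ffunP => i; rewrite !ffunE.
  by case: split => j; rewrite !lhomP !ffunE.
pose cl (c : {ffun 'I_(n + n') -> M}) : {ffun 'I_n -> M} := [ffun j => c (lshift n' j)].
pose cr (c : {ffun 'I_(n + n') -> M}) : {ffun 'I_n' -> M} := [ffun j => c (rshift n j)].
pose rf (c : {ffun 'I_(n + n') -> M}) := (lhom_fun r (cl c), lhom_fun r' (cr c)).
have rfL : linear rf.
  move=> a c d; rewrite /rf.
  have -> : cl (a *: c + d) = a *: cl c + cl d by apply/ffunP => j; rewrite !ffunE.
  have -> : cr (a *: c + d) = a *: cr c + cr d by apply/ffunP => j; rewrite !ffunE.
  by rewrite !lhomP.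
exists (n + n')%N, (mklhom sfL), (mklhom rfL); apply: lhom_ext => -[x y].
rewrite [LHS]/(rf (sf (x, y))) /rf.
have -> : cl (sf (x, y)) = lhom_fun s x.
  by apply/ffunP => j; rewrite !ffunE (unsplitK (inl j : 'I_n + 'I_n')).
have -> : cr (sf (x, y)) = lhom_fun s' y.
  by apply/ffunP => j; rewrite !ffunE (unsplitK (inr j : 'I_n + 'I_n')).
move/(congr1 (fun h => lhom_fun h x)): rs => /= rs.
move/(congr1 (fun h => lhom_fun h y)): rs' => /= rs'.
by congr pair.
Qed.

Fact factors_add0 (X Y : modcat) : factors_add M (0 : hom X Y).
Proof.
exists {ffun 'I_0 -> M}, 0, 0; split; first exact: in_add0.
exact: lhom_ext.
Qed.
Fact factors_addB (X Y : modcat) (f g : hom X Y) :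
  factors_add M f -> factors_add M g -> factors_add M (f - g).
Proof.
move=> [Q [f2 [f1 [addQ ->]]]] [Q' [g2 [g1 [addQ' ->]]]].
have iL : linear (fun x : sval X => (lhom_fun f1 x, lhom_fun g1 x)).
  by move=> a x y; rewrite !lhomP.
have pL : linear (fun q : Q * Q' => lhom_fun f2 q.1 - lhom_fun g2 q.2 : sval Y).
  by move=> a x y; rewrite !lhomP opprD addrACA scalerBr.
exists (Q * Q')%type, (mklhom pL), (mklhom iL); split; first exact: in_addD.
exact: lhom_ext.
Qed.
Fact factors_add_l (X Y Z : modcat) (g : hom Y Z) (f : hom X Y) :
  factors_add M f -> factors_add M (g \oo f).
Proof.
move=> [Q [f2 [f1 [addQ ->]]]]; exists Q, (lhom_comp g f2), f1; split=> //.
exact: lhom_ext.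
Qed.
Fact factors_add_r (X Y Z : modcat) (g : hom Y Z) (f : hom X Y) :
  factors_add M g -> factors_add M (g \oo f).
Proof.
move=> [Q [g2 [g1 [addQ ->]]]]; exists Q, g2, (lhom_comp g1 f); split=> //.
exact: lhom_ext.
Qed.

(* [M] : the morphisms factoring through add M *)
Definition add_ideal : ideal modcat := @Ideal modcat
  (fun X Y f => factors_add M f)
  factors_add0 factors_addB factors_add_l factors_add_r.

End ModuleCategories.

Arguments add_ideal {A P} M.

Definition mod_fg (A : pzRingType) : excat := modcat (@fin_gen A).

(* CM_e A *)
Definition CMe (R : comNzRingType) (A : algType R) (e : idem_elt A) : excat :=
  modcat (fun X : lmodType A =>
    [/\ fin_gen X, free_fin_rank (@restr R A X : lmodType R) &
        fg_projective (emod e X : lmodType (corner e))]).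

(* Main.v *)
(* Put L = B[[t]]. An object X of CM_e A is a pair of L-modules t X_1 <= X_2 <= X_1 with X_1
   projective, and the equivalence is X |-> X / AeX = X_2 / t X_1. It is faithful since a
   morphism that it kills factors through AeX, which lies in add Ae; full since AeY is
   injective in CM_e A, so that X -> X / AeX -> Y / AeY lifts along Y -> Y / AeY; dense since
   a B-module M embeds in some B^n and is the image of the submodule of A^n that lies over it.
   The embedding in B^n, the Gorenstein property and the injectivity of A in CM_e A all rest on
   the projectivity of the left B-module D = Hom_k(B, k). Selfinjectivity makes B a summand of
   D^n, so one trace map of the Morita context (D, Hom_B(D, B)) between B and End(D) = B is
   onto. If the other were not, it would turn every strict chain of two-sided ideals of B into
   a longer one, which is absurd. The induced functor of stable categories is a triangle
   functor because X |-> X / AeX is exact on CM_e A and preserves injectives. *)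

From HB Require Import structures.
From mathcomp Require Import all_boot all_order all_algebra all_field.
From mathcomp Require Import boolp.
Require Import Defs.

Set Implicit Arguments.
Unset Strict Implicit.
Unset Printing Implicit Defensive.

Import GRing.Theory.
Local Open Scope ring_scope.

(** * Submodules, quotients and short exact sequences *)

(** Selfinjectivity does not make D isomorphic to B as a B-module, so A need not be isomorphic to
    Hom_R(A, R), and maps into A are not simply R-functionals. The substitute is [theta]: an
    R-functional on an A-module W and a B-map D -> B together yield an A-map W -> A. A relation sum
    f_i(d_i) = 1 makes maps into A extend along every A-map that splits over R; a dual basis of D
    makes the maps [theta] numerous enough to recover every functional. As R is a principal ideal
    domain, conflations of CM_e A do split over R.

    Morphisms of (CM_e A)/[Ae] are classes and its conflations are defined up to isomorphism, so
    Quillen's axioms are not checked there: they are pulled back from mod B along a full, faithful,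
    dense functor that preserves and reflects conflations. Reflection is the delicate half, since a
    representative of a deflation need not be surjective.

    For triangles, the functor does not respect the chosen conflations X -> I(X) -> X[1]; comparing
    its image of such a conflation with the one chosen for the image of X produces the natural
    isomorphism with the suspension. *)

Coercion lhom_fun : lhom >-> Funclass.
Notation "f $ x" := (lhom_fun f x) (at level 10, x at level 9, left associativity).

Section LinearMapTheory.
Variables (A : pzRingType) (M N : lmodType A).
Implicit Types f g : lhom M N.

Lemma lhomD f x y : f (x + y) = f x + f y.
Proof. exact: (raddfD (f : {linear _ -> _})). Qed.
Lemma lhom0 f : f 0 = 0.
Proof. exact: (raddf0 (f : {linear _ -> _})). Qed.
Lemma lhomN f x : f (- x) = - f x.
Proof. exact: (raddfN (f : {linear _ -> _})). Qed.
Lemma lhomB f x y : f (x - y) = f x - f y.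
Proof. exact: (raddfB (f : {linear _ -> _})). Qed.
Lemma lhomZ f a x : f (a *: x) = a *: f x.
Proof. exact: (linearZ_LR (f : {linear _ -> _})). Qed.
Lemma lhom_sum f (I : Type) (r : seq I) (P : pred I) (E : I -> M) :
  f (\sum_(i <- r | P i) E i) = \sum_(i <- r | P i) f (E i).
Proof. exact: (raddf_sum (f : {linear _ -> _})). Qed.

Lemma mklhomE (f : M -> N) (fL : linear f) x : mklhom fL x = f x.
Proof. by []. Qed.

Lemma lhom_addE f g x : lhom_fun (f + g) x = f x + g x.
Proof. by []. Qed.
Lemma lhom_subE f g x : lhom_fun (f - g) x = f x - g x.
Proof. by []. Qed.
Lemma lhom_zeroE x : lhom_fun (0 : lhom M N) x = 0.
Proof. by []. Qed.

Lemma lhom_inj0 f : (forall x, f x = 0 -> x = 0) -> injective f.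
Proof. by move=> f0 x y e; apply/subr0_eq/f0; rewrite lhomB e subrr. Qed.

Lemma lhom_inj_eq0 f x : injective f -> f x = 0 -> x = 0.
Proof. by move=> fI; rewrite -(lhom0 f) => /fI. Qed.

(** Linear maps are obtained below from linear relations. Uniqueness at 0 suffices, because the
    difference of two values at x is a value at 0. *)
Lemma linear_graph (Q : M -> N -> Prop) :
  (forall x, exists y, Q x y) -> (forall y, Q 0 y -> y = 0) ->
  (forall a x y x' y', Q x y -> Q x' y' -> Q (a *: x + x') (a *: y + y')) ->
  exists f : lhom M N, forall x, Q x (f x).
Proof.
move=> tot Q0 QL.
have Qu x y y' : Q x y -> Q x y' -> y = y'.
  move=> q q'; apply/subr0_eq/Q0.
  by have := QL (-1) x y' x y q' q; rewrite !scaleN1r addNr addrC.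
have [f fQ] := choice tot.
have fL : linear f by move=> a x y; apply: (Qu (a *: x + y)) => //; apply: QL.
by exists (mklhom fL).
Qed.

End LinearMapTheory.

Lemma lhom_compE (A : pzRingType) (L M N : lmodType A) (g : lhom M N) (f : lhom L M) x :
  lhom_comp g f x = g (f x).
Proof. by []. Qed.

Lemma lhom_eqE (A : pzRingType) (M N : lmodType A) (f g : lhom M N) x : f = g -> f x = g x.
Proof. by move->. Qed.

Section Factorisation.
Variable A : pzRingType.

Lemma lhom_factor_surj (X Y W : lmodType A) (p : lhom X Y) (f : lhom X W) :
  (forall y, exists x, p x = y) -> (forall x, p x = 0 -> f x = 0) ->
  exists g : lhom Y W, forall x, g (p x) = f x.
Proof.
move=> ps pf.
have [||a y w y' w' [x [<- <-]] [x' [<- <-]]|g gP] :=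
    @linear_graph A Y W (fun y w => exists x, p x = y /\ f x = w).
- by move=> y; have [x <-] := ps y; exists (f x), x.
- by move=> w [x [/pf -> <-]].
- by exists (a *: x + x'); rewrite !lhomP.
exists g => x; have [x' [e <-]] := gP (p x).
by apply/subr0_eq; rewrite -lhomB; apply: pf; rewrite lhomB e subrr.
Qed.

Lemma lhom_factor_inj (X Y W : lmodType A) (i : lhom X Y) (f : lhom W Y) :
  injective i -> (forall w, exists x, i x = f w) ->
  exists g : lhom W X, forall w, i (g w) = f w.
Proof.
move=> iI fi.
have [|||g gP] := @linear_graph A W X (fun w x => i x = f w) => //.
- by move=> x; rewrite lhom0 -(lhom0 i) => /iI.
- by move=> a w x w' x' e e'; rewrite !lhomP e e'.
by exists g.
Qed.

End Factorisation.

Section Submodules.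
Variable A : pzRingType.

(** Membership is a proposition, since kernels and images are not decidable here; the boolean
    predicate that subtypes and quotients require is obtained classically. *)
Record submod (X : lmodType A) := Submod {
  smem :> X -> Prop;
  smem0 : smem 0;
  smemP : forall a x y, smem x -> smem y -> smem (a *: x + y) }.

Variables (X : lmodType A) (N : submod X).

Definition submod_pred : {pred X} := fun x => `[< N x >].

Lemma submod_predP x : x \in submod_pred <-> N x.
Proof. by split => [/asboolP|h] //; apply/asboolP. Qed.

Fact submod_pred_closed : submod_closed submod_pred.
Proof.
split; first exact/submod_predP/smem0.
by move=> a x y /submod_predP xN /submod_predP yN; apply/submod_predP/smemP.
Qed.
HB.instance Definition _ :=
  GRing.isSubmodClosed.Build A X submod_pred submod_pred_closed.

Record subm : Type := Subm { subm_val : X; _ : subm_val \in submod_pred }.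
HB.instance Definition _ := [isSub of subm for subm_val].
HB.instance Definition _ := [Choice of subm by <:].
HB.instance Definition _ := [SubChoice_isSubLmodule of subm by <:].

Definition quotm : Type := Quotient.quot submod_pred.
HB.instance Definition _ := GRing.Zmodule.on quotm.

Definition quotm_pi0 (x : X) : quotm := (\pi_(Quotient.quot submod_pred) x)%qT.

Lemma quotm_pi0_eq x y : quotm_pi0 x = quotm_pi0 y <-> N (x - y).
Proof.
rewrite (rwP eqP) /quotm_pi0 -Quotient.idealrBE; exact: submod_predP.
Qed.

Lemma quotm_reprK : cancel (fun u : quotm => repr u : X) quotm_pi0.
Proof. by move=> u; apply: reprK. Qed.

Lemma quotm_pi0D : {morph quotm_pi0 : x y / x + y}.
Proof. by move=> x y; rewrite /quotm_pi0 !piE. Qed.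

Definition quotm_scale (a : A) (u : quotm) : quotm := quotm_pi0 (a *: repr u).

Lemma quotm_scale_pi a x : quotm_scale a (quotm_pi0 x) = quotm_pi0 (a *: x).
Proof.
apply/quotm_pi0_eq; rewrite -scalerBr -[_ *: _]addr0; apply: smemP; last exact: smem0.
by apply/quotm_pi0_eq; rewrite quotm_reprK.
Qed.

Fact quotm_scaleA a b u : quotm_scale a (quotm_scale b u) = quotm_scale (a * b) u.
Proof. by rewrite -[u]quotm_reprK !quotm_scale_pi scalerA. Qed.
Fact quotm_scale1 : left_id 1 quotm_scale.
Proof. by move=> u; rewrite -[u]quotm_reprK quotm_scale_pi scale1r. Qed.
Fact quotm_scaleDr : right_distributive quotm_scale +%R.
Proof.
move=> a u v; rewrite -[u]quotm_reprK -[v]quotm_reprK.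
by rewrite -quotm_pi0D !quotm_scale_pi scalerDr quotm_pi0D.
Qed.
Fact quotm_scaleDl u : {morph quotm_scale^~ u : a b / a + b}.
Proof.
by move=> a b; rewrite -[u]quotm_reprK !quotm_scale_pi scalerDl quotm_pi0D.
Qed.
HB.instance Definition _ := GRing.Zmodule_isLmodule.Build A quotm
  quotm_scaleA quotm_scale1 quotm_scaleDr quotm_scaleDl.

Fact subm_inP : linear (fun u : subm => val u).
Proof. by []. Qed.
Definition subm_in : lhom subm X := mklhom subm_inP.

Fact quotm_piP : linear quotm_pi0.
Proof. by move=> a x y; rewrite quotm_pi0D -quotm_scale_pi. Qed.
Definition quotm_pi : lhom X quotm := mklhom quotm_piP.

Lemma subm_in_inj : injective subm_in.
Proof. exact: val_inj. Qed.
Lemma subm_inN u : N (subm_in u).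
Proof. exact/submod_predP/valP. Qed.
Lemma subm_inE x : N x <-> exists u, subm_in u = x.
Proof.
split=> [/submod_predP xN|[u <-]]; last exact: subm_inN.
by exists (Subm xN).
Qed.

Lemma quotm_pi_surj u : exists x, quotm_pi x = u.
Proof. by exists (repr u); apply: quotm_reprK. Qed.
Lemma quotm_pi_eq0 x : quotm_pi x = 0 <-> N x.
Proof. by rewrite -(lhom0 quotm_pi) quotm_pi0_eq subr0. Qed.

Lemma subm_quotm_exact : short_exact subm_in quotm_pi.
Proof.
split; [exact: subm_in_inj | exact: quotm_pi_surj | move=> x].
by rewrite quotm_pi_eq0; apply: subm_inE.
Qed.

End Submodules.

Section KernelImage.
Variables (A : pzRingType) (X Y : lmodType A) (f : lhom X Y).

Fact lkerm_subproof a x y : f x = 0 -> f y = 0 -> f (a *: x + y) = 0.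
Proof. by rewrite lhomP => -> ->; rewrite scaler0 addr0. Qed.
Definition lkerm : submod X := Submod (lhom0 f) lkerm_subproof.

Fact limm0 : exists x, f x = 0. Proof. by exists 0; apply: lhom0. Qed.
Fact limm_subproof a y y' :
  (exists x, f x = y) -> (exists x, f x = y') -> exists x, f x = a *: y + y'.
Proof. by move=> [x <-] [x' <-]; exists (a *: x + x'); rewrite lhomP. Qed.
Definition limm : submod Y := Submod limm0 limm_subproof.

Lemma ker_exact : (forall y, exists x, f x = y) -> short_exact (subm_in lkerm) f.
Proof.
by move=> fs; split=> //; [exact: subm_in_inj | move=> x; apply: (subm_inE lkerm)].
Qed.

Lemma coker_exact : injective f -> short_exact f (quotm_pi limm).
Proof.
by move=> fI; split=> //; [exact: quotm_pi_surj | move=> y; apply: quotm_pi_eq0].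
Qed.

End KernelImage.

Lemma lhom_bij_inv (A : pzRingType) (X Y : lmodType A) (f : lhom X Y) :
  injective f -> (forall y, exists x, f x = y) ->
  exists g : lhom Y X, lhom_comp g f = lhom_id X /\ lhom_comp f g = lhom_id Y.
Proof.
move=> fI fs; have [|g gP] := lhom_factor_inj (f := lhom_id Y) fI; first exact: fs.
exists g; split; apply: lhom_ext => x; last exact: gP.
by apply: fI; apply: gP.
Qed.

Section ShortExact.
Variables (A : pzRingType) (L M N : lmodType A) (f : lhom L M) (g : lhom M N).
Hypothesis fg : short_exact f g.

Lemma ses_inj : injective f. Proof. by case: fg. Qed.
Lemma ses_surj z : exists y, g y = z. Proof. by case: fg. Qed.
Lemma ses_mid y : g y = 0 -> exists x, f x = y. Proof. by case: fg => _ _ h /h. Qed.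
Lemma ses_cmp0 x : g (f x) = 0. Proof. by case: fg => _ _ h; apply/h; exists x. Qed.

Lemma ses_section_retraction (s : lhom N M) : lhom_comp g s = lhom_id N ->
  exists r : lhom M L, lhom_comp r f = lhom_id L /\ forall y, y = f (r y) + s (g y).
Proof.
move=> gs; have gsE z : g (s z) = z := lhom_eqE z gs.
have [|r rP] := lhom_factor_inj (f := lhom_id M - lhom_comp s g) ses_inj.
  by move=> y; apply: ses_mid; rewrite lhom_subE lhomB [g (lhom_comp s g y)]gsE subrr.
exists r; split; last by move=> y; rewrite rP lhom_subE subrK.
apply: lhom_ext => x; apply: ses_inj; rewrite [LHS](rP (f x)) lhom_subE.
by rewrite [lhom_comp s g _]lhom_compE ses_cmp0 lhom0 subr0.
Qed.

End ShortExact.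

(** * Exact categories of modules *)

Lemma is_iso_idm (C : pacat) (X : C) : is_iso (idm X).
Proof. by exists (idm X); rewrite cmp1m. Qed.

Lemma is_iso_cmp (C : pacat) (X Y Z : C) (g : hom Y Z) (f : hom X Y) :
  is_iso g -> is_iso f -> is_iso (g \oo f).
Proof.
move=> [g' [g'g gg']] [f' [f'f ff']]; exists (f' \oo g'); split.
  by rewrite -cmpA (cmpA g') g'g cmp1m.
by rewrite -cmpA (cmpA f) ff' cmp1m.
Qed.

(** These two conditions yield all of Quillen's axioms: every object that the axioms ask for is the
    middle term of a short exact sequence whose outer terms are already in the class. *)
Record ext_closed (A : pzRingType) (P : lmodType A -> Prop) : Prop := ExtClosed {
  ext_closed0 : forall M : lmodType A, (forall x : M, x = 0) -> P M;
  ext_closedX : forall (L M N : lmodType A) (f : lhom L M) (g : lhom M N),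
    short_exact f g -> P L -> P N -> P M }.

Section ModuleCategory.
Variables (A : pzRingType) (P : lmodType A -> Prop).
Notation E := (modcat P).

Definition mobj M (PM : P M) : E := exist _ M PM.

Lemma modcat_cmpE (X Y Z : E) (g : hom Y Z) (f : hom X Y) x :
  (g \oo f : lhom _ _) $ x = g $ (f $ x).
Proof. by []. Qed.

Lemma modcat_isoP (X Y : E) (f : hom X Y) :
  is_iso f <-> injective (lhom_fun f) /\ forall y, exists x, lhom_fun f x = y.
Proof.
split=> [[g [gf fg]]|[fI fs]].
  split=> [|y]; last by exists (lhom_fun g y); apply: (lhom_eqE y fg).
  by apply: (can_inj (g := lhom_fun g)) => x; apply: (lhom_eqE x gf).
by have [g [gf fg]] := lhom_bij_inv fI fs; exists g.
Qed.

Lemma confl_is_kernel (X Y Z : E) (f : hom X Y) (g : hom Y Z) :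
  confl f g -> is_kernel f g.
Proof.
move=> fg; split=> [|W h gh0]; first by apply: lhom_ext => x; apply: (ses_cmp0 fg).
have [|l fl] := lhom_factor_inj (f := h) (ses_inj fg).
  by move=> w; apply: (ses_mid fg); apply: (lhom_eqE w gh0).
exists l; split=> [|l' fl']; first by apply: lhom_ext => w; apply: fl.
apply: lhom_ext => w; apply: (ses_inj fg); rewrite fl.
exact/esym/(lhom_eqE w fl').
Qed.

Lemma confl_is_cokernel (X Y Z : E) (f : hom X Y) (g : hom Y Z) :
  confl f g -> is_cokernel g f.
Proof.
move=> fg; split=> [|W h hf0]; first by apply: lhom_ext => x; apply: (ses_cmp0 fg).
have [|l lg] := lhom_factor_surj (f := h) (ses_surj fg).
  by move=> y /(ses_mid fg)[x <-]; apply: (lhom_eqE x hf0).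
exists l; split=> [|l' l'g]; first by apply: lhom_ext => y; apply: lg.
apply: lhom_ext => z; have [y <-] := ses_surj fg z; rewrite lg.
exact/esym/(lhom_eqE y l'g).
Qed.

(** Equality of the cokernels gives W = b(Y) + f'(X'), and b y + f' x' = 0 forces y = f x and x' = -
    a x for some x. So a compatible pair (h, h') determines the map on W and leaves no ambiguity. *)
Lemma confl_is_pushout (X Y Z X' W : E) (f : hom X Y) (g : hom Y Z) (a : hom X X')
    (b : hom Y W) (f' : hom X' W) (g' : hom W Z) :
  confl f g -> confl f' g' -> b \oo f = f' \oo a -> g' \oo b = g ->
  is_pushout f a b f'.
Proof.
move=> fg fg' bf g'b; split=> // V h h' hf.
have bfE x : b $ (f $ x) = f' $ (a $ x) := lhom_eqE x bf.
have g'bE y : g' $ (b $ y) = g $ y := lhom_eqE y g'b.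
have hfE x : h $ (f $ x) = h' $ (a $ x) := lhom_eqE x hf.
have sum w : exists y x', b $ y + f' $ x' = w.
  have [y gy] := ses_surj fg (g' $ w); have [|x' e] := @ses_mid _ _ _ _ _ _ fg' (w - b $ y).
    by rewrite lhomB g'bE gy subrr.
  by exists y, x'; rewrite e addrC subrK.
have [|v [y [x' [e <-]]]|c w v w' v' [y [x [<- <-]]] [y' [x' [<- <-]]]|l lP] :=
    @linear_graph A (sval W) (sval V)
      (fun w v => exists y x', b $ y + f' $ x' = w /\ h $ y + h' $ x' = v).
- by move=> w; have [y [x' e]] := sum w; exists (h $ y + h' $ x'), y, x'.
- have [|x fx] := @ses_mid _ _ _ _ _ _ fg y.
    by rewrite -g'bE -[b $ y](addrK (f' $ x')) e sub0r lhomN (ses_cmp0 fg') oppr0.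
  rewrite -fx hfE -lhomD; move: e; rewrite -fx bfE -lhomD.
  by move/(lhom_inj_eq0 (ses_inj fg')) ->; rewrite lhom0.
- exists (c *: y + y'), (c *: x + x'); by split; rewrite !lhomP scalerDr addrACA.
have lE y x' : l (b $ y + f' $ x') = h $ y + h' $ x'.
  have [y1 [x1 [e <-]]] := lP (b $ y + f' $ x').
  apply/subr0_eq; rewrite opprD addrACA -!lhomB.
  have e0 : b $ (y1 - y) + f' $ (x1 - x') = 0 by rewrite !lhomB addrACA -opprD e subrr.
  have [|x fx] := @ses_mid _ _ _ _ _ _ fg (y1 - y).
    by rewrite -g'bE (canRL (addrK _) e0) sub0r lhomN (ses_cmp0 fg') oppr0.
  rewrite -fx hfE -lhomD; move: e0; rewrite -fx bfE -lhomD.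
  by move/(lhom_inj_eq0 (ses_inj fg')) ->; rewrite lhom0.
exists l; split=> [|l' [l'b l'f]].
  split; apply: lhom_ext => u.
    by have := lE u 0; rewrite !lhom0 !addr0.
  by have := lE 0 u; rewrite !lhom0 !add0r.
apply: lhom_ext => w; have [y [x' <-]] := sum w; rewrite lE lhomD; congr (_ + _).
  exact/esym/(lhom_eqE y l'b).
exact/esym/(lhom_eqE x' l'f).
Qed.

(** Dual to the pushout criterion: [b] and [g'] are jointly injective, because the kernel of [g'] is
    the image of [f'], on which [b] acts as the injective [f]. *)
Lemma confl_is_pullback (X W Y Z' Z : E) (f : hom X Y) (g : hom Y Z) (a : hom Z' Z)
    (f' : hom X W) (g' : hom W Z') (b : hom W Y) :
  confl f g -> confl f' g' -> g \oo b = a \oo g' -> b \oo f' = f ->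
  is_pullback b g' g a.
Proof.
move=> fg fg' gb bf'; split=> // V h h' gh.
have gbE w : g $ (b $ w) = a $ (g' $ w) := lhom_eqE w gb.
have bf'E x : b $ (f' $ x) = f $ x := lhom_eqE x bf'.
have ghE v : g $ (h $ v) = a $ (h' $ v) := lhom_eqE v gh.
have jI w : b $ w = 0 -> g' $ w = 0 -> w = 0.
  move=> bw /(ses_mid fg')[x xw]; rewrite -xw; move: bw; rewrite -xw bf'E.
  by move/(lhom_inj_eq0 (ses_inj fg)) ->; rewrite lhom0.
have [|w [bw g'w]|c v w v' w' [e1 e2] [e1' e2']|l lP] :=
    @linear_graph A (sval V) (sval W) (fun v w => b $ w = h $ v /\ g' $ w = h' $ v).
- move=> v; have [w1 g'w1] := ses_surj fg' (h' $ v).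
  have [|x fx] := @ses_mid _ _ _ _ _ _ fg (h $ v - b $ w1).
    by rewrite lhomB gbE g'w1 ghE subrr.
  exists (w1 + f' $ x); rewrite !lhomD bf'E fx (ses_cmp0 fg') addr0 g'w1.
  by rewrite addrC subrK.
- by apply: jI; rewrite ?bw ?g'w lhom0.
- by rewrite !lhomP e1 e2 e1' e2'.
exists l; split=> [|l' [bl' g'l']].
  by split; apply: lhom_ext => v; have [] := lP v.
apply: lhom_ext => v; apply/subr0_eq; have [e1 e2] := lP v; apply: jI; rewrite lhomB.
  by rewrite e1 [b $ (l' $ v)](lhom_eqE v bl') subrr.
by rewrite e2 [g' $ (l' $ v)](lhom_eqE v g'l') subrr.
Qed.

Lemma confl_iso (X Y Z X' Y' Z' : E) (f : hom X Y) (g : hom Y Z)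
    (f' : hom X' Y') (g' : hom Y' Z') (a : hom X X') (b : hom Y Y') (c : hom Z Z') :
  is_iso a -> is_iso b -> is_iso c ->
  b \oo f = f' \oo a -> c \oo g = g' \oo b -> confl f g -> confl f' g'.
Proof.
move=> /modcat_isoP[aI sa] /modcat_isoP[bI sb] /modcat_isoP[cI sc] bf cg fg.
have bfE x : b $ (f $ x) = f' $ (a $ x) := lhom_eqE x bf.
have cgE y : c $ (g $ y) = g' $ (b $ y) := lhom_eqE y cg.
split=> [x' x''|z'|y'].
- have [[x <-] [y <-]] := (sa x', sa x''); rewrite -!bfE => /bI/(ses_inj fg) -> //.
- have [z <-] := sc z'; have [y <-] := ses_surj fg z.
  by exists (b $ y); rewrite -cgE.
have [y <-] := sb y'; rewrite -cgE; split=> [|[x' e]].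
  by move/(lhom_inj_eq0 cI)/(ses_mid fg) => [x <-]; exists (a $ x); rewrite -bfE.
by have [x ex] := sa x'; move: e; rewrite -ex -bfE => /bI <-; rewrite (ses_cmp0 fg) lhom0.
Qed.

Hypothesis PE : ext_closed P.

Lemma ext_closed_zero : exists Z : E, forall z : sval Z, z = 0.
Proof.
have z0 (z : {ffun 'I_0 -> A^o}) : z = 0 by apply/ffunP => -[].
by exists (mobj (ext_closed0 PE z0)).
Qed.

Lemma ext_closed_biproduct (X Y : E) : exists W i j p q, @is_biproduct E X Y W i j p q.
Proof.
have iL : linear (fun x : sval X => (x, 0 : sval Y)).
  by move=> a x y; congr pair; rewrite /= scaler0 addr0.
have jL : linear (fun y : sval Y => (0 : sval X, y)).
  by move=> a x y; congr pair; rewrite /= scaler0 addr0.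
have pL : linear (fun w : (sval X * sval Y)%type => w.1) by [].
have qL : linear (fun w : (sval X * sval Y)%type => w.2) by [].
have PW : P (sval X * sval Y)%type.
  apply: (ext_closedX PE (f := mklhom iL) (g := mklhom qL)); try exact: svalP.
  split=> [x y []|y|[x y]] //; first by exists (0, y).
  by rewrite mklhomE /=; split=> [->|[x' [_ <-]]] //; exists x.
exists (mobj PW), (mklhom iL), (mklhom jL), (mklhom pL), (mklhom qL).
split; apply: lhom_ext => w //.
rewrite [LHS]lhom_addE !modcat_cmpE !mklhomE /=; case: w => x y.
by congr pair; rewrite /= ?addr0 ?add0r.
Qed.

Lemma confl_id_l (X : E) : exists Z (g : hom X Z), confl (idm X) g.
Proof.
have [Z Z0] := ext_closed_zero; exists Z, 0; split=> // [z|x].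
  by exists 0; rewrite (Z0 z) (Z0 (_ $ _)).
by split=> // _; exists x.
Qed.

Lemma confl_id_r (X : E) : exists Z (f : hom Z X), confl f (idm X).
Proof.
have [Z Z0] := ext_closed_zero; exists Z, 0; split=> // [z z' _|x|x].
- by rewrite (Z0 z) (Z0 z').
- by exists x.
split=> [|[z <-]]; last by rewrite lhom_zeroE lhom0.
by move=> x0; exists 0; rewrite lhom_zeroE; exact/esym/x0.
Qed.

(** The cokernel of the composite is an extension of the cokernel of [g] by the cokernel of [f]. *)
Lemma ext_closed_infl_cmp (X Y Z : E) (g : hom Y Z) (f : hom X Y) :
  inflation g -> inflation f -> inflation (g \oo f).
Proof.
move=> [C [p gp]] [D [q fq]]; pose h : lhom (sval X) (sval Z) := g \oo f.
have hI : injective h by move=> x y /(ses_inj gp)/(ses_inj fq).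
have hp := coker_exact hI; pose pi := quotm_pi (limm h).
have [|u uP] := @lhom_factor_surj _ _ _ _ q (lhom_comp pi g) (ses_surj fq).
  move=> y /(ses_mid fq)[x <-]; exact: (ses_cmp0 hp).
have [|v vP] := @lhom_factor_surj _ _ _ _ pi p (ses_surj hp).
  by move=> z /(ses_mid hp)[x <-]; apply: (ses_cmp0 gp).
have PW : P (quotm (limm h)).
  apply: (ext_closedX PE (f := u) (g := v)); try exact: svalP.
  split.
  - apply: lhom_inj0 => d; have [y <-] := ses_surj fq d; rewrite uP.
    by move=> /(ses_mid hp)[x /(ses_inj gp) <-]; apply: (ses_cmp0 fq).
  - by move=> c; have [z <-] := ses_surj gp c; exists (pi z).
  move=> w; have [z <-] := ses_surj hp w; rewrite [v _]vP; split.
    by move=> /(ses_mid gp)[y <-]; exists (q $ y); apply: uP.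
  move=> [d]; have [y <-] := ses_surj fq d; rewrite uP => e.
  have [|x] := @ses_mid _ _ _ _ _ _ hp (z - g $ y).
    by rewrite lhomB -e subrr.
  move=> /esym/(canRL (subrK _)) ->.
  by rewrite lhomD (ses_cmp0 gp) addr0; apply: (ses_cmp0 gp).
by exists (mobj PW), pi.
Qed.

(** The kernel of the composite is an extension of the kernel of [g] by the kernel of [f]. *)
Lemma ext_closed_defl_cmp (X Y Z : E) (g : hom Y Z) (f : hom X Y) :
  deflation g -> deflation f -> deflation (g \oo f).
Proof.
move=> [L [i ig]] [K [j jf]]; pose h : lhom (sval X) (sval Z) := g \oo f.
have hs z : exists x, h x = z.
  by have [y <-] := ses_surj ig z; have [x <-] := ses_surj jf y; exists x.
have kh := ker_exact hs; pose ka := subm_in (lkerm h).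
have [|u uP] := @lhom_factor_inj _ _ _ _ ka j (ses_inj kh).
  by move=> k; apply: (ses_mid kh); rewrite /h modcat_cmpE (ses_cmp0 jf) lhom0.
have [|v vP] := @lhom_factor_inj _ _ _ _ i (lhom_comp f ka) (ses_inj ig).
  by move=> w; apply: (ses_mid ig); apply: (ses_cmp0 kh).
have PW : P (subm (lkerm h)).
  apply: (ext_closedX PE (f := u) (g := v)); try exact: svalP.
  split.
  - by apply: lhom_inj0 => k e; apply: (lhom_inj_eq0 (ses_inj jf)); rewrite -uP e lhom0.
  - move=> l; have [x fx] := ses_surj jf (i $ l).
    have [|w wx] := @ses_mid _ _ _ _ _ _ kh x; first by rewrite /h modcat_cmpE fx (ses_cmp0 ig).
    by exists w; apply: (ses_inj ig); rewrite vP lhom_compE [ka w]wx.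
  move=> w; split=> [e|[k <-]].
    have [|k kw] := @ses_mid _ _ _ _ _ _ jf (ka w).
      by rewrite -[LHS](vP w) e lhom0.
    by exists k; apply: (ses_inj kh); rewrite uP.
  apply: (lhom_inj_eq0 (ses_inj ig)).
  by rewrite vP lhom_compE uP (ses_cmp0 jf).
by exists (mobj PW), ka.
Qed.

Lemma ext_closed_pushout (X Y Z X' : E) (f : hom X Y) (g : hom Y Z) (a : hom X X') :
  confl f g -> exists (W : E) (b : hom Y W) (f' : hom X' W) (g' : hom W Z),
    [/\ confl f' g', b \oo f = f' \oo a & g' \oo b = g].
Proof.
move=> fg.
have dL : linear (fun x : sval X => (f $ x, - (a $ x)) : sval Y * sval X').
  by move=> c x y; rewrite !lhomP opprD -scalerN.
have gL : linear (fun w : sval Y * sval X' => g $ w.1 : sval Z).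
  by move=> c x y; rewrite -lhomP.
have bL : linear (fun y : sval Y => (y, 0) : sval Y * sval X').
  by move=> c x y; congr pair; rewrite /= scaler0 addr0.
have fL : linear (fun x : sval X' => (0, x) : sval Y * sval X').
  by move=> c x y; congr pair; rewrite /= scaler0 addr0.
pose d := mklhom dL; pose pi := quotm_pi (limm d).
have piP := @quotm_pi_eq0 _ _ (limm d).
have [||g' g'P] := @lhom_factor_surj _ _ _ _ pi (mklhom gL).
- exact: quotm_pi_surj.
- by move=> w /piP[x <-]; apply: (ses_cmp0 fg).
have fg' : short_exact (lhom_comp pi (mklhom fL)) g'.
  split.
  - apply: lhom_inj0 => x' /piP[x [/(lhom_inj_eq0 (ses_inj fg)) -> <-]].
    by rewrite lhom0 oppr0.
  - move=> z; have [y <-] := ses_surj fg z.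
    by exists (pi (y, 0)); rewrite g'P.
  move=> w; have [[y x'] <-] := quotm_pi_surj w; rewrite [g' _]g'P; split.
    move=> /(ses_mid fg)[x fx]; exists (x' + a $ x).
    apply/subr0_eq; rewrite lhom_compE -lhomB; apply/piP; exists (- x).
    by rewrite !mklhomE; congr pair; rewrite lhomN ?opprK ?fx ?sub0r //= addrC addKr.
  move=> [u]; rewrite lhom_compE => e.
  have /piP[x [+ _]] : pi (mklhom fL u - (y, x')) = 0 by rewrite lhomB e subrr.
  rewrite mklhomE /= sub0r => /(congr1 -%R); rewrite opprK => <-.
  by rewrite lhomN (ses_cmp0 fg) oppr0.
have PW : P (quotm (limm d)) by apply: (ext_closedX PE fg'); apply: svalP.
exists (mobj PW), (lhom_comp pi (mklhom bL)), (lhom_comp pi (mklhom fL)), g'; split=> //.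
  apply: lhom_ext => x; apply/subr0_eq; rewrite !modcat_cmpE !lhom_compE -lhomB.
  by apply/piP; exists x; rewrite !mklhomE; congr pair; rewrite /= ?subr0 ?sub0r.
by apply: lhom_ext => y; rewrite modcat_cmpE lhom_compE g'P.
Qed.

Lemma ext_closed_pullback (X Y Z Z' : E) (f : hom X Y) (g : hom Y Z) (a : hom Z' Z) :
  confl f g -> exists (W : E) (f' : hom X W) (g' : hom W Z') (b : hom W Y),
    [/\ confl f' g', g \oo b = a \oo g' & b \oo f' = f].
Proof.
move=> fg.
have dL : linear (fun w : sval Y * sval Z' => g $ w.1 - a $ w.2 : sval Z).
  by move=> c x y; rewrite !lhomP opprD addrACA scalerBr.
have fL : linear (fun x : sval X => (f $ x, 0) : sval Y * sval Z').
  by move=> c x y; rewrite lhomP; congr pair; rewrite /= scaler0 addr0.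
have pL : linear (fun w : (sval Y * sval Z')%type => w.1) by [].
have qL : linear (fun w : (sval Y * sval Z')%type => w.2) by [].
pose d := mklhom dL; pose ka := subm_in (lkerm d).
have [|f' f'P] := @lhom_factor_inj _ _ _ _ ka (mklhom fL) (@subm_in_inj _ _ _).
  move=> x; apply/subm_inE; change (g $ (f $ x) - a $ 0 = 0).
  by rewrite (ses_cmp0 fg) lhom0 subr0.
have fg' : short_exact f' (lhom_comp (mklhom qL) ka).
  split.
  - apply: lhom_inj0 => x e; apply: (lhom_inj_eq0 (ses_inj fg)).
    by have /(congr1 fst) := f'P x; rewrite e lhom0 => /esym.
  - move=> z'; have [y gy] := ses_surj fg (a $ z').
    have /subm_inE[w we] : lkerm d (y, z').
      by change (g $ y - a $ z' = 0); rewrite gy subrr.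
    by exists w; rewrite lhom_compE [ka w]we.
  move=> w; rewrite lhom_compE; split=> [e|[x <-]]; last by rewrite f'P.
  have w0 : (ka $ w).2 = 0 := e.
  have : g $ (ka $ w).1 - a $ (ka $ w).2 = 0 := subm_inN w.
  rewrite w0 lhom0 subr0 => /(ses_mid fg)[x fx]; exists x.
  apply: (@subm_in_inj _ _ _); rewrite f'P mklhomE fx -[in LHS]w0.
  by case: (ka $ w).
have PW : P (subm (lkerm d)) by apply: (ext_closedX PE fg'); apply: svalP.
exists (mobj PW), f', (lhom_comp (mklhom qL) ka), (lhom_comp (mklhom pL) ka); split=> //.
  apply: lhom_ext => w; apply/subr0_eq; exact: (subm_inN w).
by apply: lhom_ext => x; rewrite modcat_cmpE lhom_compE f'P.
Qed.

Theorem modcat_exact : exact_axioms E.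
Proof.
split.
- split; last exact: ext_closed_biproduct.
  by have [Z Z0] := ext_closed_zero; exists Z; apply: lhom_ext => z; rewrite (Z0 z) (Z0 (_ $ _)) [RHS]Z0.
- by move=> X Y Z f g fg; split; [apply: confl_is_kernel | apply: confl_is_cokernel].
- exact: confl_iso.
- exact: confl_id_l.
- exact: confl_id_r.
- exact: ext_closed_infl_cmp.
- exact: ext_closed_defl_cmp.
- move=> X Y X' f a [Z [g fg]].
  have [W [b [f' [g' [fg' bf g'b]]]]] := ext_closed_pushout a fg.
  exists W, b, f'; split; first exact: confl_is_pushout fg fg' bf g'b.
  by exists Z, g'.
move=> Y Z Z' g a [X [f fg]].
have [W [f' [g' [b [fg' gb bf']]]]] := ext_closed_pullback a fg.
exists W, b, g'; split; first exact: confl_is_pullback fg fg' gb bf'.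
by exists X, f'.
Qed.

(** A standard triangle only knows its cone as some pushout. Any pushout is isomorphic to the
    constructed one and inherits its conflation. *)
Lemma is_pushout_confl (X Y Z X' W : E) (f : hom X Y) (g : hom Y Z) (a : hom X X')
    (b : hom Y W) (f' : hom X' W) :
  confl f g -> is_pushout f a b f' ->
  exists g' : hom W Z, confl f' g' /\ g' \oo b = g.
Proof.
move=> fg [bf Wu].
have [W1 [b1 [f1 [g1 [fg1 b1f g1b]]]]] := ext_closed_pushout a fg.
have [_ W1u] := confl_is_pushout fg fg1 b1f g1b.
have [u [[ub uf] _]] := Wu _ _ _ b1f; have [v [[vb vf] _]] := W1u _ _ _ bf.
have uv : is_iso u.
  exists v; split.
    have [l [_ lu]] := Wu _ _ _ bf.
    transitivity l; [apply/esym/lu | apply: lu]; last by rewrite !cmp1m.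
    by rewrite -!cmpA ub uf vb vf.
  have [l [_ lu]] := W1u _ _ _ b1f.
  transitivity l; [apply/esym/lu | apply: lu]; last by rewrite !cmp1m.
  by rewrite -!cmpA vb vf ub uf.
exists (g1 \oo u); split; last by rewrite -cmpA ub.
have [v' [v'u uv']] := uv.
apply: (confl_iso (is_iso_idm X') _ (is_iso_idm Z) _ _ fg1 (b := v')).
- by exists u.
- by rewrite cmpm1 -uf cmpA v'u cmp1m.
by rewrite cmp1m -cmpA uv' cmpm1.
Qed.

End ModuleCategory.

(** * Transport of exact structures *)

Section CompositionTheory.
Variable C : pacat.

Lemma cmp0m (X Y Z : C) (f : hom X Y) : (0 : hom Y Z) \oo f = 0.
Proof. by rewrite -[0 in LHS](subrr (0 : hom Y Z)) cmpB subrr. Qed.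

Lemma cmpm0 (X Y Z : C) (g : hom Y Z) : g \oo (0 : hom X Y) = 0.
Proof. by rewrite -[0 in LHS](subrr (0 : hom X Y)) cmpBr subrr. Qed.

End CompositionTheory.

Section FunctorTheory.
Variables (C D : pacat) (F : functor C D).

Lemma fmap0 (X Y : C) : fmap F (0 : hom X Y) = 0.
Proof. by apply: (addIr (fmap F (0 : hom X Y))); rewrite -fmapD !add0r. Qed.

Lemma fmapB (X Y : C) (f g : hom X Y) : fmap F (f - g) = fmap F f - fmap F g.
Proof. by apply: (addIr (fmap F g)); rewrite -fmapD !subrK. Qed.

Lemma fmap_iso (X Y : C) (f : hom X Y) : is_iso f -> is_iso (fmap F f).
Proof. by move=> [g [gf fg]]; exists (fmap F g); rewrite -!fmapM gf fg !fmap1. Qed.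

Definition full := forall (X Y : C) (h : hom (F X) (F Y)), exists f, fmap F f = h.
Definition faithful := forall (X Y : C) (f : hom X Y), fmap F f = 0 -> f = 0.
Definition dense := forall Y : D, exists (X : C) (i : hom (F X) Y), is_iso i.

Hypotheses (Ffull : full) (Ffaithful : faithful).

Lemma faithful_inj (X Y : C) : injective (@fmap C D F X Y).
Proof. by move=> f g e; apply/subr0_eq/Ffaithful; rewrite fmapB e subrr. Qed.

Lemma full_faithful_iso (X Y : C) (f : hom X Y) : is_iso (fmap F f) -> is_iso f.
Proof.
move=> [g' [g'f fg']]; have [g Fg] := Ffull g'; exists g.
by split; apply: faithful_inj; rewrite fmapM fmap1 Fg.
Qed.

Hypothesis Fdense : dense.

Lemma full_faithful_dense_equivalence : is_equivalence F.
Proof.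
have [ob obP] := choice Fdense.
have [i iP] : exists i : forall Y, hom (F (ob Y)) Y, forall Y, is_iso (i Y).
  by exists (fun Y => projT1 (cid (obP Y))) => Y; case: (cid _).
have [j jP] : exists j : forall Y, hom Y (F (ob Y)),
    forall Y, j Y \oo i Y = idm _ /\ i Y \oo j Y = idm _.
  by exists (fun Y => projT1 (cid (iP Y))) => Y; case: (cid _).
have [m mP] : exists m : forall X Y (h : hom (F X) (F Y)), hom X Y,
    forall X Y h, fmap F (m X Y h) = h.
  exists (fun X Y h => projT1 (cid (Ffull h))) => X Y h; by case: (cid _).
pose Gm X Y (f : hom X Y) := m _ _ (j Y \oo f \oo i X).
have G1 X : Gm X X (idm X) = idm (ob X).
  by apply: faithful_inj; rewrite mP cmpm1 fmap1; case: (jP X).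
have GM X Y Z (g : hom Y Z) (f : hom X Y) : Gm _ _ (g \oo f) = Gm _ _ g \oo Gm _ _ f.
  apply: faithful_inj; rewrite fmapM !mP -!cmpA (cmpA (i Y)).
  by have [_ ->] := jP Y; rewrite cmp1m.
have GD X Y (f g : hom X Y) : Gm _ _ (f + g) = Gm _ _ f + Gm _ _ g.
  by apply: faithful_inj; rewrite fmapD !mP cmpDr cmpDl.
exists (Functor G1 GM GD); split.
  exists (fun X => m _ _ (i (F X))); split=> [X|X Y f].
    by apply: full_faithful_iso; rewrite mP; apply: iP.
  apply: faithful_inj; rewrite !fmapM /= !mP !cmpA.
  by have [_ ->] := jP (F Y); rewrite cmp1m.
exists i; split=> // X Y f; rewrite /= mP !cmpA.
by have [_ ->] := jP Y; rewrite cmp1m.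
Qed.

End FunctorTheory.

Section ExactTransport.
Variables (E E' : excat) (F : functor E E').
Hypotheses (Ffull : full F) (Ffaithful : faithful F) (Fdense : dense F).
Hypothesis E'_exact : exact_axioms E'.
Hypothesis confl_fmap : forall (X Y Z : E) (f : hom X Y) (g : hom Y Z),
  confl f g <-> confl (fmap F f) (fmap F g).

Let Finj := faithful_inj Ffaithful.

(** The cokernel of [fmap F f] is only isomorphic to some [F Z]. Fullness lifts the conjugated
    morphism, and closure of conflations of [E'] under isomorphism does the rest; the later
    transport lemmas follow this pattern. *)
Lemma reflects_inflation (X Y : E) (f : hom X Y) : inflation (fmap F f) -> inflation f.
Proof.
move=> [Z' [g' fg']]; have [Z [i [j [ji ij]]]] := Fdense Z'.
have [g Fg] := Ffull (j \oo g'); exists Z, g; apply/confl_fmap.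
apply: (ex_iso E'_exact (is_iso_idm _) (is_iso_idm _) _ _ _ fg' (c := j)).
- by exists i.
- by rewrite cmp1m cmpm1.
- by rewrite cmpm1 Fg.
Qed.

Lemma reflects_deflation (Y Z : E) (g : hom Y Z) : deflation (fmap F g) -> deflation g.
Proof.
move=> [X' [f' fg']]; have [X [i [j [ji ij]]]] := Fdense X'.
have [f Ff] := Ffull (f' \oo i); exists X, f; apply/confl_fmap.
apply: (ex_iso E'_exact _ (is_iso_idm _) (is_iso_idm _) _ _ fg' (a := j)).
- by exists i.
- by rewrite cmp1m Ff -cmpA ij cmpm1.
- by rewrite cmp1m cmpm1.
Qed.

Lemma fmap_inflation (X Y : E) (f : hom X Y) : inflation f -> inflation (fmap F f).
Proof. by move=> [Z [g /confl_fmap fg]]; exists (F Z), (fmap F g). Qed.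

Lemma fmap_deflation (X Y : E) (f : hom X Y) : deflation f -> deflation (fmap F f).
Proof. by move=> [Z [g /confl_fmap fg]]; exists (F Z), (fmap F g). Qed.

Lemma transport_additive : is_additive E.
Proof.
have [[Z' Z'0] bip] := ex_additive E'_exact; split.
  have [Z [i [j [ji _]]]] := Fdense Z'; exists Z; apply: Ffaithful.
  by rewrite fmap1 -ji -[i]cmp1m Z'0 cmp0m cmpm0.
move=> X Y; have [W' [i' [j' [p' [q' [pi qj pj qi ip]]]]]] := bip (F X) (F Y).
have [W [u [v [vu uv]]]] := Fdense W'.
have [[i Fi] [j Fj]] := (Ffull (v \oo i'), Ffull (v \oo j')).
have [[p Fp] [q Fq]] := (Ffull (p' \oo u), Ffull (q' \oo u)).
have K (S T : E') (a : hom W' S) (b : hom T W') : (a \oo u) \oo (v \oo b) = a \oo b.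
  by rewrite -cmpA (cmpA u) uv cmp1m.
exists W, i, j, p, q; split; apply: Finj; rewrite ?fmapD ?fmap0 ?fmap1 ?fmapM ?Fi ?Fj ?Fp ?Fq.
- by rewrite K.
- by rewrite K.
- by rewrite K.
- by rewrite K.
by rewrite -!cmpA -cmpDr !cmpA -cmpDl ip cmp1m.
Qed.

Lemma transport_kernel (X Y Z : E) (f : hom X Y) (g : hom Y Z) :
  is_kernel (fmap F f) (fmap F g) -> is_kernel f g.
Proof.
move=> [gf0 ker]; split; first by apply: Finj; rewrite fmapM gf0 fmap0.
move=> W h gh; have [|l' [fl l'u]] := ker _ (fmap F h); first by rewrite -fmapM gh fmap0.
have [l Fl] := Ffull l'; exists l; split; first by apply: Finj; rewrite fmapM Fl.
by move=> l1 fl1; apply: Finj; rewrite Fl; apply: l'u; rewrite -fmapM fl1.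
Qed.

Lemma transport_cokernel (X Y Z : E) (f : hom X Y) (g : hom Y Z) :
  is_cokernel (fmap F g) (fmap F f) -> is_cokernel g f.
Proof.
move=> [gf0 ker]; split; first by apply: Finj; rewrite fmapM gf0 fmap0.
move=> W h gh; have [|l' [fl l'u]] := ker _ (fmap F h); first by rewrite -fmapM gh fmap0.
have [l Fl] := Ffull l'; exists l; split; first by apply: Finj; rewrite fmapM Fl.
by move=> l1 fl1; apply: Finj; rewrite Fl; apply: l'u; rewrite -fmapM fl1.
Qed.

Lemma transport_pushout (X Y X' : E) (f : hom X Y) (a : hom X X') : inflation f ->
  exists W (b : hom Y W) (f' : hom X' W), is_pushout f a b f' /\ inflation f'.
Proof.
move=> /fmap_inflation fI.
have [W' [b1 [f1 [[bf Wu] [Z' [g1 fg1]]]]]] := ex_pushout E'_exact (fmap F a) fI.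
have [W [u [v [vu uv]]]] := Fdense W'.
have [[b Fb] [f' Ff']] := (Ffull (v \oo b1), Ffull (v \oo f1)).
exists W, b, f'; split; last first.
  apply: reflects_inflation; exists Z', (g1 \oo u); rewrite Ff'.
  apply: (ex_iso E'_exact (is_iso_idm _) _ (is_iso_idm _) _ _ fg1 (b := v)).
  - by exists u.
  - by rewrite cmpm1.
  - by rewrite cmp1m -cmpA uv cmpm1.
split; first by apply: Finj; rewrite !fmapM Fb Ff' -!cmpA bf.
move=> V h h' e; have [|l' [[lb lf] l'u]] := Wu _ (fmap F h) (fmap F h').
  by rewrite -!fmapM e.
have [l Fl] := Ffull (l' \oo u); exists l; split.
  by split; apply: Finj; rewrite fmapM Fl ?Fb ?Ff' -cmpA (cmpA u) uv cmp1m.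
move=> l1 [l1b l1f]; apply: Finj; rewrite Fl (l'u (fmap F l1 \oo v)).
  by rewrite -cmpA vu cmpm1.
by rewrite -!cmpA -Fb -Ff' -!fmapM l1b l1f.
Qed.

Lemma transport_pullback (Y Z Z' : E) (g : hom Y Z) (a : hom Z' Z) : deflation g ->
  exists W (b : hom W Y) (g' : hom W Z'), is_pullback b g' g a /\ deflation g'.
Proof.
move=> /fmap_deflation gD.
have [W' [b1 [g1 [[gb Wu] [X' [f1 fg1]]]]]] := ex_pullback E'_exact (fmap F a) gD.
have [W [u [v [vu uv]]]] := Fdense W'.
have [[b Fb] [g' Fg']] := (Ffull (b1 \oo u), Ffull (g1 \oo u)).
exists W, b, g'; split; last first.
  apply: reflects_deflation; exists X', (v \oo f1); rewrite Fg'.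
  apply: (ex_iso E'_exact (is_iso_idm _) _ (is_iso_idm _) _ _ fg1 (b := v)).
  - by exists u.
  - by rewrite cmpm1.
  - by rewrite cmp1m -cmpA uv cmpm1.
split; first by apply: Finj; rewrite !fmapM Fb Fg' !cmpA gb.
move=> V h h' e; have [|l' [[lb lf] l'u]] := Wu _ (fmap F h) (fmap F h').
  by rewrite -!fmapM e.
have [l Fl] := Ffull (v \oo l'); exists l; split.
  by split; apply: Finj; rewrite fmapM Fl ?Fb ?Fg' -cmpA (cmpA u) uv cmp1m.
move=> l1 [l1b l1f]; apply: Finj; rewrite Fl (l'u (u \oo fmap F l1)).
  by rewrite cmpA vu cmp1m.
by rewrite !cmpA -Fb -Fg' -!fmapM l1b l1f.
Qed.

Lemma transport_exact : exact_axioms E.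
Proof.
split.
- exact: transport_additive.
- move=> X Y Z f g /confl_fmap/(ex_kercok E'_exact)[fk gc].
  by split; [apply: transport_kernel | apply: transport_cokernel].
- move=> X Y Z X' Y' Z' f g f' g' a b c ia ib ic bf cg /confl_fmap fg; apply/confl_fmap.
  apply: (ex_iso E'_exact (fmap_iso F ia) (fmap_iso F ib) (fmap_iso F ic)) fg.
    by rewrite -!fmapM bf.
  by rewrite -!fmapM cg.
- by move=> X; apply: reflects_inflation; rewrite fmap1; apply: ex_infl_id.
- by move=> X; apply: reflects_deflation; rewrite fmap1; apply: ex_defl_id.
- move=> X Y Z g f /fmap_inflation gI /fmap_inflation fI.
  by apply: reflects_inflation; rewrite fmapM; apply: ex_infl_cmp.
- move=> X Y Z g f /fmap_deflation gI /fmap_deflation fI.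
  by apply: reflects_deflation; rewrite fmapM; apply: ex_defl_cmp.
- exact: transport_pushout.
- exact: transport_pullback.
Qed.

Lemma transport_ext1 : ext1_iso F.
Proof.
move=> X Y; split.
  move=> W W' f g f' g' fg fg' [h' [h'I hf gh]]; have [h Fh] := Ffull h'.
  exists h; split; first by apply: (full_faithful_iso Ffull Ffaithful); rewrite Fh.
    by apply: Finj; rewrite fmapM Fh.
  by apply: Finj; rewrite fmapM Fh.
move=> V u v uv; have [W [i iI]] := Fdense V; have [j [ji ij]] := iI.
have [[f Ff] [g Fg]] := (Ffull (j \oo u), Ffull (v \oo i)).
exists W, f, g; split; last first.
  by exists i; split; rewrite ?Ff ?Fg // cmpA ij cmp1m.
apply/confl_fmap; rewrite Ff Fg.
apply: (ex_iso E'_exact (is_iso_idm _) _ (is_iso_idm _) _ _ uv (b := j)).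
- by exists i.
- by rewrite cmpm1.
- by rewrite cmp1m -cmpA ij cmpm1.
Qed.

Theorem full_faithful_dense_exact_equivalence : exact_equivalence F.
Proof.
split=> //; first exact: transport_exact.
- exact: full_faithful_dense_equivalence.
- by move=> X Y Z f g /confl_fmap.
- exact: transport_ext1.
Qed.

End ExactTransport.

Section QuotientLift.
Variables (C D : pacat) (I : ideal C) (F : functor C D).
Hypothesis FI : forall (X Y : C) (f : hom X Y), imem I f -> fmap F f = 0.

Definition qlift_map (X Y : qcat I) (f : hom X Y) : hom (F X) (F Y) := fmap F (qrepr f).

Lemma qlift_qpi (X Y : C) (f : hom X Y) : qlift_map (qpi I f : @hom (qcat I) X Y) = fmap F f.
Proof.
apply/subr0_eq; rewrite -fmapB; apply: FI.
by apply/qpi_eq; rewrite qreprK.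
Qed.

Fact qlift1 (X : qcat I) : qlift_map (idm X) = idm (F X).
Proof. by rewrite [LHS]qlift_qpi fmap1. Qed.
Fact qliftM (X Y Z : qcat I) (g : hom Y Z) (f : hom X Y) :
  qlift_map (g \oo f) = qlift_map g \oo qlift_map f.
Proof. by rewrite [LHS]qlift_qpi fmapM. Qed.
Fact qliftD (X Y : qcat I) (f g : hom X Y) :
  qlift_map (f + g) = qlift_map f + qlift_map g.
Proof. by rewrite -[f]qreprK -[g]qreprK -qpiD !qlift_qpi fmapD. Qed.

Definition qlift : functor (qcat I) D := Functor qlift1 qliftM qliftD.

End QuotientLift.

(** * Triangle functors between stable categories *)

Section StableLifts.
Variables (E : excat) (I : ideal E).
Hypothesis stI : stable_ideal I.

Let Eex : exact_axioms E. Proof. by case: stI => -[]. Qed.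

Lemma stable_injP (P : E) : ex_injective P <-> ex_projective P.
Proof. by case: stI => FE _; rewrite (frob_projE FE). Qed.

Lemma imem_through_injective (X Y J : E) (g : hom J Y) (f : hom X J) :
  ex_injective J -> imem I (g \oo f).
Proof. by move=> /stable_injP Jp; have [_ ->] := stI; exists J, g, f. Qed.

Lemma confl_cmp0 (X Y Z : E) (f : hom X Y) (g : hom Y Z) : confl f g -> g \oo f = 0.
Proof. by move=> /(ex_kercok Eex)[[]]. Qed.

Lemma confl_extend (X Y Z W : E) (f : hom X Y) (g : hom Y Z) (h : hom Y W) :
  confl f g -> h \oo f = 0 -> exists l : hom Z W, l \oo g = h.
Proof.
by move=> /(ex_kercok Eex)[_ [_ cok]] /cok[l [lg _]]; exists l.
Qed.

Lemma confl_epi (X Y Z W : E) (f : hom X Y) (g : hom Y Z) (a b : hom Z W) :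
  confl f g -> a \oo g = b \oo g -> a = b.
Proof.
move=> fg; have [_ [_ cok]] := ex_kercok Eex fg => e.
have [|l [_ lu]] := cok _ (a \oo g); first by rewrite -cmpA (confl_cmp0 fg) cmpm0.
by rewrite -(lu a) // -(lu b).
Qed.

(** A morphism of conflations. When the middle terms are injective, [v] represents the suspension of
    [u]; stating this for arbitrary such conflations allows comparing different choices. *)
Definition lifts (X J Z Y K W : E) (f : hom X J) (g : hom J Z) (f' : hom Y K)
    (g' : hom K W) (u : hom X Y) (h : hom J K) (v : hom Z W) : Prop :=
  h \oo f = f' \oo u /\ v \oo g = g' \oo h.

Lemma lifts_exist (X J Z Y K W : E) (f : hom X J) (g : hom J Z) (f' : hom Y K)
    (g' : hom K W) (u : hom X Y) :
  confl f g -> confl f' g' -> ex_injective K -> exists h v, lifts f g f' g' u h v.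
Proof.
move=> fg fg' KI; have [h hf] := KI _ _ _ _ _ fg (f' \oo u).
have [|v vg] := @confl_extend _ _ _ _ _ _ (g' \oo h) fg.
  by rewrite -cmpA hf cmpA (confl_cmp0 fg') cmp0m.
by exists h, v.
Qed.

Lemma lifts_cmp (X J Z Y K W X' J' Z' : E) (f : hom X J) (g : hom J Z) (f' : hom Y K)
    (g' : hom K W) (f'' : hom X' J') (g'' : hom J' Z') u h v u' h' v' :
  lifts f' g' f'' g'' u' h' v' -> lifts f g f' g' u h v ->
  lifts f g f'' g'' (u' \oo u) (h' \oo h) (v' \oo v).
Proof.
move=> [hf' vg'] [hf vg]; split.
  by rewrite -cmpA hf cmpA hf' cmpA.
by rewrite -cmpA vg cmpA vg' cmpA.
Qed.

Lemma lifts_sub (X J Z Y K W : E) (f : hom X J) (g : hom J Z) (f' : hom Y K)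
    (g' : hom K W) u h v u' h' v' :
  lifts f g f' g' u h v -> lifts f g f' g' u' h' v' ->
  lifts f g f' g' (u - u') (h - h') (v - v').
Proof. by move=> [hf vg] [hf' vg']; split; rewrite cmpB cmpBr ?hf ?hf' ?vg ?vg'. Qed.

Lemma lifts_idm (X J Z : E) (f : hom X J) (g : hom J Z) :
  lifts f g f g (idm X) (idm J) (idm Z).
Proof. by split; rewrite cmp1m cmpm1. Qed.

(** Write u = c a0 through an injective and extend a0 to a on J. Then h - f' c a kills f, so it is r
    g, and v = g' r factors through the injective K. *)
Lemma lifts_null (X J Z Y K W : E) (f : hom X J) (g : hom J Z) (f' : hom Y K)
    (g' : hom K W) u h v :
  confl f g -> confl f' g' -> ex_injective K ->
  lifts f g f' g' u h v -> imem I u -> imem I v.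
Proof.
move=> fg fg' KI [hf vg]; have [_ ->] := stI.
move=> [P [c [a0 [/stable_injP Pinj e]]]]; have [a af] := Pinj _ _ _ _ _ fg a0.
have [|r rg] := @confl_extend _ _ _ _ _ _ (h - f' \oo c \oo a) fg.
  by rewrite cmpB hf -!cmpA af e subrr.
have -> : v = g' \oo r; last exact: imem_through_injective.
apply: (confl_epi fg); rewrite vg -cmpA rg cmpBr !cmpA (confl_cmp0 fg').
by rewrite !cmp0m subr0.
Qed.

Lemma lifts_unique (X J Z Y K W : E) (f : hom X J) (g : hom J Z) (f' : hom Y K)
    (g' : hom K W) u h v u' h' v' :
  confl f g -> confl f' g' -> ex_injective K ->
  lifts f g f' g' u h v -> lifts f g f' g' u' h' v' ->
  fmap (qfun I) u = fmap (qfun I) u' -> fmap (qfun I) v = fmap (qfun I) v'.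
Proof.
move=> fg fg' KI l l' /qpi_eq uu'; apply/qpi_eq.
exact: lifts_null fg fg' KI (lifts_sub l l') uu'.
Qed.

Lemma lifts_iso (X J Z K W : E) (f : hom X J) (g : hom J Z) (f' : hom X K)
    (g' : hom K W) h v :
  confl f g -> confl f' g' -> ex_injective J -> ex_injective K ->
  lifts f g f' g' (idm X) h v -> is_iso (fmap (qfun I) v).
Proof.
move=> fg fg' JI KI l; have [h' [v' l']] := lifts_exist (idm X) fg' fg JI.
exists (fmap (qfun I) v'); rewrite -!fmapM; split.
  rewrite -(fmap1 (qfun I)).
  by apply: (lifts_unique fg fg JI (lifts_cmp l' l) (lifts_idm f g)); rewrite cmp1m.
rewrite -(fmap1 (qfun I)).
by apply: (lifts_unique fg' fg' KI (lifts_cmp l l') (lifts_idm f' g')); rewrite cmp1m.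
Qed.

Lemma pushout_unique (X Y Y' W V : E) (f : hom X Y) (f' : hom X Y') (g : hom Y W)
    (g' : hom Y' W) (l l' : hom W V) :
  is_pushout f f' g g' -> l \oo g = l' \oo g -> l \oo g' = l' \oo g' -> l = l'.
Proof.
move=> [e po] lg lg'; have [|m [_ mu]] := po V (l' \oo g) (l' \oo g').
  by rewrite -!cmpA e.
by rewrite -(mu l) // -(mu l').
Qed.

(** Since n kills f, it equals r g. Then d and q r w agree after q and after v, hence are equal, and
    q r w passes through the injective J. Applied to d = c' c - 1 below, this makes maps between
    cones stable isomorphisms. *)
Lemma pushout_null (X J Z Y W : E) (f : hom X J) (g : hom J Z) (u : hom X Y)
    (q : hom J W) (v : hom Y W) (w : hom W Z) (n : hom J J) (d : hom W W) :
  confl f g -> ex_injective J -> is_pushout f u q v -> w \oo q = g -> w \oo v = 0 ->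
  n \oo f = 0 -> d \oo q = q \oo n -> d \oo v = 0 -> imem I d.
Proof.
move=> fg JI po wq wv nf dq dv; have [r rg] := confl_extend fg nf.
have -> : d = q \oo (r \oo w); last exact: imem_through_injective.
apply: (pushout_unique po); first by rewrite dq -!cmpA wq rg.
by rewrite dv -!cmpA wv !cmpm0.
Qed.

Lemma susp_mor_lifts (S : suspension E) (X Y : E) (f0 : hom X Y) h g0 :
  lifts (susp_in S X) (susp_out S X) (susp_in S Y) (susp_out S Y) f0 h g0 ->
  @susp_mor E I S X Y (fmap (qfun I) f0) (fmap (qfun I) g0).
Proof. by move=> [hf gh]; exists f0, h, g0. Qed.

Lemma susp_mor_exists (S : suspension E) (X Y : E) (f : @hom (qcat I) X Y) :
  exists g, @susp_mor E I S X Y f g.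
Proof.
have [h [g0 l]] := lifts_exist (qrepr f) (susp_confl S X) (susp_confl S Y)
  (@susp_injP _ S Y).
by exists (fmap (qfun I) g0); have := susp_mor_lifts l; rewrite /= qreprK.
Qed.

End StableLifts.

Section InducedTriangleFunctor.
Variables (E : excat) (I : ideal E) (E' : excat) (I' : ideal E').
Hypotheses (stI : stable_ideal I) (stI' : stable_ideal I').
Variable F : functor E E'.
Hypothesis F_exact : is_exact_functor F.
Hypothesis F_inj : forall J : E, ex_injective J -> ex_injective (F J).
Hypothesis FI : forall (X Y : E) (f : hom X Y),
  imem I f -> fmap (fcomp (qfun I') F) f = 0.
(** This hypothesis and the next are general properties of exact categories; they are supplied from
    the proofs with elements in [modcat]. *)
Hypothesis pushout_confl : forall (X Y Z X' W : E) (f : hom X Y) (g : hom Y Z)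
    (a : hom X X') (b : hom Y W) (f' : hom X' W),
  confl f g -> is_pushout f a b f' -> exists g' : hom W Z, confl f' g' /\ g' \oo b = g.
Hypothesis confl_pushout : forall (X Y Z X' W : E') (f : hom X Y) (g : hom Y Z)
    (a : hom X X') (b : hom Y W) (f' : hom X' W) (g' : hom W Z),
  confl f g -> confl f' g' -> b \oo f = f' \oo a -> g' \oo b = g -> is_pushout f a b f'.

Notation G := (qlift FI).

Lemma qlift_qfun (X Y : E) (f : hom X Y) :
  fmap G (fmap (qfun I) f) = fmap (qfun I') (fmap F f).
Proof. exact: (qlift_qpi FI f). Qed.

Variables (S : suspension E) (S' : suspension E').

Let Sconfl X : confl (susp_in S X) (susp_out S X) := susp_confl S X.
Let S'confl X : confl (susp_in S' X) (susp_out S' X) := susp_confl S' X.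
Let FSconfl X : confl (fmap F (susp_in S X)) (fmap F (susp_out S X)) :=
  F_exact (Sconfl X).
Let S'inj X : ex_injective (susp_inj S' X) := @susp_injP _ S' X.
Let FSinj X : ex_injective (F (susp_inj S X)) := F_inj (@susp_injP _ S X).

Let compares X h (p : hom (F (S X)) (S' (F X))) :=
  lifts (fmap F (susp_in S X)) (fmap F (susp_out S X))
        (susp_in S' (F X)) (susp_out S' (F X)) (idm (F X)) h p.

(** The image of a standard triangle is a pushout along F X -> F I(X) instead of F X -> I(F X). The
    comparison of these two embeddings induces a map of cones, and a comparison in the opposite
    direction gives its stable inverse. *)
Lemma induced_dist_triangle (X Y C : E) (u : hom X Y) (v : hom Y C) (w : hom C (S X))
    h (p : hom (F (S X)) (S' (F X))) :
  std_triangle u v w -> compares h p ->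
  exists (C' : E') (v' : hom (F Y) C') (w' : hom C' (S' (F X))) (c : hom (F C) C'),
  [/\ std_triangle (fmap F u) v' w', is_iso (fmap (qfun I') c),
      c \oo fmap F v = v' & w' \oo c = p \oo fmap F w].
Proof.
move=> [q [po wq wv]] hp; have [hin pout] := hp; rewrite cmpm1 in hin.
have E'ex : exact_axioms E' by case: stI' => -[].
(* The pushout provides a conflation starting with [v]; its deflation satisfies the equations that
   characterise [w]. *)
have vw : confl v w.
  have [g [vg gq]] := pushout_confl (Sconfl X) po.
  suff -> : w = g by [].
  apply: (pushout_unique po); first by rewrite wq gq.
  by rewrite wv (confl_cmp0 stI vg).
have Fwq : fmap F w \oo fmap F q = fmap F (susp_out S X) by rewrite -fmapM wq.
have Fwv : fmap F w \oo fmap F v = 0 by rewrite -fmapM wv fmap0.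
have Fqin : fmap F q \oo fmap F (susp_in S X) = fmap F v \oo fmap F u.
  by rewrite -!fmapM; have [->] := po.
have Fpo := confl_pushout (FSconfl X) (F_exact vw) Fqin Fwq.
have [|C' [q' [v' [po' _]]]] :=
    ex_pushout E'ex (fmap F u) (f := susp_in S' (F X)).
  by exists (S' (F X)), (susp_out S' (F X)).
have [q'in q'u] := po'.
have [|w' [[w'q' w'v'] _]] := q'u _ (susp_out S' (F X)) 0.
  by rewrite (confl_cmp0 stI' (S'confl _)) cmp0m.
have [|c [[cq cv] _]] := (Fpo.2) _ (q' \oo h) v'.
  by rewrite -cmpA hin.
have [k [r kr]] := lifts_exist stI' (idm (F X)) (S'confl (F X)) (FSconfl X) (@FSinj X).
have [kin _] := kr; rewrite cmpm1 in kin.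
have [|c' [[c'q' c'v'] _]] := q'u _ (fmap F q \oo k) (fmap F v).
  by rewrite -cmpA kin.
exists C', v', w', c; split=> //.
- by exists q'.
(* The difference c' c - 1 vanishes on F Y and is induced by k h - 1 on F I(X), which kills F X. The
   other composite is symmetric. *)
- exists (fmap (qfun I') c'); rewrite -!fmapM -!(fmap1 (qfun I')).
  split; apply/qpi_eq.
    apply: (pushout_null (n := k \oo h - idm _) stI' (FSconfl X) (@FSinj X) Fpo Fwq Fwv).
    + by rewrite cmpB -cmpA hin kin cmp1m subrr.
    + by rewrite cmpB cmpBr -cmpA cq cmpA c'q' cmp1m cmpm1 cmpA.
    + by rewrite cmpB -cmpA cv c'v' cmp1m subrr.
  apply: (pushout_null (n := h \oo k - idm _) stI' (S'confl _) (@S'inj _) po' w'q' w'v').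
  + by rewrite cmpB -cmpA kin hin cmp1m subrr.
  + by rewrite cmpB cmpBr -cmpA c'q' cmpA cq cmp1m cmpm1 cmpA.
  + by rewrite cmpB -cmpA c'v' cv cmp1m subrr.
apply: (pushout_unique Fpo).
  by rewrite -!cmpA cq cmpA w'q' Fwq pout.
by rewrite -!cmpA cv w'v' Fwv cmpm0.
Qed.

Theorem induced_triangle_functor : is_triangle_functor S S' G.
Proof.
have [phi phiP] : exists phi : forall X : E, hom (F (S X)) (S' (F X)),
    forall X, exists h, compares h (phi X).
  have ex X : exists p : hom (F (S X)) (S' (F X)), exists h, compares h p.
    have [h [p l]] := lifts_exist stI' (idm (F X)) (FSconfl X) (S'confl (F X)) (@S'inj _).
    by exists p, h.
  by exists (fun X => projT1 (cid (ex X))) => X; case: (cid _).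
(* Both composites complete stably equal maps F X -> F Y to morphisms from the image conflation of X
   to the chosen conflation of F Y, so uniqueness of lifts applies. *)
have nat_phi (X Y : E) (f : @hom (qcat I) X Y) g g' :
    susp_mor f g -> @susp_mor E' I' S' (F X) (F Y) (fmap G f) g' ->
    g' \oo fmap (qfun I') (phi X) = fmap (qfun I') (phi Y) \oo fmap G g.
  move=> [f0 [h [g0 [-> -> hf gh]]]] [f0' [h' [g0' [+ -> hf' gh']]]].
  rewrite !qlift_qfun => ef; rewrite -!fmapM.
  have [hX lX] := phiP X; have [hY lY] := phiP Y.
  have l0 : lifts (fmap F (susp_in S X)) (fmap F (susp_out S X))
      (fmap F (susp_in S Y)) (fmap F (susp_out S Y)) (fmap F f0) (fmap F h) (fmap F g0).
    by split; rewrite -!fmapM ?hf ?gh.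
  have l1 : lifts (susp_in S' (F X)) (susp_out S' (F X))
      (susp_in S' (F Y)) (susp_out S' (F Y)) f0' h' g0' by [].
  apply: (etrans (y := fmap (qfun I') (phi Y \oo fmap F g0))); last exact: fmapM.
  apply: (lifts_unique stI' (FSconfl X) (S'confl _) (@S'inj _)
    (lifts_cmp l1 lX) (lifts_cmp lY l0)).
  by rewrite cmpm1 cmp1m ef.
exists (fun X => fmap (qfun I') (phi X)); split=> //.
  move=> X; have [h l] := phiP X.
  exact: (lifts_iso stI' (FSconfl X) (S'confl _) (@FSinj X) (@S'inj _) l).
move=> X Y Z u v w [X' [Y' [Z' [u' [v' [w' [std]]]]]]].
move=> [a [b [c [a1 [[ia ib ic aa1] [bu cv aw]]]]]].
have [h l] := phiP X'.
have [C [v1 [w1 [cc [std1 icc ccv w1cc]]]]] := induced_dist_triangle std l.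
have [a1' a1'P] := @susp_mor_exists E' I' stI' S' (F X) (F X') (fmap G a).
exists (F X'), (F Y'), C, (fmap F u'), v1, w1; split=> //.
exists (fmap G a), (fmap G b), (fmap (qfun I') cc \oo fmap G c), a1'; split.
  split=> //; [exact: fmap_iso | exact: fmap_iso | apply: is_iso_cmp => //].
  exact: fmap_iso.
split.
- by rewrite -[LHS](fmapM G b u) bu [LHS](fmapM G) qlift_qfun.
- rewrite -[LHS]cmpA -[fmap G c \oo _](fmapM G c v) cv [fmap G _](fmapM G) qlift_qfun.
  by rewrite cmpA -[_ \oo fmap _ (fmap F v')](fmapM (qfun I') cc) ccv.
rewrite [LHS]cmpA [X in X \oo _](nat_phi _ _ _ _ _ aa1 a1'P) -[LHS]cmpA.
rewrite -[fmap G a1 \oo _](fmapM G a1 w) aw [fmap G _](fmapM G) qlift_qfun !cmpA.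
by rewrite -[X in X \oo _ = _](fmapM (qfun I') (phi X')) -w1cc [X in X \oo _ = _](fmapM (qfun I')).
Qed.

End InducedTriangleFunctor.

(** * Dual bases and Frobenius categories of modules *)

Section FiniteFunctions.
Variables (A : pzRingType) (I : finType).

Fact lin_comb_subproof (M : lmodType A) (x : I -> M) :
  linear (fun v : {ffun I -> A^o} => \sum_i (v i : A) *: x i).
Proof.
move=> a u v; rewrite scaler_sumr -big_split; apply: eq_bigr => i _ /=.
by rewrite !ffunE scalerDl scalerA.
Qed.
Definition lin_comb (M : lmodType A) (x : I -> M) : lhom {ffun I -> A^o} M :=
  mklhom (lin_comb_subproof x).

Fact lhom_ffun_subproof (X M : lmodType A) (f : I -> lhom X M) :
  linear (fun x => [ffun i => f i x]).
Proof. by move=> a x y; apply/ffunP => i; rewrite !ffunE lhomP. Qed.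
Definition lhom_ffun (X M : lmodType A) (f : I -> lhom X M) : lhom X {ffun I -> M} :=
  mklhom (lhom_ffun_subproof f).

Lemma lhom_ffunE (X M : lmodType A) (f : I -> lhom X M) x i : lhom_ffun f x i = f i x.
Proof. by rewrite mklhomE ffunE. Qed.

Fact ffun_proj_subproof (M : lmodType A) i : linear (fun v : {ffun I -> M} => v i).
Proof. by move=> a x y; rewrite !ffunE. Qed.
Definition ffun_proj (M : lmodType A) i : lhom {ffun I -> M} M :=
  mklhom (@ffun_proj_subproof M i).

Definition ffun_unit i : {ffun I -> A^o} := [ffun j => (i == j)%:R].

Lemma ffun_unitE (v : {ffun I -> A^o}) : v = \sum_i (v i : A) *: ffun_unit i.
Proof.
apply/ffunP => j; rewrite sum_ffunE (bigD1 j) //= big1 => [|i /negbTE ne_ij].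
  by rewrite !ffunE eqxx addr0 [RHS]mulr1.
by rewrite !ffunE ne_ij scaler0.
Qed.

Lemma free_lift (M N : lmodType A) (g : lhom M N) (f : lhom {ffun I -> A^o} N) :
  (forall y, exists x, g x = y) -> exists h, lhom_comp g h = f.
Proof.
move=> gs; have [y yP] := choice (fun i => gs (f (ffun_unit i))).
exists (lin_comb y); apply: lhom_ext => v; rewrite lhom_compE mklhomE lhom_sum.
rewrite {2}(ffun_unitE v) lhom_sum; apply: eq_bigr => i _.
by rewrite !lhomZ yP.
Qed.

End FiniteFunctions.

Section DualBases.
Variable A : pzRingType.

(** The dual basis criterion for finitely generated projectives. An arbitrary finite index type lets
    bases be combined over sums and products of types without renumbering. *)
Definition dual_basis (P : lmodType A) : Prop :=
  exists (I : finType) (x : I -> P) (phi : I -> lhom P A^o),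
  forall p, p = \sum_i (phi i p : A) *: x i.

Lemma dual_basis_projective (P : lmodType A) : dual_basis P -> projective_module P.
Proof.
move=> [I [x [phi xP]]] M N g f gs.
have [y yP] := choice (fun i => gs (f (x i))).
exists (lhom_comp (lin_comb y) (lhom_ffun phi)); apply: lhom_ext => p.
rewrite !lhom_compE mklhomE lhom_sum {2}(xP p) lhom_sum.
by apply: eq_bigr => i _; rewrite !lhomZ yP mklhomE ffunE.
Qed.

Lemma fin_gen_surj (M : lmodType A) :
  fin_gen M <-> exists n (f : lhom {ffun 'I_n -> A^o} M), forall y, exists x, f x = y.
Proof.
split=> [[n [x xP]]|[n [f fs]]].
  exists n, (lin_comb x) => y; have [c ->] := xP y.
  by exists [ffun i => c i]; rewrite mklhomE; apply: eq_bigr => i _; rewrite ffunE.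
exists n, (fun i => f (ffun_unit A i)) => y; have [v <-] := fs y.
exists v; rewrite {1}(ffun_unitE v) lhom_sum.
by apply: eq_bigr => i _; rewrite lhomZ.
Qed.

Lemma dual_basis_in_add (P : lmodType A) : dual_basis P -> in_add A^o P.
Proof.
move=> [I [x [phi xP]]].
exists #|I|, (lhom_ffun (fun i => phi (enum_val i))), (lin_comb (fun i => x (enum_val i))).
apply: lhom_ext => p; rewrite lhom_compE !mklhomE [RHS]xP.
rewrite (reindex_onto (fun i : 'I_#|I| => enum_val i) enum_rank) /= => [|i _]; last exact: enum_rankK.
apply: eq_big => [i|i _]; first by rewrite enum_valK eqxx.
by rewrite ffunE.
Qed.

Lemma in_add_dual_basis (P : lmodType A) : in_add A^o P -> dual_basis P.
Proof.
move=> [n [s [r rs]]].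
exists 'I_n, (fun i => r (ffun_unit A i)), (fun i => lhom_comp (ffun_proj A^o i) s) => p.
rewrite -[LHS](lhom_eqE p rs) lhom_compE {1}(ffun_unitE (s p)) lhom_sum.
by apply: eq_bigr => i _; rewrite lhomZ.
Qed.

Lemma dual_basis_fin_gen (P : lmodType A) : dual_basis P -> fin_gen P.
Proof.
move=> /dual_basis_in_add[n [s [r rs]]]; apply/fin_gen_surj; exists n, r => y.
by exists (s y); apply: (lhom_eqE y rs).
Qed.

Lemma fg_projectiveP (P : lmodType A) : fg_projective P <-> dual_basis P.
Proof.
split=> [[/fin_gen_surj[n [f fs]] Pp]|Pd].
  have [s fsid] := Pp _ _ f (lhom_id P) fs.
  by apply: in_add_dual_basis; exists n, s, f.
by split; [apply: dual_basis_fin_gen | apply: dual_basis_projective].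
Qed.

Lemma dual_basis_free (I : finType) : dual_basis {ffun I -> A^o}.
Proof. by exists I, (@ffun_unit A I), (ffun_proj A^o) => v; apply: ffun_unitE. Qed.

Lemma dual_basis_retract (P Q : lmodType A) (s : lhom Q P) (r : lhom P Q) :
  (forall q, r (s q) = q) -> dual_basis P -> dual_basis Q.
Proof.
move=> rs [I [x [phi xP]]].
exists I, (fun i => r (x i)), (fun i => lhom_comp (phi i) s) => q.
rewrite -[LHS]rs {1}(xP (s q)) lhom_sum.
by apply: eq_bigr => i _; rewrite lhomZ.
Qed.

Lemma dual_basis_ext (L M N : lmodType A) (f : lhom L M) (g : lhom M N) :
  short_exact f g -> dual_basis L -> dual_basis N -> dual_basis M.
Proof.
move=> fg [I [x [phi xP]]] Nd.
have [s gs] := dual_basis_projective Nd (lhom_id N) (ses_surj fg).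
have [J [y [psi yP]]] := Nd.
have [r [_ rP]] := ses_section_retraction fg gs.
pose z (k : I + J) := match k with inl i => f (x i) | inr j => s (y j) end.
pose chi (k : I + J) : lhom M A^o :=
  match k with inl i => lhom_comp (phi i) r | inr j => lhom_comp (psi j) g end.
exists (I + J)%type, z, chi => m.
rewrite big_sumType /= {1}(rP m); congr (_ + _).
  by rewrite {1}(xP (r m)) lhom_sum; apply: eq_bigr => i _; rewrite lhomZ.
by rewrite {1}(yP (g m)) lhom_sum; apply: eq_bigr => i _; rewrite lhomZ.
Qed.

Lemma dual_basis_kernel (L M N : lmodType A) (f : lhom L M) (g : lhom M N) :
  short_exact f g -> dual_basis M -> dual_basis N -> dual_basis L.
Proof.
move=> fg Md Nd.
have [s gs] := dual_basis_projective Nd (lhom_id N) (ses_surj fg).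
have [r [rf _]] := ses_section_retraction fg gs.
by apply: (dual_basis_retract (s := f) (r := r)) => // l; apply: (lhom_eqE l rf).
Qed.

Lemma dual_basis0 (M : lmodType A) : (forall x : M, x = 0) -> dual_basis M.
Proof.
by move=> M0; exists 'I_0, (fun=> 0), (fun=> 0) => p; rewrite big_ord0.
Qed.

Lemma free_fin_rank_dual_basis (M : lmodType A) : free_fin_rank M -> dual_basis M.
Proof.
move=> [n [b bP]].
have [|c c0|a x c y d ex ey|f fP] := @linear_graph A M {ffun 'I_n -> A^o}
    (fun m c => m = \sum_i (c i : A) *: b i).
- by move=> x; have [c [e _]] := bP x; exists c.
- have [d [_ du]] := bP 0; rewrite -(du _ c0); apply: du.
  by rewrite big1 // => i _; rewrite ffunE scale0r.
- rewrite ex ey scaler_sumr -big_split; apply: eq_bigr => i _ /=.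
  by rewrite !ffunE scalerDl scalerA.
by exists 'I_n, b, (fun i => lhom_comp (ffun_proj A^o i) f).
Qed.

End DualBases.

(** * Submodules of free modules over a principal ideal domain *)

Definition principal_domain (R : comNzRingType) : Prop :=
  (forall a b : R, a * b = 0 -> a = 0 \/ b = 0) /\
  forall J : submod (R^o : lmodType R),
    exists a : R, J a /\ forall x, J x -> exists c : R, x = c * a.

Section PrincipalDomain.
Variable R : comNzRingType.
Hypothesis R_pid : principal_domain R.

(** Induction on n. The first coordinates of X form an ideal generated by some a = c(x0). If a = 0,
    dropping that coordinate keeps injectivity; otherwise X is the direct sum of R x0 and the kernel
    of c, which embeds in rank n - 1. *)
Lemma free_submod_ord n (X : lmodType R) (f : lhom X {ffun 'I_n -> R^o}) :
  injective f -> free_fin_rank X.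
Proof.
have [dom pid] := R_pid.
elim: n X f => [|n IHn] X f fI.
  exists 0%N, (fun=> 0) => x; have -> : x = 0 by apply: fI; apply/ffunP => -[].
  by exists 0; split=> [|c _]; [rewrite big_ord0 | apply/ffunP => -[]].
pose c := lhom_comp (ffun_proj R^o ord0) f.
have [a [[x0 cx0] aP]] := pid (limm c).
have [a0|a_neq0] := eqVneq a 0.
  have fL : linear (fun x => [ffun i => f x (lift ord0 i)] : {ffun 'I_n -> R^o}).
    by move=> b x y; apply/ffunP => i; rewrite lhomP !ffunE.
  apply: (IHn _ (mklhom fL)); apply: lhom_inj0 => x /ffunP fx.
  apply: (lhom_inj_eq0 fI); apply/ffunP => i; rewrite ffunE.
  have [j ->|->] := unliftP ord0 i; first by have := fx j; rewrite !ffunE.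
  by have [|r] := aP (c x); [exists x | rewrite a0 mulr0].
have gL : linear (fun u : subm (lkerm c) =>
    [ffun i => f (subm_in _ u) (lift ord0 i)] : {ffun 'I_n -> R^o}).
  by move=> d x y; apply/ffunP => i; rewrite !lhomP !ffunE.
have [|m [b bP]] := IHn _ (mklhom gL).
  apply: lhom_inj0 => u /ffunP fu.
  apply: (@subm_in_inj _ _ _); rewrite lhom0; apply: (lhom_inj_eq0 fI).
  apply/ffunP => i; rewrite ffunE.
  have [j ->|->] := unliftP ord0 i; first by have := fu j; rewrite !ffunE.
  exact: (subm_inN u).
pose b' (i : 'I_m.+1) := if unlift ord0 i is Some j then subm_in _ (b j) else x0.
have sumE (d : {ffun 'I_m.+1 -> R}) :
    \sum_i d i *: b' i = d ord0 *: x0 + subm_in _ (\sum_j d (lift ord0 j) *: b j).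
  rewrite big_ord_recl /b' unlift_none lhom_sum; congr (_ + _).
  by apply: eq_bigr => j _; rewrite liftK lhomZ.
have cE (d : R) (u : subm (lkerm c)) : c (d *: x0 + subm_in _ u) = d * a.
  by have cu : c (subm_in _ u) = 0 := subm_inN u; rewrite lhomP cx0 cu addr0.
exists m.+1, b' => x.
have [|r cx] := aP (c x); first by exists x.
have /subm_inE[u eu] : lkerm c (x - r *: x0).
  by change (c (x - r *: x0) = 0); rewrite lhomB lhomZ cx cx0 subrr.
have [d [dE du]] := bP u.
exists [ffun i => if unlift ord0 i is Some j then d j else r]; split.
  rewrite sumE !ffunE unlift_none; under eq_bigr => j _ do rewrite ffunE liftK.
  by rewrite -dE eu addrC subrK.
move=> d'; rewrite sumE => xE; have rE : r = d' ord0.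
  apply/subr0_eq; have [|//|a0] := dom (r - d' ord0) a; last by rewrite a0 eqxx in a_neq0.
  by rewrite mulrBl -cx xE cE subrr.
have dE' : d = [ffun j => d' (lift ord0 j)].
  apply: du; under eq_bigr => j _ do rewrite ffunE.
  by apply: (@subm_in_inj _ _ _); rewrite eu {1}xE rE addrC addKr.
apply/ffunP => i; rewrite ffunE; have [j ->|->] := unliftP ord0 i.
  by rewrite dE' ffunE.
exact: rE.
Qed.

Lemma free_submod (X M : lmodType R) (f : lhom X M) :
  injective f -> dual_basis M -> free_fin_rank X.
Proof.
move=> fI /dual_basis_in_add[n [s [r rs]]].
apply: (@free_submod_ord n _ (lhom_comp s f)) => x y e; apply: fI.
by rewrite -[LHS](lhom_eqE _ rs) -[RHS](lhom_eqE _ rs); congr (r _).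
Qed.

Lemma free_fin_rankP (X : lmodType R) : free_fin_rank X <-> dual_basis X.
Proof.
split; first exact: free_fin_rank_dual_basis.
by apply: (free_submod (f := lhom_id X)).
Qed.

End PrincipalDomain.

(** * Frobenius categories in which the free modules are projective and injective *)

Section FrobeniusModuleCategory.
Variables (A : pzRingType) (P : lmodType A -> Prop).
Notation E := (modcat P).
Hypothesis P_ext : ext_closed P.
Hypothesis P_free : forall n, P {ffun 'I_n -> A^o}.
Hypothesis P_cover : forall X, P X ->
  exists n (g : lhom {ffun 'I_n -> A^o} X),
    (forall x, exists v, g v = x) /\ P (subm (lkerm g)).
Hypothesis P_envelope : forall X, P X ->
  exists n (j : lhom X {ffun 'I_n -> A^o}), injective j /\ P (quotm (limm j)).
Hypothesis P_extend : forall (X Y Z : lmodType A) (f : lhom X Y) (g : lhom Y Z),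
  P X -> P Y -> P Z -> short_exact f g ->
  forall h : lhom X A^o, exists l : lhom Y A^o, lhom_comp l f = h.

Let obj_free n : E := mobj (P_free n).

Lemma in_add_ex_projective (X : E) : in_add A^o (sval X) -> ex_projective X.
Proof.
move=> [n [s [r rs]]] U V W f g fg h.
have [l gl] := free_lift (lhom_comp h r) (ses_surj fg).
have glE v : g $ (l v) = h $ (r v) := lhom_eqE v gl.
have rsE x : r (s x) = x := lhom_eqE x rs.
by exists (lhom_comp l s); apply: lhom_ext => x; rewrite modcat_cmpE lhom_compE glE rsE.
Qed.

Lemma in_add_ex_injective (X : E) : in_add A^o (sval X) -> ex_injective X.
Proof.
move=> [n [s [r rs]]] U V W f g fg h.
have ex i := P_extend (svalP U) (svalP V) (svalP W) fg
  (lhom_comp (ffun_proj A^o i) (lhom_comp s h)).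
have [l lP] := choice ex.
have rsE x : r (s x) = x := lhom_eqE x rs.
exists (lhom_comp r (lhom_ffun l)); apply: lhom_ext => x.
rewrite modcat_cmpE lhom_compE -[RHS]rsE; congr (r _).
by apply/ffunP => i; rewrite ffunE; apply: (lhom_eqE x (lP i)).
Qed.

Lemma ex_projective_in_add (X : E) : ex_projective X -> in_add A^o (sval X).
Proof.
move=> Xp; have [n [g [gs PK]]] := P_cover (svalP X).
have fg : @confl E (mobj PK) (obj_free n) X (subm_in (lkerm g)) g by apply: ker_exact.
have [s gsE] := Xp _ _ _ _ _ fg (idm X).
by exists n, s, g.
Qed.

Lemma ex_injective_in_add (X : E) : ex_injective X -> in_add A^o (sval X).
Proof.
move=> Xi; have [n [j [jI PC]]] := P_envelope (svalP X).
have fg : @confl E X (obj_free n) (mobj PC) j (quotm_pi (limm j)) by apply: coker_exact.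
have [r rj] := Xi _ _ _ _ _ fg (idm X).
by exists n, j, r.
Qed.

Lemma in_add_free (X : E) n : sval X = {ffun 'I_n -> A^o} :> lmodType A -> in_add A^o (sval X).
Proof. by move=> ->; exists n, (lhom_id _), (lhom_id _); apply: lhom_ext. Qed.

(** Projectives and injectives both coincide with add A: a free cover of a projective splits, as
    does a free embedding of an injective, and [P_extend] makes A injective relative to the
    conflations. *)
Theorem modcat_Frobenius : Frobenius E.
Proof.
split; first exact: modcat_exact.
- move=> X; split; first by move/ex_projective_in_add/in_add_ex_injective.
  by move/ex_injective_in_add/in_add_ex_projective.
- move=> X; have [n [g [gs PK]]] := P_cover (svalP X).
  exists (mobj PK), (obj_free n), (subm_in (lkerm g)), g; split; last exact: ker_exact.
  exact/in_add_ex_projective/(@in_add_free (obj_free n)).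
move=> X; have [n [j [jI PC]]] := P_envelope (svalP X).
exists (obj_free n), (mobj PC), j, (quotm_pi (limm j)); split; last exact: coker_exact.
exact/in_add_ex_injective/(@in_add_free (obj_free n)).
Qed.

Theorem modcat_stable_ideal : stable_ideal (add_ideal (A^o : lmodType A) : ideal E).
Proof.
split; first exact: modcat_Frobenius.
move=> X Y f; split.
  move=> [Q [g [h [[n [s [r rs]]] ->]]]].
  exists (obj_free n), (lhom_comp g r), (lhom_comp s h); split.
    exact/in_add_ex_projective/(@in_add_free (obj_free n)).
  have rsE q : r (s q) = q := lhom_eqE q rs.
  by apply: lhom_ext => x; rewrite modcat_cmpE !lhom_compE rsE.
move=> [Q [g [h [Qp ->]]]]; exists (sval Q), g, h; split=> //.
exact: ex_projective_in_add.
Qed.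

End FrobeniusModuleCategory.

(** * Selfinjective algebras *)

Section FinitelyGenerated.
Variable A : pzRingType.

Lemma fin_genI (I : finType) (M : lmodType A) (x : I -> M) :
  (forall m, exists c : I -> A, m = \sum_i c i *: x i) -> fin_gen M.
Proof.
move=> xP; exists #|I|, (fun i => x (enum_val i)) => m; have [c ->] := xP m.
exists (fun i => c (enum_val i)).
rewrite (reindex_onto (fun i : 'I_#|I| => enum_val i) enum_rank) /= => [|i _].
  by apply: eq_bigl => i; rewrite enum_valK eqxx.
exact: enum_rankK.
Qed.

Lemma fin_gen_quot (M N : lmodType A) (g : lhom M N) :
  (forall y, exists x, g x = y) -> fin_gen M -> fin_gen N.
Proof.
move=> gs [n [x xP]]; exists n, (fun i => g (x i)) => y.
have [m <-] := gs y; have [c ->] := xP m; exists c.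
by rewrite lhom_sum; apply: eq_bigr => i _; rewrite lhomZ.
Qed.

Lemma fin_gen_ext_closed : ext_closed (@fin_gen A).
Proof.
split=> [M M0|L M N f g fg [n [x xP]] [p [z zP]]].
  by exists 0%N, (fun=> 0) => m; exists (fun=> 0); rewrite big_ord0.
have [y yz] := choice (fun j => ses_surj fg (z j)).
apply: (@fin_genI ('I_n + 'I_p)%type _
  (fun k => match k with inl i => f (x i) | inr j => y j end)) => m.
have [d gm] := zP (g m).
have [|l fl] := @ses_mid _ _ _ _ _ _ fg (m - \sum_j d j *: y j).
  rewrite lhomB gm lhom_sum; under [X in _ - X]eq_bigr => j _ do rewrite lhomZ yz.
  by rewrite subrr.
have [c lc] := xP l.
exists (fun k => match k with inl i => c i | inr j => d j end).
rewrite big_sumType /= -[LHS](subrK (\sum_j d j *: y j)) -fl lc lhom_sum.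
by congr (_ + _); apply: eq_bigr => i _; rewrite lhomZ.
Qed.

End FinitelyGenerated.

Lemma fin_gen_restr (R : pzRingType) (A : lalgType R) (X : lmodType A) :
  fin_gen (@restr R A X : lmodType R) -> fin_gen X.
Proof.
move=> [n [x xP]]; exists n, x => m; have [c e] := xP m.
by exists (fun i => (c i)%:A).
Qed.

Section VectorSpaces.
Variables (k : fieldType) (V : vectType k).

Lemma vectType_dual_basis : dual_basis (V : lmodType k).
Proof.
have cL i : linear (coord (vbasis {:V}) i : V -> k^o) by move=> a x y; rewrite linearP.
exists 'I_(\dim {:V}), (fun i : 'I__ => (vbasis {:V})`_i), (fun i => mklhom (cL i)) => v.
exact: (coord_vbasis (memvf v)).
Qed.

(** Among the subspaces contained in [N], one of largest dimension is all of [N], since a further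
    vector of [N] would enlarge it. *)
Lemma submod_vspace (N : submod (V : lmodType k)) :
  exists U : {vspace V}, forall v, v \in U <-> N v.
Proof.
pose p n := `[< exists U : {vspace V}, \dim U = n /\ forall v, v \in U -> N v >].
have ex_p : exists n, p n.
  exists 0%N; apply/asboolP; exists 0%VS; split=> [|v]; first exact: dimv0.
  by rewrite memv0 => /eqP ->; apply: smem0.
have p_le n : p n -> (n <= \dim {:V})%N.
  by move=> /asboolP[U [<- _]]; apply: dimvS; apply: subvf.
case: (ex_maxnP ex_p p_le) => n /asboolP[U [Un UN]] nmax; exists U => v.
split=> [/UN //|vN]; apply: contraT => vU.
suff /nmax : p (\dim (U + <[v]>)%VS).
  move=> le; have /eqP UE : U == (U + <[v]>)%VS by rewrite eqEdim addvSl Un le.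
  by case/negP: vU; rewrite UE; apply: (subvP (addvSr _ _)); apply: memv_line.
apply/asboolP; exists (U + <[v]>)%VS; split=> // w /memv_addP[u uU [_ /vlineP[c ->] ->]].
by rewrite addrC; apply: smemP => //; apply: UN.
Qed.

Lemma submod_chain_bound (N : nat -> submod (V : lmodType k)) n :
  (forall i, (i < n)%N ->
    (forall v, N i v -> N i.+1 v) /\ exists v, N i.+1 v /\ ~ N i v) ->
  (n <= \dim {:V})%N.
Proof.
move=> strict; have [U UP] := choice (fun i => submod_vspace (N i)).
suff le i : (i <= n)%N -> (i <= \dim (U i))%N.
  by apply: leq_trans (le n (leqnn n)) _; apply: dimvS; apply: subvf.
elim: i => // i IHi lt_in; have [sub [v [v1 v0]]] := strict i lt_in.
apply: leq_ltn_trans (IHi (ltnW lt_in)) _.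
have sUU : (U i <= U i.+1)%VS by apply/subvP => w /UP/sub/UP.
rewrite (ltn_leqif (dimv_leqif_sup sUU)); apply/negP => /subvP/(_ v) h.
by apply: v0; apply/UP/h/UP.
Qed.

End VectorSpaces.

Lemma field_principal_domain (k : fieldType) : principal_domain k.
Proof.
split=> [a b /eqP|J]; first by rewrite mulf_eq0 => /orP[]/eqP; [left | right].
have [[a [Ja /eqP a0]]|J0] := pselect (exists a : k, J a /\ a <> 0).
  by exists a; split=> // x _; exists (x / a); rewrite divfK.
exists 0; split=> [|x Jx]; first exact: (smem0 J).
by exists 0; rewrite mulr0; apply: contrapT => x0; apply: J0; exists x.
Qed.

Section SelfInjectiveAlgebra.
Variables (k : fieldType) (B : falgType k).

Notation D := (Rdual B : lmodType B).
Notation "d ## b" := (lhom_fun (d : lhom B k^o) b) (at level 10, b at level 9).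

Lemma Rdual_scaleE (a : B) (d : D) b : (a *: d) ## b = d ## (b * a).
Proof. by []. Qed.

Lemma Rdual_sum (I : finType) (d : I -> D) b : (\sum_i d i) ## b = \sum_i d i ## b.
Proof. by elim/big_rec2: _ => // i y1 y2 _ <-. Qed.

Lemma algE (c : k) (d : D) b : ((c%:A : B) *: d) ## b = c * d ## b.
Proof. by rewrite Rdual_scaleE mulr_algr lhomZ. Qed.

Let X (i : 'I_(\dim {:B})) : B := (vbasis {:B})`_i.
Fact coord_subproof i : linear (coord (vbasis {:B}) i : B -> k^o).
Proof. by move=> a x y; rewrite linearP. Qed.
Definition dual_vect i : D := mklhom (coord_subproof i).

Lemma basis_expand b : b = \sum_i dual_vect i ## b *: X i.
Proof. exact: (coord_vbasis (memvf b)). Qed.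

Lemma dual_expand (d : D) : d = \sum_i ((d ## (X i))%:A : B) *: dual_vect i.
Proof.
apply: lhom_ext => b; rewrite Rdual_sum {1}(basis_expand b) lhom_sum.
by apply: eq_bigr => i _; rewrite lhomZ algE [LHS]mulrC.
Qed.

Lemma dual_vect_inj b : (forall i, dual_vect i ## b = 0) -> b = 0.
Proof. by move=> b0; rewrite (basis_expand b) big1 // => i _; rewrite b0 scale0r. Qed.

Definition unit_in_trace : Prop :=
  exists (I : finType) (f : I -> lhom D B^o) (d : I -> D), \sum_i f i (d i) = 1 :> B.

(* [b |-> (b xi_i)_i] embeds B in a power of its dual, which splits by injectivity. *)
Lemma selfinjective_trace : selfinjective B -> unit_in_trace.
Proof.
move=> Binj; pose I := 'I_(\dim {:B}).
have jL : linear (fun b : B^o => [ffun i : I => (b : B) *: dual_vect i]).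
  by move=> a x y; apply/ffunP => i; rewrite !ffunE scalerDl scalerA.
have jI : injective (mklhom jL).
  apply: lhom_inj0 => b /ffunP jb; apply: dual_vect_inj => i.
  have := jb i; rewrite !ffunE => /(congr1 (fun d : D => d ## 1)).
  by rewrite Rdual_scaleE mul1r.
have [r rj] := Binj _ _ _ (lhom_id B^o) jI.
have eL i : linear (fun d : D => [ffun j : I => d *+ (i == j)]).
  move=> a x y; apply/ffunP => j; rewrite !ffunE.
  by case: eqP => _; rewrite ?mulr1n ?mulr0n ?scaler0 ?addr0.
exists I, (fun i => lhom_comp r (mklhom (eL i))), dual_vect.
rewrite -[RHS](lhom_eqE (1 : B^o) rj) -[LHS]lhom_sum; congr (r _).
apply/ffunP => j; rewrite sum_ffunE (bigD1 j) //= big1 => [|i /negbTE ij].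
  by rewrite !ffunE eqxx addr0 scale1r.
by rewrite ffunE ij.
Qed.

Fact dual_rmul_subproof b (d : D) : linear (fun y : B => d ## (b * y) : k^o).
Proof. by move=> a x y; rewrite mulrDr -scalerAr lhomP. Qed.
Definition dual_rmul0 b (d : D) : D := mklhom (dual_rmul_subproof b d).
Fact dual_rmulP b : linear (dual_rmul0 b).
Proof.
move=> a d d'; apply: lhom_ext => y.
rewrite -[LHS]/(lhom_fun (a *: d + d' : D) (b * y)).
by rewrite -[RHS]/(d ## (b * (y * a)) + d' ## (b * y)) mulrA.
Qed.
(** The right action of B on its dual, which commutes with the left one. *)
Definition dual_rmul b : lhom D D := mklhom (dual_rmulP b).

Lemma dual_rmulE b d y : dual_rmul b d ## y = d ## (b * y).
Proof. by []. Qed.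

(** The functional d |-> (phi d)(1) on D is evaluation at some b, because B is its own bidual over
    k. Linearity of phi over B then moves the evaluation point from 1 to any y. *)
Lemma dual_rmul_surj (phi : lhom D D) : exists b, forall d, phi d = dual_rmul b d.
Proof.
pose b := \sum_i (phi (dual_vect i)) ## 1 *: X i; exists b.
have bP d : d ## b = (phi d) ## 1.
  rewrite /b lhom_sum {2}(dual_expand d) lhom_sum Rdual_sum.
  by apply: eq_bigr => i _; rewrite !lhomZ algE [LHS]mulrC.
move=> d; apply: lhom_ext => y.
by rewrite -[y in LHS]mul1r -Rdual_scaleE -lhomZ -bP.
Qed.

Definition two_sided (J : submod (B : lmodType k)) : Prop :=
  forall a b u, J u -> J (a * u * b).

(* The product D J Hom(D, B), read as an ideal of B through [dual_rmul_surj]; for J = B it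
   is the trace ideal of a Morita context between B and B. *)
Definition trace_mem (J : submod (B : lmodType k)) (b : B) : Prop :=
  exists (I : finType) (f : I -> lhom D B^o) (u : I -> B) (d : I -> D),
    (forall i, J (u i)) /\
    forall x, dual_rmul b x = \sum_i (f i x * u i : B) *: d i.

Fact trace_mem0 J : trace_mem J 0.
Proof.
exists 'I_0, (fun=> 0), (fun=> 0), (fun=> 0); split=> [i|x]; first exact: smem0.
by rewrite big_ord0; apply: lhom_ext => y; rewrite dual_rmulE mul0r lhom0.
Qed.

Fact trace_memP J c b b' : trace_mem J b -> trace_mem J b' -> trace_mem J (c *: b + b').
Proof.
move=> [I [f [u [d [Ju bP]]]]] [I' [f' [u' [d' [Ju' bP']]]]].
exists (I + I')%type,
  (fun t => match t with inl i => f i | inr i => f' i end),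
  (fun t => match t with inl i => c *: u i | inr i => u' i end),
  (fun t => match t with inl i => d i | inr i => d' i end); split.
  case=> i //; rewrite -[_ *: _]addr0; apply: smemP => //; exact: smem0.
move=> x; rewrite big_sumType /= -bP'.
under eq_bigr => i _ do rewrite -scalerAr -mulr_algl -scalerA.
rewrite -scaler_sumr -bP; apply: lhom_ext => y.
rewrite -[RHS]/((_ *: dual_rmul b x) ## y + dual_rmul b' x ## y) algE !dual_rmulE.
by rewrite mulrDl -scalerAl lhomP.
Qed.

Definition trace_ideal J : submod (B : lmodType k) :=
  @Submod _ _ (trace_mem J) (trace_mem0 J) (@trace_memP J).

Lemma trace_two_sided J : two_sided (trace_ideal J).
Proof.
move=> a c b [I [f [u [d [Ju bP]]]]].
exists I, (fun i => lhom_comp (f i) (dual_rmul a)), u, (fun i => dual_rmul c (d i)).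
split=> // x; transitivity (dual_rmul c (dual_rmul b (dual_rmul a x))).
  by apply: lhom_ext => y; rewrite !dual_rmulE !mulrA.
by rewrite bP lhom_sum; apply: eq_bigr => i _; rewrite lhomZ.
Qed.

Lemma trace_mono (J J' : submod (B : lmodType k)) :
  (forall b, J b -> J' b) -> forall b, trace_ideal J b -> trace_ideal J' b.
Proof. by move=> JJ' b [I [f [u [d [Ju bP]]]]]; exists I, f, u, d; split=> // i; apply/JJ'. Qed.

Lemma submod_sum (R : pzRingType) (M : lmodType R) (N : submod M) (I : finType) (x : I -> M) :
  (forall i, N (x i)) -> N (\sum_i x i).
Proof.
move=> Nx; elim/big_ind: _ => // [|a b Na Nb]; first exact: smem0.
by rewrite -[a]scale1r; apply: smemP.
Qed.

(** Multiplying j on both sides by 1 = sum f_a(d_a) leaves terms f_a(d_a) j f_b(d_b) = f_b(phi(d_a))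
    with phi = f_a(-) j d_b. This endomorphism of D lies in the trace ideal of J', hence in that of
    J; rewriting it with coefficients from J puts each term in J. *)
Lemma trace_reflect (J J' : submod (B : lmodType k)) : unit_in_trace -> two_sided J ->
  (forall b, trace_ideal J' b -> trace_ideal J b) -> forall b, J' b -> J b.
Proof.
move=> [I [f [d fd]]] J2 sub j J'j.
have -> : j = \sum_a \sum_b f a (d a) * j * (f b (d b) : B).
  under eq_bigr => a _ do rewrite -mulr_sumr fd mulr1.
  by rewrite -mulr_suml fd mul1r.
apply: submod_sum => a; apply: submod_sum => b.
have phiL : linear (fun x : D => (f a x * j : B) *: d b).
  by move=> c x y; rewrite lhomP mulrDl scalerDl scalerA mulrA.
have [beta betaP] := dual_rmul_surj (mklhom phiL).
have /sub[T [g [u [e [Ju bP]]]]] : trace_ideal J' beta.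
  exists 'I_1, (fun=> f a), (fun=> j), (fun=> d b); split=> // x.
  by rewrite big_ord1 -betaP.
have -> : f a (d a) * j * (f b (d b) : B) = \sum_t (g t (d a) : B) * u t * (f b (e t) : B).
  have -> : f a (d a) * j * (f b (d b) : B) = f b ((f a (d a) * j : B) *: d b) by rewrite lhomZ.
  rewrite -[X in f b X]/(mklhom phiL (d a)) betaP bP lhom_sum.
  by apply: eq_bigr => t _; rewrite lhomZ.
by apply: submod_sum => t; apply: J2.
Qed.

Definition full_ideal : submod (B : lmodType k) :=
  @Submod _ _ (fun=> True) I (fun _ _ _ _ _ => I).

(* If the trace ideal of D were proper, [trace_ideal] would turn every strict chain of
   two-sided ideals into a longer one. *)
Lemma trace_unit : unit_in_trace -> trace_ideal full_ideal 1.
Proof.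
move=> tr; apply: contrapT => tr1.
have chain n : exists J : nat -> submod (B : lmodType k),
    [/\ forall i, two_sided (J i),
        forall i, (i < n)%N ->
          (forall b, J i b -> J i.+1 b) /\ exists b, J i.+1 b /\ ~ J i b &
        forall b, J n b].
  elim: n => [|n [J [J2 Js Jn]]]; first by exists (fun=> full_ideal).
  (* The new chain consists of the trace ideals of the old one, followed by B. Old links stay strict
     because [trace_ideal] reflects inclusions; the added last link is strict because 1 is not a
     trace. *)
  exists (fun i => if (i <= n)%N then trace_ideal (J i) else full_ideal); split.
  - by move=> i; case: ifP => // _; apply: trace_two_sided.
  - move=> i; rewrite ltnS => le_in; rewrite le_in; case: ltnP => [lt_in|le_ni].
      have [JJ [b [Jb1 Jb0]]] := Js i lt_in; split; first exact: trace_mono.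
      apply: contrapT => nex; apply: Jb0; apply: (@trace_reflect (J i) (J i.+1)) => // c Jc.
      by apply: contrapT => nJc; apply: nex; exists c.
    split=> //; exists 1; split=> //.
    by move=> h; apply: tr1; apply: trace_mono h.
  - by move=> b; rewrite ltnn.
have [J [_ Js _]] := chain (\dim {:B}).+1.
by have := submod_chain_bound Js; rewrite ltnn.
Qed.

Hypothesis B_inj : selfinjective B.

(** Right multiplication by 1 is the identity, so membership of 1 in the trace ideal reads x = sum
    f_i(x) u_i d_i, which is a dual basis. *)
Theorem selfinjective_dual_basis : dual_basis D.
Proof.
have [I [f [u [d [_ idP]]]]] := trace_unit (selfinjective_trace B_inj).
exists I, (fun i => u i *: d i), f => x.
under eq_bigr => i _ do rewrite scalerA.
by rewrite -idP; apply: lhom_ext => y; rewrite dual_rmulE mul1r.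
Qed.

(** A k-functional xi on M gives the B-map v |-> (b |-> xi(b v)) from M to D, and the coordinate
    functionals make these maps jointly injective. A dual basis of D turns maps to D into maps to
    B. *)
Lemma fin_gen_embeds (M : lmodType B) : fin_gen M ->
  exists n (j : lhom M {ffun 'I_n -> B^o}), injective j.
Proof.
move=> /fin_gen_surj[m [g gs]]; pose V := {ffun 'I_m -> B}.
have gP c (v w : V) : g v = 0 -> g w = 0 -> g (c *: v + w : V) = 0.
  move=> gv gw; rewrite -[LHS](_ : g ((c%:A : B) *: (v : {ffun 'I_m -> B^o}) + w) = _).
    by rewrite lhomP gv gw scaler0 addr0.
  by congr (g _); apply/ffunP => i; rewrite !ffunE; congr (_ + _); exact: (mulr_algl c (v i)).
have [U UP] := submod_vspace (@Submod k V (fun v => g v = 0) (lhom0 g) gP).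
(* A k-linear map with kernel U = ker g: it embeds M in B^m over k, with no linearity over B. *)
pose p (v : V) : V := v - projv U v.
have p0 v : p v = 0 <-> g v = 0.
  rewrite /p; split=> [/subr0_eq ->|/UP vU]; first exact/UP/memv_proj.
  by rewrite projv_id ?subrr.
have pP c (v w : V) : p (c *: v + w) = c *: p v + p w.
  by rewrite /p linearP opprD addrACA scalerBr.
have pD (v w : V) : p (v + w) = p v + p w by have := pP 1 v w; rewrite !scale1r.
have algZ c b (v : V) : ((c *: b : B) *: (v : {ffun 'I_m -> B^o})) = c *: ((b *: (v : {ffun 'I_m -> B^o})) : V).
  by apply/ffunP => i; rewrite !ffunE scalerAl.
have dL i j (v : V) : linear (fun b : B => dual_vect j ## (p ((b : B) *: (v : {ffun 'I_m -> B^o})) i) : k^o).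
  by move=> c a b; rewrite scalerDl algZ pP !ffunE lhomP.
have PsiL i j : linear (fun v : {ffun 'I_m -> B^o} => mklhom (dL i j v) : D).
  move=> a v w; apply: lhom_ext => b; rewrite mklhomE.
  rewrite -[RHS]/(dual_vect j ## (p ((b * a) *: v) i) + dual_vect j ## (p (b *: w) i)).
  by rewrite scalerDr scalerA [p (_ + _)]pD ffunE lhomD.
have [T [x [phi xP]]] := selfinjective_dual_basis.
pose Psi := lhom_ffun (fun t : 'I_#|{: 'I_m * 'I_(\dim {:B}) * T}| =>
  lhom_comp (phi (enum_val t).2) (mklhom (PsiL (enum_val t).1.1 (enum_val t).1.2))).
have kerPsi v : Psi v = 0 <-> g v = 0.
  split=> [/ffunP Pv|gv].
    apply/p0/ffunP => i; rewrite [RHS]ffunE; apply: dual_vect_inj => j.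
    have Pij : mklhom (PsiL i j) v = 0.
      rewrite [LHS]xP big1 // => t _.
      by have := Pv (enum_rank (i, j, t)); rewrite !ffunE lhom_compE enum_rankK => ->; rewrite scale0r.
    have := congr1 (fun d : D => d ## 1) Pij.
    by rewrite [X in X = _ -> _]/(dual_vect j ## (p (1 *: v) i)) scale1r.
  apply/ffunP => t; rewrite !ffunE lhom_compE -[RHS](lhom0 (phi (enum_val t).2)).
  congr (phi _ _); apply: lhom_ext => b; rewrite -[LHS]/(dual_vect _ ## (p (b *: v) _)).
  by have /p0 -> : g (b *: v) = 0; [rewrite lhomZ gv scaler0 | rewrite ffunE lhom0].
have [|j jP] := lhom_factor_surj (f := Psi) gs; first by move=> v /kerPsi.
exists _, j; apply: lhom_inj0 => y; have [v <-] := gs y.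
by rewrite jP => /kerPsi.
Qed.

Lemma fin_gen_kernel n (M : lmodType B) (g : lhom {ffun 'I_n -> B^o} M) :
  fin_gen (subm (lkerm g)).
Proof.
apply: (@fin_gen_restr k); apply: dual_basis_fin_gen; apply/free_fin_rank_dual_basis.
have iL : linear (fun u : restr (subm (lkerm g)) =>
    subm_in _ (u : subm (lkerm g)) : {ffun 'I_n -> B}).
  move=> c u v; apply/ffunP => i; rewrite lhomP !ffunE.
  by congr (_ + _); apply: (mulr_algl c (_ : B)).
apply: (free_submod (field_principal_domain k) (f := mklhom iL)).
  by move=> u v; apply: (@subm_in_inj _ _ (lkerm g) u v).
exact: vectType_dual_basis.
Qed.

Theorem mod_fg_stable_ideal : stable_ideal (add_ideal (B^o : lmodType B) : ideal (mod_fg B)).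
Proof.
apply: modcat_stable_ideal.
- exact: fin_gen_ext_closed.
- by move=> n; apply: dual_basis_fin_gen; apply: dual_basis_free.
- move=> M /fin_gen_surj[n [g gs]]; exists n, g; split=> //; exact: fin_gen_kernel.
- move=> M /fin_gen_embeds[n [j jI]]; exists n, j; split=> //.
  apply: (fin_gen_quot (@quotm_pi_surj _ _ _)).
  by apply: dual_basis_fin_gen; apply: dual_basis_free.
by move=> L M N f g _ _ _ fg h; apply: B_inj; apply: (ses_inj fg).
Qed.

End SelfInjectiveAlgebra.

(** * The order A *)

Section Shift.
Variable S : nzRingType.
Implicit Types f g c : fps S.

(** Multiplication by t; [fps_unshift] is division by t with the constant term discarded. *)
Definition fps_shift c : fps S := Fps (fun n => if n is m.+1 then fcoef c m else 0).
Definition fps_unshift f : fps S := Fps (fun n => fcoef f n.+1).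

Lemma fcoefD f g n : fcoef (f + g) n = fcoef f n + fcoef g n.
Proof. by []. Qed.
Lemma fcoef0 n : fcoef (0 : fps S) n = 0.
Proof. by []. Qed.
Lemma fcoef_sum (I : Type) (r : seq I) (P : pred I) (F : I -> fps S) n :
  fcoef (\sum_(i <- r | P i) F i) n = \sum_(i <- r | P i) fcoef (F i) n.
Proof. by elim/big_rec2: _ => // i x y _ <-. Qed.

Lemma fps_shiftK : cancel fps_shift fps_unshift.
Proof. by move=> c; apply: fps_ext. Qed.
Lemma fps_unshiftK f : fcoef f 0 = 0 -> fps_shift (fps_unshift f) = f.
Proof. by move=> f0; apply: fps_ext => -[|n]. Qed.
Lemma fps_shiftD : {morph fps_shift : f g / f + g}.
Proof. by move=> f g; apply: fps_ext => -[|n] //=; rewrite addr0. Qed.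
Lemma fps_unshiftD : {morph fps_unshift : f g / f + g}.
Proof. by move=> f g; apply: fps_ext. Qed.
Lemma fps_shift0 : fps_shift 0 = 0.
Proof. by apply: fps_ext => -[]. Qed.

Lemma fps_shiftMl c f : fps_shift c * f = fps_shift (c * f).
Proof.
apply: fps_ext => -[|n]; rewrite fcoefM.
  by rewrite big_ord1 mul0r.
by rewrite big_ord_recl mul0r add0r.
Qed.

Lemma fps_shiftMr f c : f * fps_shift c = fps_shift (f * c).
Proof.
apply: fps_ext => -[|n]; rewrite fcoefM.
  by rewrite big_ord1 mulr0.
rewrite big_ord_recr /= subnn mulr0 addr0; apply: eq_bigr => i _.
by rewrite subSn // -ltnS.
Qed.

Lemma fps_shift_inj : injective fps_shift.
Proof. exact: can_inj fps_shiftK. Qed.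

Lemma fps_constMc a f n : fcoef (fps_const a * f) n = a * fcoef f n.
Proof. by rewrite [_ * _]fps_constM. Qed.
Lemma fps_Mconstc f a n : fcoef (f * fps_const a) n = fcoef f n * a.
Proof. by rewrite [_ * _]fps_Mconst. Qed.

End Shift.

(** * Power series over a field form a principal ideal domain *)

Section PowerSeriesDomain.
Variable k : fieldType.
Implicit Types a b u x y : fps k.

Lemma fps_neq0P a : a <> 0 ->
  exists m, fcoef a m != 0 /\ forall i, (i < m)%N -> fcoef a i = 0.
Proof.
move=> a0; have ex : exists m, fcoef a m != 0.
  apply: contrapT => h; apply: a0; apply: fps_ext => n; apply/eqP/contraT => an.
  by case: h; exists n.
case: (ex_minnP ex) => m am mmin; exists m; split=> // i lt_im.
by apply/eqP/contraT => /mmin; rewrite leqNgt lt_im.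
Qed.

Lemma fps_mul_eq0 a b : a * b = 0 -> a = 0 \/ b = 0.
Proof.
move=> ab; have [->|/eqP/fps_neq0P[m [am am0]]] := eqVneq a 0; first by left.
have [->|/eqP/fps_neq0P[n [bn bn0]]] := eqVneq b 0; first by right.
have := congr1 (fun f => fcoef f (m + n)) ab; rewrite fcoefM fcoef0.
have lt_m : (m < (m + n).+1)%N by rewrite ltnS leq_addr.
rewrite (bigD1 (Ordinal lt_m)) //= big1 ?addr0 => [|i].
  by rewrite addKn => /eqP; rewrite mulf_eq0 (negbTE am) (negbTE bn).
rewrite -val_eqE /= => ne_im; case: (ltngtP i m) ne_im => // [lt_im|lt_mi] _.
  by rewrite am0 // mul0r.
rewrite bn0 ?mulr0 // ltn_subLR ?ltn_add2r //; by rewrite -ltnS.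
Qed.

(** The first n coefficients of y / u, by solving y = c u degree by degree. The list is carried
    along because each coefficient depends on all earlier ones. *)
Fixpoint fps_quot_seq u y n : seq k :=
  if n is m.+1 then
    let s := fps_quot_seq u y m in
    rcons s ((fcoef y m - \sum_(i < m) s`_i * fcoef u (m - i)) / fcoef u 0)
  else [::].

Lemma fps_dvd_unit u y : fcoef u 0 != 0 -> exists c, y = c * u.
Proof.
move=> u0; pose s := fps_quot_seq u y; pose c := Fps (fun n => (s n.+1)`_n).
have size_s n : size (s n) = n by elim: n => //= n IHn; rewrite size_rcons IHn.
have s_c n i : (i < n)%N -> (s n)`_i = fcoef c i.
  elim: n => // n IHn; rewrite ltnS leq_eqVlt => /orP[/eqP -> //|lt_in].
  by rewrite -(IHn lt_in) /= nth_rcons size_s lt_in.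
exists c; apply: fps_ext => n; rewrite fcoefM big_ord_recr /= subnn.
rewrite nth_rcons size_s ltnn eqxx divfK // addrC -[LHS](subrK (\sum_(i < n) (s n)`_i * fcoef u (n - i))).
by congr (_ + _); apply: eq_bigr => i _; rewrite s_c.
Qed.

Lemma fps_iter_unshift m f n : fcoef (iter m (@fps_unshift k) f) n = fcoef f (n + m).
Proof. by elim: m n => [|m IHm] n /=; rewrite ?addn0 // IHm addSnnS. Qed.

Lemma fps_iter_shiftK m f : (forall i, (i < m)%N -> fcoef f i = 0) ->
  f = iter m (@fps_shift k) (iter m (@fps_unshift k) f).
Proof.
elim: m f => // m IHm f f0.
rewrite -[LHS]fps_unshiftK ?f0 // [iter m.+1 (@fps_unshift k) f]iterSr iterS.
by congr (fps_shift _); apply: IHm => i lt_im; apply: f0.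
Qed.

Lemma fps_iter_shiftMr m c u : iter m (@fps_shift k) (c * u) = c * iter m (@fps_shift k) u.
Proof. by elim: m => //= m ->; rewrite fps_shiftMr. Qed.

(** An element a of J of least order m generates J: after division by t^m, a has a nonzero constant
    term and therefore divides every series. *)
Lemma fps_principal_domain : principal_domain (fps k).
Proof.
split; first exact: fps_mul_eq0.
move=> J; have [nz|J0] := pselect (exists n a, J a /\ fcoef a n != 0); last first.
  exists 0; split=> [|x Jx]; first exact: (smem0 J).
  exists 0; rewrite mulr0; apply: fps_ext => n; apply/eqP/contraT => xn.
  by case: J0; exists n, x.
have ex : exists n, `[< exists a, J a /\ fcoef a n != 0 >].
  by have [n h] := nz; exists n; apply/asboolP.
case: (ex_minnP ex) => m /asboolP[a [Ja am]] mmin.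
have low x i : J x -> (i < m)%N -> fcoef x i = 0.
  move=> Jx lt_im; apply/eqP/contraT => xi.
  have /mmin : `[< exists a, J a /\ fcoef a i != 0 >] by apply/asboolP; exists x.
  by rewrite leqNgt lt_im.
exists a; split=> // x Jx.
have [|c e] := @fps_dvd_unit (iter m (@fps_unshift k) a) (iter m (@fps_unshift k) x).
  by rewrite fps_iter_unshift.
exists c; rewrite (@fps_iter_shiftK m x) => [|i]; last exact: low.
by rewrite e fps_iter_shiftMr -fps_iter_shiftK => // i; apply: low.
Qed.

End PowerSeriesDomain.

(* Writing the lower left entry of an element of tord B as t c makes (a, b, c, d) range
   over all quadruples of series. *)
Section OrderCoordinates.
Variables (k : comNzRingType) (B : algType k).
Notation A := (tord B).
Notation S := (fps B).
Implicit Types (a b c d l : S) (h g : A).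

Fact tmx_in a b c d :
  (\matrix_(i, j) (if i == 0 then if j == 0 then a else b
                   else if j == 0 then fps_shift c else d) : 'M[S]_2) \in hord_pred B.
Proof. by rewrite inE mxE. Qed.
Definition tmx a b c d : A := Hord (tmx_in a b c d).

Definition t11 h : S := val h 0 0.
Definition t12 h : S := val h 0 1.
Definition t21 h : S := fps_unshift (val h 1 0).
Definition t22 h : S := val h 1 1.

Lemma val10 h : val h 1 0 = fps_shift (t21 h).
Proof. by rewrite fps_unshiftK //; case: h => h /= /eqP. Qed.

Lemma tord_ext h g :
  t11 h = t11 g -> t12 h = t12 g -> t21 h = t21 g -> t22 h = t22 g -> h = g.
Proof.
move=> e11 e12 e21 e22; apply: val_inj; apply/matrixP => i j.
have c0 (x : 'I_2) : x = 0 \/ x = 1.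
  by case: x => [[|[|x]] lt_x] //; [left | right]; apply: val_inj.
have [[->|->] [->|->]] := (c0 i, c0 j) => //.
by rewrite !val10 e21.
Qed.

Lemma t11_tmx a b c d : t11 (tmx a b c d) = a. Proof. by rewrite /t11 mxE. Qed.
Lemma t12_tmx a b c d : t12 (tmx a b c d) = b. Proof. by rewrite /t12 mxE. Qed.
Lemma t21_tmx a b c d : t21 (tmx a b c d) = c.
Proof. by rewrite /t21 mxE /= fps_shiftK. Qed.
Lemma t22_tmx a b c d : t22 (tmx a b c d) = d. Proof. by rewrite /t22 mxE. Qed.

Lemma t11D h g : t11 (h + g) = t11 h + t11 g. Proof. by rewrite /t11 mxE. Qed.
Lemma t12D h g : t12 (h + g) = t12 h + t12 g. Proof. by rewrite /t12 mxE. Qed.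
Lemma t21D h g : t21 (h + g) = t21 h + t21 g.
Proof. by rewrite /t21 -fps_unshiftD mxE. Qed.
Lemma t22D h g : t22 (h + g) = t22 h + t22 g. Proof. by rewrite /t22 mxE. Qed.

Lemma t11_0 : t11 0 = 0. Proof. by rewrite /t11 mxE. Qed.
Lemma t12_0 : t12 0 = 0. Proof. by rewrite /t12 mxE. Qed.
Lemma t21_0 : t21 0 = 0. Proof. by rewrite /t21 mxE; apply: fps_ext. Qed.
Lemma t22_0 : t22 0 = 0. Proof. by rewrite /t22 mxE. Qed.

Lemma t11_1 : t11 1 = 1. Proof. by rewrite /t11 mxE. Qed.
Lemma t12_1 : t12 1 = 0. Proof. by rewrite /t12 mxE. Qed.
Lemma t21_1 : t21 1 = 0. Proof. by rewrite /t21 mxE; apply: fps_ext. Qed.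
Lemma t22_1 : t22 1 = 1. Proof. by rewrite /t22 mxE. Qed.

Lemma valM h g i j : val (h * g) i j = val h i 0 * val g 0 j + val h i 1 * val g 1 j.
Proof.
rewrite mxE !big_ord_recl big_ord0 addr0 /=.
by have -> : lift ord0 ord0 = 1 :> 'I_2 by apply: val_inj.
Qed.

Lemma t11M h g : t11 (h * g) = t11 h * t11 g + fps_shift (t12 h * t21 g).
Proof. by rewrite /t11 valM val10 fps_shiftMr. Qed.
Lemma t12M h g : t12 (h * g) = t11 h * t12 g + t12 h * t22 g.
Proof. exact: valM. Qed.
Lemma t21M h g : t21 (h * g) = t21 h * t11 g + t22 h * t21 g.
Proof.
by rewrite {1}/t21 valM !val10 fps_shiftMr fps_shiftMl -fps_shiftD fps_shiftK.
Qed.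
Lemma t22M h g : t22 (h * g) = fps_shift (t21 h * t12 g) + t22 h * t22 g.
Proof. by rewrite /t22 valM val10 fps_shiftMl. Qed.

Definition tE := (t11D, t12D, t21D, t22D, t11M, t12M, t21M, t22M,
  t11_tmx, t12_tmx, t21_tmx, t22_tmx, (t11_0, t12_0, t21_0, t22_0, t11_1, t12_1, t21_1, t22_1)).
Definition t0E := (mul0r, mulr0, add0r, addr0, mul1r, mulr1, @fps_shift0 B).

(** The scalar matrices and four matrix units, with [tta] equal to t E_21, generate A. Linearity of
    a map over A therefore reduces to these elements ([tord_linear]), and their products are settled
    by coordinates. *)
Definition tsc l : A := tmx l 0 0 l.
Definition te1 : A := tmx 1 0 0 0.
Definition te2 : A := tmx 0 0 0 1.
Definition tal : A := tmx 0 1 0 0.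
Definition tta : A := tmx 0 0 1 0.
Definition tin (b : B) : A := tsc (fps_const b).
Definition tvar : S := fps_shift 1.

Ltac tord := by apply: tord_ext; rewrite ?tE ?t0E.

Lemma tmx_decomp h :
  h = tsc (t11 h) * te1 + tsc (t12 h) * tal + tsc (t21 h) * tta + tsc (t22 h) * te2.
Proof. tord. Qed.

Lemma te12 : te1 + te2 = 1. Proof. tord. Qed.
Lemma te1_te1 : te1 * te1 = te1. Proof. tord. Qed.
Lemma te1_tal : te1 * tal = tal. Proof. tord. Qed.
Lemma te1_tta : te1 * tta = 0. Proof. tord. Qed.
Lemma te1_te2 : te1 * te2 = 0. Proof. tord. Qed.
Lemma te2_te1 : te2 * te1 = 0. Proof. tord. Qed.
Lemma te2_tal : te2 * tal = 0. Proof. tord. Qed.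
Lemma te2_tta : te2 * tta = tta. Proof. tord. Qed.
Lemma te2_te2 : te2 * te2 = te2. Proof. tord. Qed.
Lemma tal_te1 : tal * te1 = 0. Proof. tord. Qed.
Lemma tal_tal : tal * tal = 0. Proof. tord. Qed.
Lemma tal_tta : tal * tta = tsc tvar * te1. Proof. tord. Qed.
Lemma tal_te2 : tal * te2 = tal. Proof. tord. Qed.
Lemma tta_te1 : tta * te1 = tta. Proof. tord. Qed.
Lemma tta_tal : tta * tal = tsc tvar * te2. Proof. tord. Qed.
Lemma tta_tta : tta * tta = 0. Proof. tord. Qed.
Lemma tta_te2 : tta * te2 = 0. Proof. tord. Qed.
Lemma tsc_te1 l : tsc l * te1 = te1 * tsc l. Proof. tord. Qed.
Lemma tsc_te2 l : tsc l * te2 = te2 * tsc l. Proof. tord. Qed.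
Lemma tsc_tal l : tsc l * tal = tal * tsc l. Proof. tord. Qed.
Lemma tsc_tta l : tsc l * tta = tta * tsc l. Proof. tord. Qed.
Lemma tscM l l' : tsc l * tsc l' = tsc (l * l'). Proof. tord. Qed.
Lemma tscD l l' : tsc l + tsc l' = tsc (l + l'). Proof. tord. Qed.
Lemma tsc1 : tsc 1 = 1. Proof. tord. Qed.
Lemma tsc0 : tsc 0 = 0. Proof. tord. Qed.

Lemma fps_constM2 (x y : B) : fps_const x * fps_const y = fps_const (x * y).
Proof. by apply: fps_ext => -[|n]; rewrite fps_constMc //= mulr0. Qed.

Fact tin_zmod : zmod_morphism tin.
Proof.
move=> x y; apply: (addIr (tin y)); rewrite subrK tscD; congr tsc.
by apply: fps_ext => -[|n] /=; rewrite ?subrK ?addr0.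
Qed.
Fact tin_monoid : monoid_morphism tin.
Proof. by split=> [|x y]; [apply: tsc1 | rewrite tscM fps_constM2]. Qed.
HB.instance Definition _ := GRing.isZmodMorphism.Build B A tin tin_zmod.
HB.instance Definition _ := GRing.isMonoidMorphism.Build B A tin tin_monoid.

Lemma tord_scaleE (r : fps k) h : r *: h = tsc (fps_in B r) * h.
Proof.
have scE i j : val (r *: h) i j = fps_in B r * val h i j.
  by rewrite -[val (_ *: h)]/((fps_in B r)%:M *m val h) mul_scalar_mx mxE.
apply: tord_ext; rewrite ?tE ?t0E ?[LHS]scE //.
by rewrite {1}/t21 scE val10 fps_shiftMr fps_shiftK.
Qed.

Lemma tord_algE (r : fps k) : r%:A = tsc (fps_in B r) :> A.
Proof. by rewrite tord_scaleE mulr1. Qed.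

Lemma e11_val : idem_val (e11 B) = te1.
Proof.
apply: val_inj; apply/matrixP => i j; apply: fps_ext => n; rewrite !mxE /=.
rewrite -/(i == 0) [_ == 0 :> 'I_2]eq_sym.
by case: i => [[|[|i]] ?] //; case: j => [[|[|j]] ?] //; case: n => [|n] /=; rewrite ?scale1r ?scale0r.
Qed.

End OrderCoordinates.

Arguments te1 {k B}.
Arguments te2 {k B}.
Arguments tal {k B}.
Arguments tta {k B}.
Arguments tvar {k B}.

Section Restriction.
Variables (R : pzRingType) (A : lalgType R).
Notation res X := (@restr R A X : lmodType R).

Fact restr_lhom_subproof (X Y : lmodType A) (f : lhom X Y) :
  linear (fun x : restr X => f x : restr Y).
Proof. by move=> r x y; rewrite lhomP. Qed.
Definition restr_lhom (X Y : lmodType A) (f : lhom X Y) : lhom (res X) (res Y) :=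
  mklhom (restr_lhom_subproof f).

Lemma restr_exact (X Y Z : lmodType A) (f : lhom X Y) (g : lhom Y Z) :
  short_exact f g -> short_exact (restr_lhom f) (restr_lhom g).
Proof. by move=> [fI gs fg]; split. Qed.

End Restriction.

Section LinearOverOrder.
Variables (k : fieldType) (B : falgType k).
Notation A := (tord B).

Lemma tord_linear (X Y : lmodType A) (f : X -> Y) :
  {morph f : x y / x + y} -> (forall (l : fps B) x, f (tsc l *: x) = tsc l *: f x) ->
  (forall x, f (te1 *: x) = te1 *: f x) -> (forall x, f (te2 *: x) = te2 *: f x) ->
  (forall x, f (tal *: x) = tal *: f x) -> (forall x, f (tta *: x) = tta *: f x) ->
  linear f.
Proof.
move=> fD fs f1 f2 fal fta a x y; rewrite fD (tmx_decomp a) !scalerDl.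
by rewrite !fD -!scalerA !fs f1 f2 fal fta.
Qed.

End LinearOverOrder.

(** * Maps into A built from R-functionals *)

Section FunctionalsAndMaps.
Variables (k : fieldType) (B : falgType k).
Notation A := (tord B).
Notation R := (fps k).
Notation D := (Rdual B : lmodType B).
Notation res X := (@restr (fps k) (tord B) X : lmodType (fps k)).
Notation "d ## b" := (lhom_fun (d : lhom B k^o) b) (at level 10, b at level 9).

Lemma res_scaleE (W : lmodType A) (r : R) (w : W) : (r *: (w : res W)) = tsc (fps_in B r) *: w.
Proof. by rewrite -tord_algE. Qed.

Lemma fps_in_const (c : k) : fps_in B (fps_const c) = fps_const (c%:A).
Proof. by apply: fps_ext => -[|n] //=; rewrite scale0r. Qed.

Definition dser (d : D) (m : fps B) : R := Fps (fun n => d ## (fcoef m n)).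

Lemma dserD d m m' : dser d (m + m') = dser d m + dser d m'.
Proof. by apply: fps_ext => n; rewrite /= lhomD. Qed.

Lemma dser_in d r m : dser d (fps_in B r * m) = r * dser d m.
Proof.
apply: fps_ext => n; rewrite /= lhom_sum; apply: eq_bigr => i _.
by rewrite mulr_algl lhomZ.
Qed.

Lemma fps_basis (m : fps B) :
  m = \sum_(i < \dim {:B}) fps_in B (dser (dual_vect i) m) * fps_const (vbasis {:B})`_i.
Proof.
apply: fps_ext => n; rewrite fcoef_sum {1}(basis_expand (fcoef m n)).
by apply: eq_bigr => i _; rewrite fps_Mconstc /= mulr_algl.
Qed.

Lemma tsc_sum (I : finType) (F : I -> fps B) : tsc (\sum_i F i) = \sum_i tsc (F i).
Proof. by elim/big_rec2: _ => [|i x y _ <-]; rewrite ?tsc0 ?tscD. Qed.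

Section Coefficients.
Variables (W : lmodType A) (l : lhom (res W) R^o).

Fact dcoef_subproof n w : linear (fun b : B => fcoef (l (tin b *: w) : R) n : k^o).
Proof.
move=> c b b'; have -> : tin (c *: b + b') = tsc (fps_in B (fps_const c)) * tin b + tin b'.
  by rewrite fps_in_const -[tsc _]/(tin c%:A) -rmorphM mulr_algl -rmorphD.
rewrite scalerDl -scalerA -res_scaleE lhomP.
by rewrite fcoefD -[X in X + _]/(fcoef (fps_const c * _ : R) n) fps_constMc.
Qed.
(** As B is finite dimensional, Hom_R(B[[t]], R) = D[[t]], and [l] induces w |-> (m |-> l(m w)) from
    W to it. This is the n-th coefficient of that map. *)
Definition dcoef n w : D := mklhom (dcoef_subproof n w).

Lemma dcoefD n w w' : dcoef n (w + w') = dcoef n w + dcoef n w'.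
Proof. by apply: lhom_ext => b; rewrite mklhomE scalerDr lhomD. Qed.

(** Linearity over B[[t]] of the induced map W -> D[[t]], written out in coefficients. *)
Lemma dcoef_tsc n m w : dcoef n (tsc m *: w) = \sum_(p < n.+1) fcoef m p *: dcoef (n - p) w.
Proof.
apply: lhom_ext => b; rewrite Rdual_sum mklhomE scalerA /tin tscM.
under eq_bigr => p _ do rewrite Rdual_scaleE -fps_constMc.
move: (fps_const b * m) => {}m.
(* Since [l] is only R-linear, the series [m] is first expanded as a finite R-combination of
   constants from a basis of B. *)
have -> : tsc m *: w = \sum_i dser (dual_vect i) m *: (tin (vbasis {:B})`_i *: w : res W).
  rewrite {1}(fps_basis m) tsc_sum scaler_suml; apply: eq_bigr => i _.
  by rewrite res_scaleE scalerA tscM.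
rewrite lhom_sum fcoef_sum.
rewrite (eq_bigr (fun i => \sum_(p < n.+1) fcoef (dser (dual_vect i) m) p *
  dcoef (n - p) w ## ((vbasis {:B})`_i))) => [|i _]; last by rewrite lhomZ [LHS]fcoefM.
rewrite exchange_big; apply: eq_bigr => p _ /=.
rewrite -[RHS]/(dcoef (n - p) w ## (fcoef m p)) [in RHS](basis_expand (fcoef m p)) lhom_sum.
apply: eq_bigr => i _; by rewrite lhomZ.
Qed.

Variable f : lhom D B^o.

Definition coef_map w : fps B := Fps (fun n => f (dcoef n w)).

Lemma coef_mapD w w' : coef_map (w + w') = coef_map w + coef_map w'.
Proof. by apply: fps_ext => n; rewrite /= dcoefD lhomD. Qed.

Lemma coef_map_tsc m w : coef_map (tsc m *: w) = m * coef_map w.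
Proof.
apply: fps_ext => n; rewrite /= dcoef_tsc lhom_sum; apply: eq_bigr => p _.
by rewrite lhomZ.
Qed.

Lemma coef_map0 : coef_map 0 = 0.
Proof. by apply: (addIr (coef_map 0)); rewrite -coef_mapD !add0r. Qed.

(* The R-order [R R; tR R] carries the nondegenerate form [h |-> h_12 + h_21 / t]; [theta]
   is the inverse of the isomorphism Hom_A(W, A) -> Hom_R(W, R) it induces, applied after f. *)
Definition theta0 w : A :=
  tmx (coef_map (tta *: w)) (coef_map (te1 *: w)) (coef_map (te2 *: w)) (coef_map (tal *: w)).

Ltac tord := apply: tord_ext; rewrite ?tE ?t0E.

Fact theta_subproof : linear (theta0 : W -> A^o).
Proof.
apply: tord_linear => [w w'|m w|w|w|w|w]; rewrite /theta0.
- by tord; rewrite scalerDr coef_mapD.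
- by rewrite !scalerA -!tsc_tta -!tsc_te1 -!tsc_te2 -!tsc_tal -!scalerA !coef_map_tsc; tord.
- rewrite !scalerA tta_te1 te1_te1 te2_te1 tal_te1 !scale0r coef_map0; by tord.
- rewrite !scalerA tta_te2 te1_te2 te2_te2 tal_te2 !scale0r coef_map0; by tord.
- rewrite !scalerA tta_tal te1_tal te2_tal tal_tal !scale0r coef_map0 -scalerA coef_map_tsc.
  by tord; rewrite ?(fps_shiftMl 1) ?mul1r.
rewrite !scalerA tta_tta te1_tta te2_tta tal_tta !scale0r coef_map0 -scalerA coef_map_tsc.
by tord; rewrite ?(fps_shiftMl 1) ?mul1r.
Qed.
Definition theta : lhom W A^o := mklhom theta_subproof.

End Coefficients.

Lemma theta_comp (X W : lmodType A) (g : lhom X W) (l : lhom (res W) R^o)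
    (l' : lhom (res X) R^o) (f : lhom D B^o) x :
  (forall y, l' y = l (g y)) -> theta l' f x = theta l f (g x).
Proof.
move=> e; have cE y : coef_map l' f y = coef_map l f (g y).
  apply: fps_ext => n; congr (f _); apply: lhom_ext => b.
  by rewrite !mklhomE e lhomZ.
by rewrite !mklhomE /theta0 !cE !lhomZ.
Qed.

Fact delta_subproof (d : D) : linear (fun h : A => dser d (t12 h + t21 h) : R^o).
Proof.
move=> r h g; rewrite tord_scaleE !tE !t0E addrACA -mulrDr dserD dser_in.
by [].
Qed.
(** The form h_12 + h_21 / t followed by [d] on coefficients; [t21] has the division by t built
    in. *)
Definition delta (d : D) : lhom (A : lmodType R) R^o := mklhom (delta_subproof d).

Fact delta_res_subproof (d : D) : linear (delta d : res A^o -> R^o).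
Proof.
move=> r h g; have -> : r *: h + g = r *: (h : A) + (g : A) :> A.
  by rewrite -[in RHS]mulr_algl.
by rewrite lhomP.
Qed.
(** R acts on [res A^o] through the unit of A; this agrees with the action on the algebra A only up
    to a proof, hence a second version of [delta]. *)
Definition delta_res (d : D) : lhom (res A^o) R^o := mklhom (delta_res_subproof d).

(** One composite of [delta] and [theta]. Summed over a relation sum f_i(d_i) = 1 in B, it recovers
    the unit of A. *)
Lemma theta_delta1 (f : lhom D B^o) (d : D) : theta (delta_res d) f (1 : A^o) = tin (f d).
Proof.
have cE (h : A) : coef_map (delta_res d) f (h : A^o) = (t12 h + t21 h) * fps_const (f d : B).
  apply: fps_ext => n; rewrite fps_Mconstc -[RHS](lhomZ f (fcoef (t12 h + t21 h) n) d); congr (f _).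
  apply: lhom_ext => b; rewrite mklhomE Rdual_scaleE.
  rewrite -[LHS]/(d ## (fcoef (t12 (tin b * h) + t21 (tin b * h)) n)).
  by rewrite !tE !t0E -mulrDr fps_constMc.
rewrite mklhomE /theta0 !cE /tin /tsc.
by apply: tord_ext; rewrite ?tE ?t0E.
Qed.

(** The other composite: along a dual basis of D, the maps [theta] retain the whole functional
    [l]. *)
Lemma delta_theta (I : finType) (x : I -> D) (phi : I -> lhom D B^o) :
  (forall d, d = \sum_i (phi i d : B) *: x i) ->
  forall (W : lmodType A) (l : lhom (res W) R^o) w,
  \sum_i delta (x i) (theta l (phi i) w) = l w.
Proof.
move=> xP W l w; apply: fps_ext => n; rewrite fcoef_sum.
transitivity (dcoef l n w ## 1); last by rewrite mklhomE rmorph1 scale1r.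
rewrite (xP (dcoef l n w)) Rdual_sum; apply: eq_bigr => i _.
rewrite Rdual_scaleE mul1r.
rewrite -[LHS]/(x i ## (fcoef (t12 (theta0 l (phi i) w) + t21 (theta0 l (phi i) w)) n)).
by rewrite /theta0 t12_tmx t21_tmx -coef_mapD -scalerDl te12 scale1r.
Qed.

Hypothesis B_inj : selfinjective B.

(** The functionals delta(d_j) phi on X extend to W through the R-retraction, and [theta] converts
    the extensions into A-maps. By naturality of [theta], restricting their sum to X multiplies phi
    by sum f_j(d_j) = 1. *)
Lemma extend_to_regular (X W : lmodType A) (i : lhom X W) (r : lhom (res W) (res X)) :
  (forall x, r (i x) = x) -> forall phi : lhom X A^o,
  exists psi : lhom W A^o, lhom_comp psi i = phi.
Proof.
move=> ri phi; have [I [f [d fd]]] := selfinjective_trace B_inj.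
pose l j : lhom (res W) R^o := lhom_comp (delta_res (d j)) (lhom_comp (restr_lhom phi) r).
exists (\sum_j theta (l j) (f j)); apply: lhom_ext => x.
have sumE (F : I -> lhom W A^o) w : lhom_fun (\sum_j F j) w = \sum_j F j w.
  by elim/big_rec2: _ => // j y1 y2 _ <-.
have e1 : (1 : A) = \sum_j (theta (delta_res (d j)) (f j) (1 : A^o) : A).
  rewrite (eq_bigr (fun j => tin (f j (d j) : B))) => [|j _]; last first.
    exact: (theta_delta1 (f j) (d j)).
  by rewrite -(rmorph_sum (@tin k B)) fd rmorph1.
rewrite lhom_compE sumE -[RHS](mulr1 (phi x : A)) e1 mulr_sumr; apply: eq_bigr => j _.
rewrite -[RHS](lhomZ (theta (delta_res (d j)) (f j)) (phi x : A) 1) [_ *: 1]mulr1.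
rewrite -(@theta_comp X _ phi _ (lhom_comp (l j) (restr_lhom i))) => [|y].
  by rewrite -(@theta_comp X _ i _ (lhom_comp (l j) (restr_lhom i))).
by rewrite !lhom_compE mklhomE ri.
Qed.

(** Each functional of an R-dual basis of X, combined with each functional of a B-dual basis of D,
    gives one coordinate. [delta_theta] recovers the R-functionals from these, hence an R-linear
    retraction; it is not A-linear in general. *)
Lemma embeds_split (X : lmodType A) : dual_basis (res X) ->
  exists n (j : lhom X {ffun 'I_n -> A^o}) (r : lhom (res {ffun 'I_n -> A^o}) (res X)),
  forall x, r (j x) = x.
Proof.
move=> [I [y [l yP]]]; have [T [x [phi xP]]] := selfinjective_dual_basis B_inj.
pose J := 'I_#|{: I * T}|; pose c (t : J) := enum_val t.
pose j := lhom_ffun (fun t : J => theta (l (c t).1) (phi (c t).2)).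
pose r := lhom_comp (lin_comb (fun t => y (c t).1)) (lhom_ffun (fun t : J =>
  lhom_comp (delta_res (x (c t).2)) (restr_lhom (ffun_proj A^o t)))).
exists #|{: I * T}|, j, r => z.
have -> : r (j z) =
    \sum_t (delta (x (c t).2) (theta (l (c t).1) (phi (c t).2) z) : R) *: y (c t).1.
  rewrite lhom_compE mklhomE; apply: eq_bigr => t _; congr (_ *: _).
  rewrite ffunE !lhom_compE; congr (delta_res _ $ _).
  exact: (lhom_ffunE _ z t).
rewrite [RHS]yP (reindex_onto (@enum_rank _) (@enum_val _ _)) /= => [|t _]; last exact: enum_valK.
rewrite (eq_bigl xpredT) => [|t]; last by rewrite enum_rankK eqxx.
under eq_bigr => t _ do rewrite /c enum_rankK.
rewrite -(pair_bigA _ (fun i t => (delta (x t) (theta (l i) (phi t) z) : R) *: y i)) /=.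
apply: eq_bigr => i _; rewrite -scaler_suml; congr (_ *: _).
exact: (delta_theta xP (l i) z).
Qed.

Lemma tsc_expand (m : fps B) (u : A) :
  tsc m * u = \sum_(i < \dim {:B}) (dser (dual_vect i) m : R) *: (tin (vbasis {:B})`_i * u).
Proof.
rewrite {1}(fps_basis m) tsc_sum mulr_suml; apply: eq_bigr => i _.
by rewrite tord_scaleE mulrA tscM.
Qed.

Fact dser_lhom_subproof (t : A -> fps B) (d : D) :
  (forall h g, t (h + g) = t h + t g) -> (forall r h, t (r *: h) = fps_in B r * t h) ->
  linear (fun h : A => dser d (t h) : R^o).
Proof. by move=> tD tZ r h g; rewrite tD tZ dserD dser_in. Qed.

Lemma tord_dual_basis : dual_basis (A : lmodType R).
Proof.
pose I := 'I_(\dim {:B}); pose X (i : I) : B := (vbasis {:B})`_i.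
have L11 i := dser_lhom_subproof (t := @t11 k B) (dual_vect i : D) (@t11D k B).
have L12 i := dser_lhom_subproof (t := @t12 k B) (dual_vect i : D) (@t12D k B).
have L21 i := dser_lhom_subproof (t := @t21 k B) (dual_vect i : D) (@t21D k B).
have L22 i := dser_lhom_subproof (t := @t22 k B) (dual_vect i : D) (@t22D k B).
have Z11 r h : t11 (r *: h) = fps_in B r * t11 h by rewrite tord_scaleE !tE !t0E.
have Z12 r h : t12 (r *: h) = fps_in B r * t12 h by rewrite tord_scaleE !tE !t0E.
have Z21 r h : t21 (r *: h) = fps_in B r * t21 h by rewrite tord_scaleE !tE !t0E.
have Z22 r h : t22 (r *: h) = fps_in B r * t22 h by rewrite tord_scaleE !tE !t0E.
exists (I + I + (I + I))%type,
  (fun s => match s with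
     | inl (inl i) => tin (X i) * te1 | inl (inr i) => tin (X i) * tal
     | inr (inl i) => tin (X i) * tta | inr (inr i) => tin (X i) * te2 end),
  (fun s => match s with
     | inl (inl i) => mklhom (L11 i Z11) | inl (inr i) => mklhom (L12 i Z12)
     | inr (inl i) => mklhom (L21 i Z21) | inr (inr i) => mklhom (L22 i Z22) end) => h.
by rewrite !big_sumType /= {1}(tmx_decomp h) !tsc_expand !addrA.
Qed.

Fact Rdual_eval1_subproof : linear (fun x : res (Rdual A : lmodType A) =>
  lhom_fun (x : lhom (A : lmodType R) R^o) 1 : R^o).
Proof.
move=> r x y; rewrite -[LHS]/(lhom_fun (x : lhom (A : lmodType R) R^o) (1 * r%:A) + _ _).
by rewrite mul1r lhomZ.
Qed.
Definition Rdual_eval1 : lhom (res (Rdual A : lmodType A)) R^o := mklhom Rdual_eval1_subproof.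

(** This is [delta_theta] for W = Hom_R(A, R) and the functional of evaluation at 1, because z(h) =
    (h z)(1). *)
Lemma Rdual_tord_dual_basis : dual_basis (Rdual A : lmodType A).
Proof.
have [T [x [phi xP]]] := selfinjective_dual_basis B_inj.
exists T, (fun a => delta (x a) : Rdual A), (fun a => theta Rdual_eval1 (phi a)) => z.
apply: lhom_ext => h.
have sumE (F : T -> Rdual A) : lhom_fun (\sum_a F a : Rdual A) h =
    \sum_a lhom_fun (F a : lhom (A : lmodType R) R^o) h.
  by elim/big_rec2: _ => // i y1 y2 _ <-.
rewrite sumE -[LHS]/(lhom_fun (z : lhom (A : lmodType R) R^o) h) -[h in LHS]mul1r.
rewrite -[LHS]/(Rdual_eval1 (h *: z)) -(delta_theta xP); apply: eq_bigr => a _.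
by rewrite lhomZ.
Qed.

Theorem tord_Gorenstein : Gorenstein_order A.
Proof.
split; first exact/(free_fin_rankP (fps_principal_domain k))/tord_dual_basis.
exact/dual_basis_projective/Rdual_tord_dual_basis.
Qed.

End FunctionalsAndMaps.

(** * The category CM_e A *)

Section Splittings.
Variable A : pzRingType.

Lemma ses_retraction_section (L M N : lmodType A) (f : lhom L M) (g : lhom M N)
    (r : lhom M L) : short_exact f g -> (forall x, r (f x) = x) ->
  exists s : lhom N M, forall z, g (s z) = z.
Proof.
move=> fg rf.
have [|s sP] := lhom_factor_surj (f := lhom_id M - lhom_comp f r) (ses_surj fg).
  by move=> y /(ses_mid fg)[x <-]; rewrite lhom_subE lhom_compE rf subrr.
exists s => z; have [y <-] := ses_surj fg z.
by rewrite sP lhom_subE lhomB [lhom_comp f r y]lhom_compE (ses_cmp0 fg) subr0.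
Qed.

Lemma dual_basis_ffun (I : finType) (M : lmodType A) :
  dual_basis M -> dual_basis {ffun I -> M}.
Proof.
move=> [J [x [phi xP]]].
exists (I * J)%type, (fun t => [ffun i => x t.2 *+ (t.1 == i)]),
  (fun t => lhom_comp (phi t.2) (ffun_proj M t.1)) => v.
rewrite -(pair_bigA _ (fun i j => (phi j (v i) : A) *: [ffun i' => x j *+ (i == i')])) /=.
apply/ffunP => i; rewrite sum_ffunE (bigD1 i) //= [X in _ + X]big1 ?addr0 => [|i' /negbTE ne].
  by rewrite sum_ffunE {1}(xP (v i)); apply: eq_bigr => j _; rewrite !ffunE eqxx.
by rewrite sum_ffunE big1 // => j _; rewrite !ffunE ne scaler0.
Qed.

Lemma dual_basis_ord (P : lmodType A) : dual_basis P ->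
  exists n (x : 'I_n -> P) (phi : 'I_n -> lhom P A^o),
  forall p, p = \sum_i (phi i p : A) *: x i.
Proof.
move=> /dual_basis_in_add[n [s [r rs]]].
exists n, (fun i => r (ffun_unit A i)), (fun i => lhom_comp (ffun_proj A^o i) s) => p.
rewrite -[LHS](lhom_eqE p rs) lhom_compE {1}(ffun_unitE (s p)) lhom_sum.
by apply: eq_bigr => i _; rewrite lhomZ.
Qed.

End Splittings.

Lemma restr_ffun_dual_basis (R : pzRingType) (A : lalgType R) (I : finType) (M : lmodType A) :
  dual_basis (@restr R A M : lmodType R) -> dual_basis (@restr R A {ffun I -> M} : lmodType R).
Proof.
move=> /(@dual_basis_ffun _ I) Md.
have fL : linear (fun x : {ffun I -> @restr R A M} => x : @restr R A {ffun I -> M}).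
  by move=> r x y; apply/ffunP => i; rewrite !ffunE.
apply: (dual_basis_retract (s := lhom_ffun (fun i => restr_lhom (ffun_proj M i)))
  (r := mklhom fL)) Md => u.
by rewrite mklhomE; apply/ffunP => i; rewrite ffunE.
Qed.

Section IdempotentPart.
Variables (A : pzRingType) (eI : idem_elt A).
Notation e := (idem_val eI).

Fact emk_in (X : lmodType A) (x : X) : e *: x \in @emod_pred A eI X.
Proof. by rewrite inE scalerA idemK. Qed.
Definition emk (X : lmodType A) (x : X) : emod eI X := Emod (emk_in x).

Lemma emod_valE (X : lmodType A) (u : emod eI X) : e *: val u = val u.
Proof. by case: u => x /= /eqP. Qed.
Lemma emkK (X : lmodType A) (u : emod eI X) : emk (val u) = u.
Proof. by apply: val_inj; apply: emod_valE. Qed.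
Lemma emkD (X : lmodType A) (x y : X) : emk (x + y) = emk x + emk y.
Proof. by apply: val_inj; rewrite /= scalerDr. Qed.
Lemma emk_eq (X : lmodType A) (x y : X) : e *: x = e *: y -> emk x = emk y.
Proof. by move=> exy; apply: val_inj. Qed.
Lemma emkZ (X : lmodType A) (a : corner eI) (x : X) : emk (val a *: x) = a *: emk x.
Proof. by apply: val_inj; rewrite /= !scalerA corner_l corner_r. Qed.

Lemma corner_scaleE (a : corner eI) (b : (corner eI)^o) :
  val (a *: b : corner eI) = val a * val (b : corner eI).
Proof. by []. Qed.

Lemma emod_regularE (a : corner eI) (u v : emod eI A^o) :
  emod_val (a *: u + v) = val a * (emod_val u : A) + (emod_val v : A) :> A.
Proof. by []. Qed.

Lemma emod_regularE2 (a b : corner eI) (u v : emod eI A^o) :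
  emod_val (a *: u + b *: v) = val a * (emod_val u : A) + val b * (emod_val v : A) :> A.
Proof. by []. Qed.

Fact emap_subproof (X Y : lmodType A) (f : lhom X Y) :
  linear (fun u : emod eI X => emk (f (val u))).
Proof. by move=> a u v; rewrite -emkZ -emkD -lhomP. Qed.
Definition emap (X Y : lmodType A) (f : lhom X Y) : lhom (emod eI X) (emod eI Y) :=
  mklhom (emap_subproof f).

Lemma val_emap (X Y : lmodType A) (f : lhom X Y) u : val (emap f u) = f (val u).
Proof. by rewrite /= -lhomZ emod_valE. Qed.

Lemma emap_emk (X Y : lmodType A) (f : lhom X Y) x : emap f (emk x) = emk (f x).
Proof. by apply: val_inj; rewrite val_emap /= lhomZ. Qed.

Lemma emap_exact (X Y Z : lmodType A) (f : lhom X Y) (g : lhom Y Z) :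
  short_exact f g -> short_exact (emap f) (emap g).
Proof.
move=> fg; split.
- by move=> u v /(congr1 val); rewrite !val_emap => /(ses_inj fg)/val_inj.
- by move=> w; have [y gy] := ses_surj fg (val w); exists (emk y); rewrite emap_emk gy emkK.
move=> v; split=> [/(congr1 val)|[u <-]].
  rewrite val_emap => /(ses_mid fg)[x fx]; exists (emk x).
  by rewrite emap_emk fx emkK.
by apply: val_inj; rewrite !val_emap (ses_cmp0 fg).
Qed.

Lemma emod_ffun_dual_basis (I : finType) (M : lmodType A) :
  dual_basis (emod eI M : lmodType (corner eI)) ->
  dual_basis (emod eI {ffun I -> M} : lmodType (corner eI)).
Proof.
move=> /(@dual_basis_ffun _ I) Md.
pose E : lmodType (corner eI) := emod eI {ffun I -> M}.
have rL : linear (fun w : {ffun I -> emod eI M} => emk [ffun i => val (w i)] : E).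
  move=> a u v; rewrite -emkZ -emkD; congr emk.
  by apply/ffunP => i; rewrite !ffunE.
apply: (dual_basis_retract (s := lhom_ffun (fun i => emap (ffun_proj M i)))
  (r := mklhom rL)) Md => u.
rewrite mklhomE -[RHS]emkK; congr emk; apply/ffunP => i.
by rewrite ffunE mklhomE ffunE val_emap.
Qed.

Fact lideal_val_subproof : linear (fun u : lideal eI => val u : A^o).
Proof. by []. Qed.
Definition lideal_in : lhom (lideal eI) A^o := mklhom lideal_val_subproof.

Fact lideal_proj_in (a : A^o) : (a : A) * e \in lideal_pred eI.
Proof. by rewrite inE -mulrA idemK. Qed.
Fact lideal_proj_subproof : linear (fun a : A^o => Lideal (lideal_proj_in a) : lideal eI).
Proof. by move=> a x y; apply: val_inj; rewrite /= mulrDl -mulrA. Qed.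
Definition lideal_proj : lhom A^o (lideal eI) := mklhom lideal_proj_subproof.

Lemma lideal_inK u : lideal_proj (lideal_in u) = u.
Proof. by apply: val_inj; case: u => u /= /eqP. Qed.

Lemma in_add_lideal (Q : lmodType A) :
  in_add (lideal eI : lmodType A) Q -> in_add A^o Q.
Proof.
move=> [n [s [r rs]]]; exists n,
  (lhom_ffun (fun i => lhom_comp lideal_in (lhom_comp (ffun_proj _ i) s))),
  (lhom_comp r (lhom_ffun (fun i => lhom_comp lideal_proj (ffun_proj _ i)))).
apply: lhom_ext => q; rewrite -[RHS](lhom_eqE q rs) !lhom_compE; congr (r _).
by apply/ffunP => i; rewrite !ffunE !lhom_compE [ffun_proj _ _ _]mklhomE !ffunE lideal_inK.
Qed.

End IdempotentPart.

Section CohenMacaulay.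
Variables (k : fieldType) (B : falgType k).
Notation A := (tord B).
Notation res X := (@restr (fps k) (tord B) X : lmodType (fps k)).
Notation e := (e11 B).
Notation eA := (corner (e11 B)).
Notation emd X := (emod (e11 B) X : lmodType (corner (e11 B))).

Definition CM (X : lmodType A) : Prop :=
  [/\ fin_gen X, free_fin_rank (res X) & fg_projective (emd X)].

Lemma CMP (X : lmodType A) : CM X <-> dual_basis (res X) /\ dual_basis (emd X).
Proof.
have freeP := free_fin_rankP (fps_principal_domain k).
split=> [[_ /freeP rX /fg_projectiveP eX] //|[rX eX]].
split; last exact/fg_projectiveP; last exact/freeP.
exact/fin_gen_restr/dual_basis_fin_gen.
Qed.

Lemma emk11 (X : lmodType A) (x : X) : val (emk e x) = te1 *: x.
Proof. by rewrite -[LHS]/(idem_val e *: x) e11_val. Qed.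

Lemma emk11_eq (X : lmodType A) (x y : X) : te1 *: x = te1 *: y -> emk e x = emk e y.
Proof. by move=> xy; apply: emk_eq; rewrite e11_val. Qed.

Lemma emod11E (X : lmodType A) (u : emod e X) : te1 *: val u = val u.
Proof. by rewrite -[RHS]emod_valE e11_val. Qed.

Fact cor_in (l : fps B) : tmx l 0 0 0 \in corner_pred e.
Proof.
by rewrite inE e11_val; apply/andP; split; apply/eqP; apply: tord_ext; rewrite ?tE ?t0E.
Qed.
(** Identifies B[[t]] with eAe; the inverse reads off the upper left entry. *)
Definition cor (l : fps B) : eA := Corner (cor_in l).

Lemma corK (a : eA) : cor (t11 (val a)) = a.
Proof.
apply: val_inj; rewrite /= -[RHS]corner_l -[in RHS](corner_r a) e11_val.
by apply: tord_ext; rewrite ?tE ?t0E.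
Qed.

Lemma corD l m : cor (l + m) = cor l + cor m.
Proof. by apply: val_inj; apply: tord_ext; rewrite /= ?tE ?t0E. Qed.
Lemma corM l m : cor (l * m) = cor l * cor m.
Proof. by apply: val_inj; apply: tord_ext; rewrite /= ?tE ?t0E. Qed.
Lemma cor_val l : val (cor l) = tsc l * te1.
Proof. by apply: tord_ext; rewrite /= ?tE ?t0E. Qed.
Lemma t12_corner (a : eA) : t12 (val a) = 0.
Proof. by rewrite -(corK a) /= t12_tmx. Qed.

Lemma CM_ext_closed : ext_closed CM.
Proof.
split=> [M M0|L M N f g fg /CMP[rL eL] /CMP[rN eN]]; apply/CMP.
  split; apply: dual_basis0 => // u.
  by apply: val_inj; rewrite [LHS]M0.
by split; [apply: dual_basis_ext (restr_exact fg) rL rN | apply: dual_basis_ext (emap_exact e fg) eL eN].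
Qed.

Lemma CM_kernel (L M N : lmodType A) (f : lhom L M) (g : lhom M N) :
  short_exact f g -> CM M -> CM N -> CM L.
Proof.
move=> fg /CMP[rM eM] /CMP[rN eN]; apply/CMP; split.
  exact: dual_basis_kernel (restr_exact fg) rM rN.
exact: dual_basis_kernel (emap_exact e fg) eM eN.
Qed.

(** The hypothesis puts eX inside N, so eN = eX remains projective, and freeness over R passes to
    submodules. *)
Lemma CM_sub (X : lmodType A) (N : submod X) :
  (forall x, N (te1 *: x)) -> CM X -> CM (subm N).
Proof.
move=> eN /CMP[rX eX]; apply/CMP; split.
  apply/(free_fin_rankP (fps_principal_domain k)).
  apply: (free_submod (fps_principal_domain k) (f := restr_lhom (subm_in N))) => //.
  exact: (@subm_in_inj _ _ N).
have [||g [gK _]] := lhom_bij_inv (f := emap e (subm_in N)).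
- by move=> u v /(congr1 val); rewrite !val_emap => /(@subm_in_inj _ _ N)/val_inj.
- move=> u; have /subm_inE[y ey] := eN (val u).
  by exists (emk e y); rewrite emap_emk ey emod11E emkK.
apply: (dual_basis_retract (s := emap e (subm_in N)) (r := g)) eX => u.
exact: (lhom_eqE u gK).
Qed.

Lemma regular_CM : dual_basis (res A^o) /\ dual_basis (emd A^o).
Proof.
split.
  have fL : linear (fun x : A => x : res A^o).
    by move=> r x y; rewrite tord_scaleE [r *: (x : res A^o)]res_scaleE.
  have gL : linear (fun x : res A^o => x : A).
    by move=> r x y; rewrite tord_scaleE [r *: (x : res A^o)]res_scaleE.
  exact: (dual_basis_retract (s := mklhom gL) (r := mklhom fL)) (tord_dual_basis B).
have L1 : linear (fun u : emd A^o => cor (t11 (emod_val u : A)) : eA^o).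
  move=> a u v; rewrite emod_regularE t11D t11M t12_corner mul0r fps_shift0 addr0 corD corM corK.
  by [].
have L2 : linear (fun u : emd A^o => cor (t12 (emod_val u : A)) : eA^o).
  move=> a u v; rewrite emod_regularE t12D t12M t12_corner mul0r addr0 corD corM corK.
  by [].
have emkP (x : A^o) : emod_val (emk e x) = te1 * (x : A) :> A by rewrite -e11_val.
(* eA is the first row of A, free over eAe on its two matrix units. *)
exists bool, (fun b => if b then emk e (te1 : A^o) else emk e (tal : A^o)),
  (fun b => if b then mklhom L1 else mklhom L2) => u.
rewrite big_bool; apply: val_inj; rewrite [RHS]emod_regularE2 !emkP te1_te1 te1_tal !cor_val.
have -> : val u = te1 * (emod_val u : A) :> A by rewrite -emkP emkK.
by apply: tord_ext; rewrite ?tE ?t0E.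
Qed.

Lemma CM_free n : CM {ffun 'I_n -> A^o}.
Proof.
have [rA eA0] := regular_CM; apply/CMP.
by split; [apply: restr_ffun_dual_basis | apply: emod_ffun_dual_basis].
Qed.

End CohenMacaulay.

(** * Maps into A built from eAe-functionals, and the submodule AeX *)

Section CornerFunctionals.
Variables (k : fieldType) (B : falgType k).
Notation A := (tord B).
Notation R := (fps k).
Notation res X := (@restr (fps k) (tord B) X : lmodType (fps k)).
Notation e := (e11 B).
Notation eA := (corner (e11 B)).
Notation emd X := (emod (e11 B) X : lmodType (corner (e11 B))).

Section Columns.
Variables (X : lmodType A) (phi : lhom (emd X) eA^o).

Definition col1 (x : X) : fps B := t11 (val (phi (emk e x) : eA)).

Lemma col1D x y : col1 (x + y) = col1 x + col1 y.
Proof. by rewrite /col1 emkD lhomD t11D. Qed.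

Lemma col1_eq x y : te1 *: x = te1 *: y -> col1 x = col1 y.
Proof. by move=> xy; rewrite /col1 (emk11_eq xy). Qed.

Lemma col10 : col1 0 = 0.
Proof. by apply: (addIr (col1 0)); rewrite -col1D !add0r. Qed.

Lemma col1_tsc l x : col1 (tsc l *: x) = l * col1 x.
Proof.
have -> : col1 (tsc l *: x) = col1 (val (cor l) *: x).
  by apply: col1_eq; rewrite cor_val !scalerA tsc_te1 mulrA te1_te1.
by rewrite /col1 emkZ lhomZ corner_scaleE cor_val !tE !t0E.
Qed.

(** The second column of A is coinduced from eAe: an A-map into it is determined by its upper entry,
    and its lower entry at x is the upper entry at [tal *: x]. *)
Definition col_map0 (x : X) : A := tmx 0 (col1 x) 0 (col1 (tal *: x)).

Fact col_map_subproof : linear (col_map0 : X -> A^o).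
Proof.
apply: tord_linear => [x y|l x|x|x|x|x]; rewrite /col_map0.
- by rewrite scalerDr !col1D; apply: tord_ext; rewrite ?tE ?t0E.
- rewrite scalerA -tsc_tal -scalerA !col1_tsc.
  by apply: tord_ext; rewrite ?tE ?t0E.
- rewrite scalerA tal_te1 scale0r col10 (@col1_eq (te1 *: x) x); last by rewrite scalerA te1_te1.
  by apply: tord_ext; rewrite ?tE ?t0E.
- rewrite scalerA tal_te2 (@col1_eq (te2 *: x) 0); last by rewrite scalerA te1_te2 scale0r scaler0.
  by rewrite col10; apply: tord_ext; rewrite ?tE ?t0E.
- rewrite scalerA tal_tal scale0r col10.
  by apply: tord_ext; rewrite ?tE ?t0E.
rewrite scalerA tal_tta -scalerA col1_tsc.
rewrite (@col1_eq (tta *: x) 0); last by rewrite scalerA te1_tta scale0r scaler0.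
rewrite (@col1_eq (te1 *: x) x); last by rewrite scalerA te1_te1.
by rewrite col10; apply: tord_ext; rewrite ?tE ?t0E // fps_shiftMl mul1r.
Qed.
Definition col_map : lhom X A^o := mklhom col_map_subproof.

End Columns.

Hypothesis B_inj : selfinjective B.

(** The given retraction is only R-linear. To get one over eAe on the e-parts, each coordinate
    functional of eX is coinduced to an A-map X -> A, extended to W, and read back in the upper
    right entry. *)
Lemma emap_retraction (X W : lmodType A) (j : lhom X W) (r : lhom (res W) (res X)) :
  (forall x, r (j x) = x) -> CM X ->
  exists s : lhom (emd W) (emd X), forall u, s (emap e j u) = u.
Proof.
move=> rj /CMP[_ [I [x [phi xP]]]].
have [psi psiP] := choice (fun i => extend_to_regular B_inj rj (col_map (phi i))).
have L i : linear (fun w : emod e W => cor (t12 (psi i (emod_val w) : A)) : eA^o).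
  move=> a w w'.
  have -> : emod_val (a *: w + w') = val a *: emod_val w + emod_val w' by [].
  rewrite lhomP -[_ *: psi i _]/(val a * (psi i (emod_val w) : A)).
  by rewrite t12D t12M t12_corner mul0r addr0 corD corM corK.
exists (lhom_comp (lin_comb x) (lhom_ffun (fun i => mklhom (L i)))) => u.
rewrite lhom_compE mklhomE [RHS]xP; apply: eq_bigr => i _; congr (_ *: _).
rewrite !mklhomE ffunE mklhomE.
have -> : emod_val (emap e j u) = j (val u) := val_emap j u.
have -> : psi i (j (val u)) = col_map (phi i) (val u) := lhom_eqE (val u) (psiP i).
by rewrite mklhomE /col_map0 t12_tmx /col1 emkK corK.
Qed.

Lemma CM_cokernel (X W Z : lmodType A) (j : lhom X W) (g : lhom W Z)
    (r : lhom (res W) (res X)) :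
  short_exact j g -> (forall x, r (j x) = x) -> CM X -> CM W -> CM Z.
Proof.
move=> jg rj cX /CMP[rW eW]; apply/CMP.
have [s gs] := ses_retraction_section (restr_exact jg) rj.
have [r' rj'] := emap_retraction rj cX.
have [s' gs'] := ses_retraction_section (emap_exact e jg) rj'.
split; first exact: dual_basis_retract gs rW.
exact: dual_basis_retract gs' eW.
Qed.

Lemma CM_cover (X : lmodType A) : CM X -> exists n (g : lhom {ffun 'I_n -> A^o} X),
  (forall x, exists v, g v = x) /\ CM (subm (lkerm g)).
Proof.
move=> cX; have [/fin_gen_surj[n [g gs]] _ _] := cX.
exists n, g; split=> //; apply: (CM_kernel (ker_exact gs)) => //.
exact: CM_free.
Qed.

Lemma CM_envelope (X : lmodType A) : CM X -> exists n (j : lhom X {ffun 'I_n -> A^o}),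
  injective j /\ CM (quotm (limm j)).
Proof.
move=> cX; have [rX _] := (CMP X).1 cX; have [n [j [r rj]]] := embeds_split B_inj rX.
have jI : injective j by apply: lhom_inj0 => x jx; rewrite -[x]rj jx lhom0.
exists n, j; split=> //.
exact: CM_cokernel (coker_exact jI) rj cX (CM_free B n).
Qed.

Lemma CM_extend (X Y Z : lmodType A) (f : lhom X Y) (g : lhom Y Z) :
  CM X -> CM Y -> CM Z -> short_exact f g ->
  forall h : lhom X A^o, exists l : lhom Y A^o, lhom_comp l f = h.
Proof.
move=> _ _ /CMP[rZ _] fg h; have rfg := restr_exact fg.
have [s gs] := dual_basis_projective rZ (lhom_id _) (ses_surj rfg).
have [r [rf _]] := ses_section_retraction rfg gs.
by apply: (extend_to_regular B_inj (r := r)) => x; apply: (lhom_eqE (x : res X) rf).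
Qed.

Theorem CM_stable_ideal : stable_ideal (add_ideal (A^o : lmodType A) : ideal (modcat (@CM k B))).
Proof.
apply: modcat_stable_ideal.
- exact: CM_ext_closed.
- exact: CM_free.
- exact: CM_cover.
- exact: CM_envelope.
- exact: CM_extend.
Qed.

(** AeX contains all of eX, and (1 - e)Ae consists of the scalar multiples of [tta]; hence
    membership of x constrains only [te2 *: x]. *)
Fact trace_part0 (X : lmodType A) : exists y : X, te2 *: (0 : X) = tta *: y.
Proof. by exists 0; rewrite !scaler0. Qed.
Fact trace_partP (X : lmodType A) (a : A) (x x' : X) :
  (exists y, te2 *: x = tta *: y) -> (exists y, te2 *: x' = tta *: y) ->
  exists y, te2 *: (a *: x + x') = tta *: y.
Proof.
move=> [y xy] [y' xy']; exists (tsc (t21 a) *: x + tsc (t22 a) *: y + y').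
have te2M : te2 * a = tta * tsc (t21 a) + tsc (t22 a) * te2.
  by apply: tord_ext; rewrite ?tE ?t0E.
rewrite !scalerDr xy' scalerA te2M scalerDl -!scalerA xy !scalerA.
by rewrite -!tsc_tta.
Qed.
(* The submodule AeX. *)
Definition trace_part (X : lmodType A) : submod X :=
  Submod (@trace_part0 X) (@trace_partP X).

Lemma trace_part_lhom (X Y : lmodType A) (f : lhom X Y) x :
  trace_part X x -> trace_part Y (f x).
Proof. by move=> [y xy]; exists (f y); rewrite -!lhomZ xy. Qed.

Lemma trace_part_CM (X : lmodType A) : CM X -> CM (subm (trace_part X)).
Proof.
move=> cX; apply: CM_sub cX => x.
by exists 0; rewrite scalerA te2_te1 scale0r scaler0.
Qed.

(** Multiplying by [tal] gives t e x = 0, and X has no t-torsion, being free over R. *)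
Lemma CM_tta_eq0 (X : lmodType A) (x : X) : CM X -> tta *: x = 0 -> te1 *: x = 0.
Proof.
move=> /CMP[[I [y [l yP]]] _] tx.
have t0 : fps_shift 1 *: (te1 *: x : res X) = 0.
  rewrite res_scaleE; have -> : fps_in B (fps_shift 1) = tvar.
    by apply: fps_ext => -[|[|n]] //=; rewrite ?scale0r ?scale1r.
  by rewrite scalerA -tal_tta -scalerA tx scaler0.
rewrite [LHS](yP (te1 *: x : res X)) big1 // => i _.
have : fps_shift 1 * (l i (te1 *: x : res X) : R) = 0.
  by rewrite -[LHS](lhomZ (l i)) t0 lhom0.
case/fps_mul_eq0 => [/(congr1 (fun f => fcoef f 1))/eqP|->]; last by rewrite scale0r.
by rewrite /= oner_eq0.
Qed.

(** As X is torsion-free, AeX is Ae tensored over eAe with the projective module eX. Concretely, a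
    dual basis (x_i, phi_i) of eX makes AeX a retract of a power of Ae, with v |-> sum v_i x_i as
    the retraction. *)
Lemma trace_part_in_add (X : lmodType A) : CM X ->
  in_add (lideal e : lmodType A) (subm (trace_part X)).
Proof.
move=> cX; have [_ /dual_basis_ord[n [x [phi xP]]]] := (CMP X).1 cX.
pose N := trace_part X; pose L := (lideal e : lmodType A).
(* Right multiplication by [tal] moves Ae onto the second columns whose lower entry is divisible by
   t. On AeX the maps [col_map] take values there, so they lift to Ae. *)
have jL : linear (fun u : L => (lideal_val u : A) * tal : A^o).
  by move=> a u v; rewrite -[lideal_val _]/(a * (lideal_val u : A) + lideal_val v) mulrDl -mulrA.
have idealP (u : L) : lideal_val u = tmx (t11 (lideal_val u)) 0 (t21 (lideal_val u)) 0 :> A.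
  case: u => u /= /eqP; rewrite e11_val => {1}<-.
  by apply: tord_ext; rewrite ?tE ?t0E.
have jI : injective (mklhom jL).
  move=> u v; rewrite !mklhomE => uv; apply: val_inj; rewrite /= [LHS]idealP [RHS]idealP.
  have /(congr1 (@t12 k B)) := uv; have /(congr1 (@t22 k B)) := uv.
  by rewrite !tE !t0E => /fps_shift_inj -> ->.
have idealI a c : tmx a 0 c 0 \in lideal_pred e.
  by rewrite inE e11_val; apply/eqP; apply: tord_ext; rewrite ?tE ?t0E.
(* The required divisibility: tal y = tal e_2 y = tal tta z = t e_1 z. *)
have zP y z i : te2 *: y = tta *: z -> col1 (phi i) (tal *: y) = fps_shift (col1 (phi i) z).
  move=> yz; have -> : tal *: y = tsc tvar *: (te1 *: z).
    by rewrite -[tal]tal_te2 -scalerA yz scalerA tal_tta scalerA.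
  rewrite col1_tsc fps_shiftMl mul1r (@col1_eq _ _ (te1 *: z) z) //.
  by rewrite scalerA te1_te1.
have ex i : exists s : lhom (subm N) L, forall u, mklhom jL (s u) = col_map (phi i) (subm_in N u).
  apply: (lhom_factor_inj (f := lhom_comp (col_map (phi i)) (subm_in N)) jI) => u.
  have [z uz] := subm_inN u.
  exists (Lideal (idealI (col1 (phi i) (subm_in N u)) (col1 (phi i) z))).
  rewrite [RHS]lhom_compE [RHS]mklhomE /col_map0 (zP _ _ _ uz) mklhomE.
  by apply: tord_ext; rewrite ?tE ?t0E.
have [s sP] := choice ex.
pose r0 := lhom_comp (lin_comb (fun i => val (x i))) (lhom_ffun (fun i : 'I_n =>
  lhom_comp (lideal_in e) (ffun_proj L i))).
have r0N v : exists u, subm_in N u = r0 v.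
  apply/subm_inE; rewrite /r0 lhom_compE mklhomE; apply: submod_sum => i.
  rewrite !mklhomE ffunE lhom_compE !mklhomE.
  exists (tsc (t21 (lideal_val (v i))) *: val (x i)).
  rewrite !scalerA -[val (v i)]/(lideal_val (v i)) {1}(idealP (v i)); congr (_ *: _).
  by apply: tord_ext; rewrite ?tE ?t0E.
have [r rP] := lhom_factor_inj (@subm_in_inj _ _ N) r0N.
exists n, (lhom_ffun s), r; apply: lhom_ext => u; apply: (@subm_in_inj _ _ N).
rewrite lhom_compE rP /r0 lhom_compE mklhomE.
have [z uz] := subm_inN u.
have sE i : lideal_val (s i u) = tsc (col1 (phi i) (subm_in N u)) * te1
    + tta * tsc (col1 (phi i) z) :> A.
  have -> : s i u = Lideal (idealI (col1 (phi i) (subm_in N u)) (col1 (phi i) z)).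
    apply: jI; rewrite sP !mklhomE /col_map0 (zP _ _ _ uz).
    by apply: tord_ext; rewrite ?tE ?t0E.
  by apply: tord_ext; rewrite ?tE ?t0E.
have eP w : te1 *: w = \sum_i tsc (col1 (phi i) w) *: val (x i).
  rewrite -emk11 {1}(xP (emk e w)) raddf_sum; apply: eq_bigr => i _.
  rewrite -[LHS]/(val (phi i (emk e w) : eA) *: val (x i)) -[in LHS](corK (phi i _)).
  by rewrite cor_val -scalerA emod11E.
transitivity (te1 *: subm_in N u + te2 *: subm_in N u); last by rewrite -scalerDl te12 scale1r.
rewrite uz -[tta]tta_te1 -scalerA !eP scaler_sumr -big_split; apply: eq_bigr => i _ /=.
rewrite !ffunE sE scalerDl -!scalerA; congr (_ + _).
by rewrite -[in RHS]emod11E scalerA.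
Qed.

End CornerFunctionals.

(** * The functor X |-> X / AeX *)

Definition pullm (B A : pzRingType) (phi : {rmorphism B -> A}) (X : lmodType A) : Type := X.

Section ScalarPullback.
Variables (B A : pzRingType) (phi : {rmorphism B -> A}).

Section Module.
Variable X : lmodType A.

HB.instance Definition _ := GRing.Zmodule.on (pullm phi X).

Definition pullm_scale (b : B) (x : pullm phi X) : pullm phi X := phi b *: (x : X).

Fact pullm_scaleA a b x : pullm_scale a (pullm_scale b x) = pullm_scale (a * b) x.
Proof. by rewrite /pullm_scale scalerA rmorphM. Qed.
Fact pullm_scale1 : left_id 1 pullm_scale.
Proof. by move=> x; rewrite /pullm_scale rmorph1 scale1r. Qed.
Fact pullm_scaleDr : right_distributive pullm_scale +%R.
Proof. by move=> a x y; apply: scalerDr. Qed.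
Fact pullm_scaleDl x : {morph pullm_scale^~ x : a b / a + b}.
Proof. by move=> a b; rewrite /pullm_scale rmorphD scalerDl. Qed.
HB.instance Definition _ := GRing.Zmodule_isLmodule.Build B (pullm phi X)
  pullm_scaleA pullm_scale1 pullm_scaleDr pullm_scaleDl.

End Module.

Fact pull_lhom_subproof (X Y : lmodType A) (f : lhom X Y) :
  linear (fun x : pullm phi X => f x : pullm phi Y).
Proof. by move=> b x y; rewrite lhomP. Qed.
Definition pull_lhom (X Y : lmodType A) (f : lhom X Y) : lhom (pullm phi X) (pullm phi Y) :=
  mklhom (pull_lhom_subproof f).

End ScalarPullback.

Section QuotientMaps.
Variable A : pzRingType.

Fact quotm_lift_subproof (X W : lmodType A) (N : submod X) (f : lhom X W) :
  (forall x, N x -> f x = 0) -> linear (fun u : quotm N => f (repr u)).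
Proof.
move=> fN a u v; apply/subr0_eq; rewrite -lhomP -lhomB; apply: fN.
apply/(quotm_pi_eq0 N); rewrite lhomB lhomP.
have reprK w : quotm_pi N (repr w) = w := quotm_reprK w.
by rewrite !reprK subrr.
Qed.
(** Unlike [lhom_factor_surj], which only asserts existence, this is an actual map, as the
    definition of a functor requires. *)
Definition quotm_lift (X W : lmodType A) (N : submod X) (f : lhom X W)
    (fN : forall x, N x -> f x = 0) : lhom (quotm N) W :=
  mklhom (quotm_lift_subproof fN).

Lemma quotm_liftE (X W : lmodType A) (N : submod X) (f : lhom X W)
    (fN : forall x, N x -> f x = 0) x : quotm_lift fN (quotm_pi N x) = f x.
Proof.
apply/subr0_eq; rewrite mklhomE -lhomB; apply: fN; apply/(quotm_pi_eq0 N).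
by rewrite lhomB [quotm_pi N (repr _)]quotm_reprK subrr.
Qed.

Lemma all_ext_closed : ext_closed (fun _ : lmodType A => True).
Proof. by []. Qed.

Lemma pullback_exact (X Y Z Z' : lmodType A) (f : lhom X Y) (g : lhom Y Z) (a : lhom Z' Z) :
  short_exact f g -> exists (W : lmodType A) (f' : lhom X W) (g' : lhom W Z') (b : lhom W Y),
    short_exact f' g' /\ forall w, g (b w) = a (g' w).
Proof.
move=> fg; pose T (M : lmodType A) : modcat (fun _ : lmodType A => True) := mobj (P := fun=> True) (M := M) I.
have [W [f' [g' [b [fg' gb _]]]]] :=
  @ext_closed_pullback _ _ all_ext_closed (T X) (T Y) (T Z) (T Z') f g a fg.
by exists (sval W), f', g', b; split=> // w; apply: (lhom_eqE w gb).
Qed.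

End QuotientMaps.

Lemma is_kernel_iso (C : pacat) (X X' Y Z : C) (f : hom X Y) (f' : hom X' Y) (g : hom Y Z) :
  is_kernel f g -> is_kernel f' g -> exists a : hom X' X, is_iso a /\ f \oo a = f'.
Proof.
move=> [gf fu] [gf' fu'].
have [a [fa _]] := fu _ f' gf'; have [b [fb _]] := fu' _ f gf.
have uniq (T : C) (m : hom T Y) (M : g \oo m = 0) (h : hom T T) :
    (forall W (n : hom W Y), g \oo n = 0 -> exists! l : hom W T, m \oo l = n) ->
    m \oo h = m -> h = idm T.
  move=> u mh; have [l [_ lu]] := u _ m M.
  by rewrite -(lu h mh); apply: lu; rewrite cmpm1.
exists a; split=> //; exists b; split.
  by apply: (uniq _ _ gf' _ fu'); rewrite cmpA fb fa.
by apply: (uniq _ _ gf _ fu); rewrite cmpA fa fb.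
Qed.

Section TraceQuotient.
Variables (k : fieldType) (B : falgType k).
Hypothesis B_inj : selfinjective B.
Notation A := (tord B).
Notation e := (e11 B).
Notation E := (modcat (@CM k B)).
Notation E' := (mod_fg B).
Notation N := (@trace_part k B).
Notation Q X := (quotm (@trace_part k B X)).
Notation pi X := (quotm_pi (@trace_part k B X)).
Notation iota := (@tin k B : {rmorphism B -> tord B}).
Notation res X := (pullm (@tin k B : {rmorphism B -> tord B}) X : lmodType B).

(** The projection of A onto A / AeA = B; [tin] is a section of it. *)
Definition rho (a : A) : B := fcoef (t22 a) 0.

Lemma trace_part_rho (X : lmodType A) (a : A) (x : X) : N X ((a - tin (rho a)) *: x).
Proof.
exists ((tsc (t21 a) + tsc (fps_unshift (t22 a)) * tal) *: x).
rewrite !scalerA; congr (_ *: _); apply: (addIr (te2 * tin (rho a))).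
rewrite -mulrDr subrK; apply: tord_ext; rewrite ?tE ?t0E //.
by apply: fps_ext => -[|n]; rewrite fcoefD /= ?add0r ?addr0.
Qed.

Lemma quot_scale (X : lmodType A) (a : A) (u : Q X) : a *: u = tin (rho a) *: u.
Proof.
have [x <-] := quotm_pi_surj u; apply/subr0_eq; rewrite -scalerBl -lhomZ.
exact/quotm_pi_eq0/trace_part_rho.
Qed.

Lemma quot_fin_gen (X : lmodType A) : fin_gen X -> fin_gen (res (Q X)).
Proof.
move=> [n [x xP]]; exists n, (fun i => pi X (x i)) => u.
have [m <-] := quotm_pi_surj u; have [c ->] := xP m.
exists (fun i => rho (c i)); rewrite lhom_sum; apply: eq_bigr => i _.
by rewrite lhomZ quot_scale.
Qed.

Lemma quot_lhom_subproof (X Y : lmodType A) (h : lhom (res (Q X)) (res (Q Y))) :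
  linear (h : Q X -> Q Y).
Proof.
move=> a u v; rewrite quot_scale [a *: h u]quot_scale.
exact: (lhomP h (rho a) u v).
Qed.

Section Map.
Variables (X Y : lmodType A) (f : lhom X Y).

Fact qmap_subproof x : N X x -> lhom_comp (pi Y) f x = 0.
Proof. by move=> xN; apply/quotm_pi_eq0/trace_part_lhom. Qed.
Definition qmap : lhom (res (Q X)) (res (Q Y)) := pull_lhom iota (quotm_lift qmap_subproof).

Lemma qmapE x : qmap (pi X x) = pi Y (f x).
Proof. exact: (quotm_liftE qmap_subproof). Qed.

End Map.

Lemma qmap_ext (X Y : lmodType A) (h h' : lhom (res (Q X)) (res (Q Y))) :
  (forall x, h (pi X x) = h' (pi X x)) -> h = h'.
Proof. by move=> hh; apply: lhom_ext => u; have [x <-] := quotm_pi_surj u. Qed.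

(* X / AeX as a module over A / AeA = B. *)
Definition tq_obj (X : E) : E' :=
  mobj (quot_fin_gen (let: And3 h _ _ := svalP X in h)).
Definition tq_map (X Y : E) (f : hom X Y) : @hom E' (tq_obj X) (tq_obj Y) := qmap f.

Fact tq_map1 (X : E) : tq_map (idm X) = idm (tq_obj X).
Proof. by apply: qmap_ext => x; rewrite qmapE. Qed.
Fact tq_mapM (X Y Z : E) (g : hom Y Z) (f : hom X Y) :
  tq_map (g \oo f) = tq_map g \oo tq_map f.
Proof. by apply: qmap_ext => x; rewrite -[RHS]/(qmap g (qmap f (pi (sval X) x))) !qmapE. Qed.
Fact tq_mapD (X Y : E) (f g : hom X Y) : tq_map (f + g) = tq_map f + tq_map g.
Proof.
apply: qmap_ext => x; rewrite qmapE -[RHS]/(qmap f (pi (sval X) x) + qmap g (pi (sval X) x)).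
by rewrite !qmapE; apply: (lhomD (pi (sval Y))).
Qed.

Definition tq : functor E E' := Functor tq_map1 tq_mapM tq_mapD.

Lemma tq_kernel (X Y : E) (f : hom X Y) :
  imem (add_ideal (lideal e : lmodType A)) f <-> fmap tq f = 0.
Proof.
split=> [[M [g [h [[n [s [r rs]]] ->]]]]|f0].
  apply: qmap_ext => x; rewrite qmapE; apply/quotm_pi_eq0.
  have rsE q : r (s q) = q := lhom_eqE q rs.
  rewrite lhom_compE -[h x]rsE; do 2! apply: trace_part_lhom.
  move: (s (h x)) => {}x.
  (* A power of Ae equals its own trace submodule: for u in Ae, e_2 u is [tta] times the scalar
     [t21 u]. *)
  exists [ffun i => Lideal (lideal_proj_in e (tsc (t21 (lideal_val (x i))) * te1)) : lideal e].
  apply/ffunP => i; rewrite !ffunE; apply: val_inj.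
  rewrite [LHS]/(te2 * lideal_val (x i)).
  rewrite -[RHS]/(tta * (tsc (t21 (lideal_val (x i))) * te1 * idem_val e)) e11_val.
  have -> : lideal_val (x i) = lideal_val (x i) * te1 :> A.
    by case: (x i) => u /= /eqP; rewrite e11_val.
  by apply: tord_ext; rewrite ?tE ?t0E.
have fN x : N (sval Y) (f $ x).
  apply/quotm_pi_eq0; rewrite -(qmapE f).
  exact: (congr1 (fun h : lhom (res (Q (sval X))) (res (Q (sval Y))) => h (pi (sval X) x)) f0).
have [|g gf] := lhom_factor_inj (f := f : lhom _ _) (@subm_in_inj _ _ (N (sval Y))).
  by move=> x; apply/subm_inE.
exists (subm (N (sval Y))), (subm_in _), g; split; first exact/trace_part_in_add/svalP.
by apply: lhom_ext => x; rewrite [RHS]gf.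
Qed.

Lemma tq_full : full tq.
Proof.
move=> X Y h; pose h' := mklhom (quot_lhom_subproof h).
(* W is the pullback of Y -> Y / AeY along X -> Y / AeY, an extension of X by AeY. It lies in CM_e
   A, so injectivity of AeY splits it, and a section followed by W -> Y is the lift. *)
have [W [f' [g' [b [fg' bE]]]]] :=
  pullback_exact (lhom_comp h' (pi (sval X))) (subm_quotm_exact (N (sval Y))).
have cN : CM (subm (N (sval Y))) := trace_part_CM (svalP Y).
have cW : CM W := ext_closedX (CM_ext_closed B) fg' cN (svalP X).
have iN : @ex_injective E (mobj cN).
  apply: (in_add_ex_injective (CM_extend B_inj)).
  exact/in_add_lideal/trace_part_in_add/svalP.
have [r rf] := iN (mobj cN) (mobj cW) X f' g' fg' (idm (mobj cN)).
have [|s gs] := ses_retraction_section (r := r) fg'; first by move=> x; apply: (lhom_eqE x rf).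
exists (lhom_comp b s); apply: qmap_ext => x; rewrite qmapE lhom_compE bE gs.
by [].
Qed.

(** Only injectivity at the left end needs more than right exactness. If e_2 f(x) = tta y, then tta
    g(y) = 0, so e g(y) = 0 by torsion-freeness of Z; hence e y comes from X and x lies in AeX. *)
Lemma tq_exact : is_exact_functor tq.
Proof.
move=> X Y Z f g fg; split.
- apply: lhom_inj0 => u; have [x <-] := quotm_pi_surj u; rewrite qmapE.
  move=> /quotm_pi_eq0[y fxy]; apply/quotm_pi_eq0.
  have gy : te1 *: (g $ y) = 0.
    apply: CM_tta_eq0 (svalP Z) _; rewrite -lhomZ -fxy -lhomZ; exact: (ses_cmp0 fg).
  have [|x' fx'] := @ses_mid _ _ _ _ _ _ fg (te1 *: y); first by rewrite lhomZ.
  exists x'; apply: (ses_inj fg); rewrite !lhomZ fxy fx' scalerA tta_te1.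
  by [].
- move=> w; have [z <-] := quotm_pi_surj w; have [y <-] := ses_surj fg z.
  by exists (pi (sval Y) y); rewrite qmapE.
move=> v; have [y <-] := quotm_pi_surj v; rewrite qmapE; split.
  move=> /quotm_pi_eq0[z gyz]; have [y' gy'] := ses_surj fg z.
  have [|x fx] := @ses_mid _ _ _ _ _ _ fg (te2 *: y - tta *: y').
    by rewrite lhomB !lhomZ gy' gyz subrr.
  exists (pi (sval X) x); rewrite qmapE; apply/esym/subr0_eq; rewrite -[LHS](lhomB (pi (sval Y))).
  apply/quotm_pi_eq0; exists y'; rewrite fx scalerBr scalerBr !scalerA te2_te2 te2_tta.
  by rewrite opprB addrC subrK.
move=> [u]; have [x <-] := quotm_pi_surj u; rewrite qmapE => e0.
apply/quotm_pi_eq0; have /quotm_pi_eq0 : pi (sval Y) (y - f $ x) = 0.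
  by rewrite lhomB -e0 subrr.
by move/(trace_part_lhom g); rewrite lhomB (ses_cmp0 fg) subr0.
Qed.

Section FreeCover.
Variable n : nat.

Lemma rhoM a b : rho (a * b) = rho a * rho b.
Proof. by rewrite /rho t22M fcoefD fcoefM big_ord1 add0r. Qed.
Lemma rhoD a b : rho (a + b) = rho a + rho b.
Proof. by rewrite /rho t22D. Qed.
Lemma rho_tin b : rho (tin b) = b.
Proof. by rewrite /rho t22_tmx. Qed.

Fact rhov_subproof :
  linear (fun v : res {ffun 'I_n -> A^o} => [ffun i => rho (v i : A)] : {ffun 'I_n -> B^o}).
Proof.
move=> b v w; apply/ffunP => i; rewrite ffunE ffunE rhoD.
by rewrite [in LHS]ffunE rhoM rho_tin !ffunE.
Qed.
Definition rhov : lhom (res {ffun 'I_n -> A^o}) {ffun 'I_n -> B^o} := mklhom rhov_subproof.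

Lemma rhov_surj w : exists v, rhov v = w.
Proof.
exists [ffun i => tin (w i : B) : A^o]; apply/ffunP => i.
by rewrite mklhomE !ffunE rho_tin.
Qed.

(** The kernel of A^n -> B^n is the trace submodule. The witness is taken in eA^n so that it also
    lies in every submodule containing eA^n, which the density argument needs. *)
Lemma rhov_eq0 (v : {ffun 'I_n -> A^o}) : rhov v = 0 ->
  exists w : {ffun 'I_n -> A^o}, te2 *: v = tta *: w /\ te1 *: w = w.
Proof.
move=> /ffunP v0.
exists [ffun i => tmx (t21 (v i)) (fps_unshift (t22 (v i))) 0 0 : A^o].
split; apply/ffunP => i; rewrite !ffunE.
  apply: tord_ext; rewrite ?tE ?t0E // fps_unshiftK //.
  by have := v0 i; rewrite mklhomE !ffunE.
by apply: tord_ext; rewrite ?tE ?t0E.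
Qed.

Lemma rhov_trace (v : {ffun 'I_n -> A^o}) : N _ v -> rhov v = 0.
Proof.
move=> [w vw]; apply/ffunP => i; rewrite mklhomE !ffunE /rho.
have /ffunP/(_ i)/(congr1 (@t22 k B)) := vw; rewrite !ffunE !tE !t0E => ->.
by [].
Qed.

End FreeCover.

Lemma tq_dense : dense tq.
Proof.
move=> M; have [n [j jI]] := fin_gen_embeds B_inj (svalP M).
have N0 : exists m, j m = rhov n 0 by exists 0; rewrite !lhom0.
have NP (a : A) (v w : {ffun 'I_n -> A^o}) : (exists m, j m = rhov n v) ->
    (exists m, j m = rhov n w) -> exists m, j m = rhov n (a *: v + w).
  move=> [m mv] [m' mw]; exists (rho a *: m + m'); rewrite lhomP mv mw.
  by apply/ffunP => i; rewrite !mklhomE !ffunE rhoD rhoM.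
pose L := Submod N0 NP.
have cL : CM (subm L).
  apply: CM_sub (CM_free B n) => v; exists 0; rewrite lhom0; apply/ffunP => i.
  by rewrite mklhomE !ffunE rhoM /rho t22_tmx mul0r.
have [|p pP] := lhom_factor_inj (f := lhom_comp (rhov n) (pull_lhom iota (subm_in L))) jI.
  by move=> u; apply: (subm_inN (N := L) u).
(* The kernel of L -> M must be the trace AeL of L itself, not just the part of L lying in the trace
   of A^n; the witness from eA^n belongs to L. *)
have p0 u : p u = 0 <-> N (subm L) u.
  split=> [pu|[w uw]].
    have /rhov_eq0[w [uw we]] : rhov n (subm_in L u) = 0.
      by have := pP u; rewrite pu lhom0.
    have /subm_inE[w' ew'] : L w.
      exists 0; rewrite lhom0 -we; apply/ffunP => i.
      by rewrite mklhomE !ffunE rhoM /rho t22_tmx mul0r.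
    by exists w'; apply: (@subm_in_inj _ _ L); rewrite !lhomZ ew'.
  apply: jI; rewrite pP lhom0; apply: rhov_trace; exists (subm_in L w).
  by rewrite -[LHS](lhomZ (subm_in L)) uw lhomZ.
have [||q qP] := @lhom_factor_surj _ _ _ _ (pull_lhom iota (pi (subm L))) p.
- exact: quotm_pi_surj.
- by move=> u /quotm_pi_eq0/p0.
exists (mobj cL), q; apply/modcat_isoP; split.
  apply: lhom_inj0 => w; have [u <-] := quotm_pi_surj w.
  by rewrite [q _]qP => /p0 uN; apply/quotm_pi_eq0.
move=> m; have [v ev] := rhov_surj (j m).
have /subm_inE[u eu] : L v by exists m.
exists (pi (subm L) u); rewrite [LHS]qP; apply: jI; rewrite pP -ev.
exact: (congr1 (rhov n) eu).
Qed.

End TraceQuotient.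

Lemma qpi_eq0 (C : pacat) (I : ideal C) (X Y : C) (f : hom X Y) :
  imem I f <-> fmap (qfun I) f = 0.
Proof.
rewrite -(fmap0 (qfun I)) -{1}[f](_ : f - 0 = f); first exact: iff_sym (qpi_eq I f 0).
by rewrite subr0.
Qed.

Lemma imemD (C : pacat) (I : ideal C) (X Y : C) (f g : hom X Y) :
  imem I f -> imem I g -> imem I (f + g).
Proof. by rewrite !qpi_eq0 fmapD => -> ->; rewrite addr0. Qed.

(** * The equivalence with mod B and its stable version *)

Section Equivalences.
Variables (k : fieldType) (B : falgType k).
Hypothesis B_inj : selfinjective B.
Notation A := (tord B).
Notation e := (e11 B).
Notation E := (modcat (@CM k B)).
Notation E' := (mod_fg B).
Notation N := (@trace_part k B).
Notation pi X := (quotm_pi (@trace_part k B X)).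
Notation iota := (@tin k B : {rmorphism B -> tord B}).
Notation I_Ae := (add_ideal (lideal e : lmodType A) : ideal E).
Notation I_A := (add_ideal (A^o : lmodType A) : ideal E).
Notation I_B := (add_ideal (B^o : lmodType B) : ideal E').
Notation TQ := (@tq k B).

Fact tq_Ae_subproof (X Y : E) (f : hom X Y) : imem I_Ae f -> fmap TQ f = 0.
Proof. by move/tq_kernel. Qed.
Definition tq_Ae : functor (qexcat I_Ae) E' := qlift tq_Ae_subproof.

Lemma tq_Ae_qfun (X Y : E) (f : hom X Y) : fmap tq_Ae (fmap (qfun I_Ae) f) = fmap TQ f.
Proof. exact: (qlift_qpi tq_Ae_subproof). Qed.

Lemma tq_Ae_full : full tq_Ae.
Proof.
move=> X Y h; have [f fh] := tq_full B_inj (X := X) (Y := Y) h.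
by exists (fmap (qfun I_Ae) f); rewrite tq_Ae_qfun.
Qed.

Lemma tq_Ae_faithful : faithful tq_Ae.
Proof.
move=> X Y f f0; rewrite -[f]qreprK; apply/(qpi_eq0 I_Ae (qrepr f)).
exact/tq_kernel.
Qed.

Lemma tq_Ae_dense : dense tq_Ae.
Proof. exact: tq_dense. Qed.

Lemma imem_trace_part (X Y Z : E) (cN : CM (subm (N (sval Z))))
    (g : @hom E (mobj cN) Y) (f : @hom E X (mobj cN)) : imem I_Ae (g \oo f).
Proof.
by exists (subm (N (sval Z))), g, f; split=> //; apply/trace_part_in_add/svalP.
Qed.

(* [Y -> Z] becomes surjective after adding the summand AeZ of add Ae to Y; the kernel of
   the result is the wanted module. *)
Lemma tq_reflects_confl (X Y Z : E) (f : hom X Y) (g : hom Y Z) :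
  confl (fmap TQ f) (fmap TQ g) ->
  @confl (qexcat I_Ae) X Y Z (fmap (qfun I_Ae) f) (fmap (qfun I_Ae) g).
Proof.
move=> fg; have cN : CM (subm (N (sval Z))) := trace_part_CM (svalP Z).
pose inc : @hom E (mobj cN) Z := subm_in (N (sval Z)).
have [W [i [j [p [q [pi_ qj pj qi ipjq]]]]]] :=
  ext_closed_biproduct (CM_ext_closed B) Y (mobj cN).
pose g1 : hom W Z := g \oo p + inc \oo q.
have g1i : g1 \oo i = g by rewrite cmpDl -!cmpA pi_ qi cmpm1 cmpm0 addr0.
have g1j : g1 \oo j = inc by rewrite cmpDl -!cmpA pj qj cmpm1 cmpm0 add0r.
have g1_surj z : exists w, lhom_fun (g1 : lhom _ _) w = z.
  have [u gu] := ses_surj fg (pi (sval Z) z); have [y yu] := quotm_pi_surj u.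
  have /subm_inE[x xz] : N (sval Z) (z - g $ y).
    apply/quotm_pi_eq0; rewrite lhomB; apply/eqP; rewrite subr_eq0; apply/eqP.
    by rewrite -[RHS](qmapE g) yu.
  exists (lhom_fun (i : lhom _ _) y + lhom_fun (j : lhom _ _) x).
  rewrite lhomD -[X in X + _]/(lhom_fun (g1 \oo i : lhom _ _) y).
  by rewrite -[X in _ + X]/(lhom_fun (g1 \oo j : lhom _ _) x) g1i g1j xz addrC subrK.
have cK : CM (subm (lkerm (g1 : lhom _ _))) :=
  CM_kernel (ker_exact g1_surj) (svalP W) (svalP Z).
pose ka : @hom E (mobj cK) W := subm_in (lkerm (g1 : lhom _ _)).
have kg : confl ka g1 := ker_exact g1_surj.
(* The summand AeZ lies in add Ae, so the projection from W to Y becomes invertible in the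
   quotient. *)
have p_iso : is_iso (fmap (qfun I_Ae) p).
  exists (fmap (qfun I_Ae) i); rewrite -!fmapM pi_ fmap1; split=> //.
  rewrite -(fmap1 (qfun I_Ae)); apply/qpi_eq.
  have -> : i \oo p - idm W = 0 - j \oo q by rewrite -ipjq opprD addrA subrr.
  by apply: imemB; [apply: imem0 | apply: imem_trace_part].
have g1p : fmap (qfun I_Ae) g1 = fmap (qfun I_Ae) g \oo fmap (qfun I_Ae) p.
  rewrite -fmapM; apply/qpi_eq; rewrite /g1 addrAC subrr add0r.
  exact: imem_trace_part.
have pk : confl (fmap TQ p \oo fmap TQ ka) (fmap TQ g).
  apply: (confl_iso (is_iso_idm _) _ (is_iso_idm _) _ _ (tq_exact kg) (b := fmap TQ p)).
  - by rewrite -tq_Ae_qfun; apply: (fmap_iso tq_Ae p_iso).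
  - by rewrite cmpm1.
  - by rewrite cmp1m -!tq_Ae_qfun g1p fmapM.
(* The images of X and of the new kernel are both kernels of the same map in mod B; the resulting
   isomorphism lifts to the quotient category, where the functor is fully faithful. *)
have [a0 [a0I fa0]] := is_kernel_iso (confl_is_kernel fg) (confl_is_kernel pk).
have [a a0E] := tq_Ae_full (X := mobj cK) (Y := X) a0.
exists (mobj cK), W, Z, ka, g1; split=> //.
exists a, (fmap (qfun I_Ae) p), (idm _); split=> //.
- by apply: (full_faithful_iso tq_Ae_full tq_Ae_faithful); rewrite a0E.
- exact: is_iso_idm.
- apply: (faithful_inj tq_Ae_faithful); rewrite !fmapM !tq_Ae_qfun a0E fa0.
  by [].
by rewrite cmp1m.
Qed.

Lemma tq_Ae_confl (X Y Z : qexcat I_Ae) (f : hom X Y) (g : hom Y Z) :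
  confl f g <-> confl (fmap tq_Ae f) (fmap tq_Ae g).
Proof.
split=> [[X' [Y' [Z' [f' [g' [fg' [a [b [c [ia ib ic bf cg]]]]]]]]]]|fg].
  apply: (confl_iso (fmap_iso tq_Ae ia) (fmap_iso tq_Ae ib) (fmap_iso tq_Ae ic) _ _
    (tq_exact fg')).
  - by rewrite -!tq_Ae_qfun -!fmapM bf.
  - by rewrite -!tq_Ae_qfun -!fmapM cg.
have := tq_reflects_confl (f := qrepr f) (g := qrepr g) fg.
by rewrite /= !qreprK.
Qed.

Theorem tq_Ae_exact_equivalence : exact_equivalence tq_Ae.
Proof.
apply: full_faithful_dense_exact_equivalence.
- exact: tq_Ae_full.
- exact: tq_Ae_faithful.
- exact: tq_Ae_dense.
- exact: modcat_exact (fin_gen_ext_closed B).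
- exact: tq_Ae_confl.
Qed.

Definition free_obj n : E := mobj (CM_free B n).

Lemma tq_free n : exists (s : lhom (sval (TQ (free_obj n))) {ffun 'I_n -> B^o})
    (r : lhom {ffun 'I_n -> B^o} (sval (TQ (free_obj n)))),
  lhom_comp r s = lhom_id _ /\ lhom_comp s r = lhom_id _.
Proof.
have [||s sP] := @lhom_factor_surj _ _ _ _
    (pull_lhom iota (pi {ffun 'I_n -> A^o})) (rhov B n).
- exact: quotm_pi_surj.
- by move=> v /quotm_pi_eq0/rhov_trace.
have [||r rs] := lhom_bij_inv (f := s).
- apply: lhom_inj0 => u; have [v <-] := quotm_pi_surj u; rewrite [s _]sP.
  move=> /rhov_eq0[w [vw _]]; apply/quotm_pi_eq0; by exists w.
- by move=> w; have [v <-] := rhov_surj w; exists (pi _ v); apply: sP.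
by exists s, r.
Qed.

Lemma tq_in_add (X : E) : in_add A^o (sval X) -> in_add B^o (sval (TQ X)).
Proof.
move=> [n [s [r rs]]]; have [t [u [ut tu]]] := tq_free n.
pose s' : @hom E X (free_obj n) := s; pose r' : @hom E (free_obj n) X := r.
have rs' : fmap TQ r' \oo fmap TQ s' = idm (TQ X) by rewrite -fmapM -fmap1; congr (fmap TQ _).
exists n, (lhom_comp t (fmap TQ s' : lhom _ _)), (lhom_comp (fmap TQ r' : lhom _ _) u).
apply: lhom_ext => x; rewrite !lhom_compE.
by rewrite -[u (t _)]/(lhom_comp u t _) ut -[RHS](lhom_eqE x rs').
Qed.

(** Conversely, a factorization of the image through B^n lifts by fullness to a composite through
    A^n. The functor kills the difference from f, which thus factors through add Ae, and add Ae is
    contained in add A. *)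
Lemma tq_add_ideal (X Y : E) (f : hom X Y) : imem I_A f <-> imem I_B (fmap TQ f).
Proof.
split.
  have [_ ->] := CM_stable_ideal B_inj; move=> [P [g [h [Pp ->]]]].
  exists (sval (TQ P)), (fmap TQ g), (fmap TQ h); split; last by rewrite fmapM.
  by apply: tq_in_add; apply: (ex_projective_in_add (@CM_free k B)) Pp; apply: CM_cover.
move=> [M [g [h [[n [s [r rs]]] fE]]]]; have [t [u [ut tu]]] := tq_free n.
have [h1 h1E] := tq_full B_inj (X := X) (Y := free_obj n) (lhom_comp u (lhom_comp s h)).
have [g1 g1E] := tq_full B_inj (X := free_obj n) (Y := Y) (lhom_comp (lhom_comp g r) t).
have -> : f = (f - g1 \oo h1) + g1 \oo h1 by rewrite subrK.
apply: imemD; last first.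
  exists {ffun 'I_n -> A^o}, g1, h1; split=> //.
  by exists n, (lhom_id _), (lhom_id _); apply: lhom_ext.
have /tq_kernel[P [g2 [h2 [/in_add_lideal addP ->]]]] : fmap TQ (f - g1 \oo h1) = 0.
  rewrite fmapB fmapM g1E h1E fE; apply/subr0_eq; rewrite subr0; apply/eqP.
  rewrite subr_eq0; apply/eqP; apply: lhom_ext => x.
  have tuE w : t (u w) = w := lhom_eqE w tu.
  have rsE w : r (s w) = w := lhom_eqE w rs.
  by rewrite modcat_cmpE !lhom_compE tuE rsE.
by exists P, g2, h2.
Qed.

Fact tq_stable_subproof (X Y : E) (f : hom X Y) :
  imem I_A f -> fmap (fcomp (qfun I_B) TQ) f = 0.
Proof. by move=> /tq_add_ideal/qpi_eq0. Qed.
Definition tq_stable : functor (qcat I_A) (qcat I_B) := qlift tq_stable_subproof.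

Lemma tq_stable_qfun (X Y : E) (f : hom X Y) :
  fmap tq_stable (fmap (qfun I_A) f) = fmap (qfun I_B) (fmap TQ f).
Proof. exact: (qlift_qpi tq_stable_subproof). Qed.

Lemma tq_stable_equivalence : is_equivalence tq_stable.
Proof.
apply: full_faithful_dense_equivalence.
- move=> X Y h; have [f fE] := tq_full B_inj (X := X) (Y := Y) (qrepr h).
  by exists (fmap (qfun I_A) f); rewrite tq_stable_qfun fE [LHS]qreprK.
- move=> X Y f f0; rewrite -[f]qreprK; apply/(qpi_eq0 I_A (qrepr f)).
  exact/tq_add_ideal/qpi_eq0.
move=> M; have [X [i iI]] := tq_dense B_inj M.
by exists X, (fmap (qfun I_B) i); apply: (fmap_iso (qfun I_B) iI).
Qed.

Theorem tq_triangle_equivalence (S : suspension E) (S' : suspension E') :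
  triangle_equivalence S S' tq_stable.
Proof.
split; first exact: tq_stable_equivalence.
apply: (induced_triangle_functor (CM_stable_ideal B_inj) (mod_fg_stable_ideal B_inj)).
- exact: tq_exact.
- move=> J Ji; apply: (in_add_ex_injective (P := @fin_gen B)).
    by move=> L M K f g _ _ _ fg h; apply: B_inj; apply: (ses_inj fg).
  apply: tq_in_add; apply: (ex_injective_in_add (@CM_free k B)) Ji.
  exact: CM_envelope.
- by move=> X Y Z X' W f g a b f'; apply: (is_pushout_confl (CM_ext_closed B)).
by move=> X Y Z X' W f g a b f' g'; apply: confl_is_pushout.
Qed.

Lemma tq_stable_induced : nat_iso (fcomp tq_stable (qfun I_A))
  (fcomp (qfun I_B) (fcomp tq_Ae (qfun I_Ae))).
Proof.
exists (fun X => fmap (qfun I_B) (idm (TQ X))); split=> [X|X Y f].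
  exact: (fmap_iso (qfun I_B) (is_iso_idm (TQ X))).
rewrite !fmap1 cmp1m cmpm1 -[LHS]/(fmap tq_stable (fmap (qfun I_A) f)) tq_stable_qfun.
by rewrite -[RHS]/(fmap (qfun I_B) (fmap tq_Ae (fmap (qfun I_Ae) f))) tq_Ae_qfun.
Qed.

End Equivalences.

Theorem corollary3 (k : fieldType) (B : falgType k) (hB : selfinjective B) :
  let A : algType (fps k) := tord B in
  let e : idem_elt A := e11 B in
  let Ae : lmodType A := lideal e in
  let AA : lmodType A := A^o in
  let BB : lmodType B := B^o in
  let CM_Ae : ideal (CMe e) := add_ideal Ae in
  let CM_A : ideal (CMe e) := add_ideal AA in
  let mod_B : ideal (mod_fg B) := add_ideal BB in
  Gorenstein_order A /\
  exists (F : functor (qexcat CM_Ae) (mod_fg B)) (G : functor (qcat CM_A) (qcat mod_B)),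
    [/\ exact_equivalence F,
        stable_ideal CM_A,
        stable_ideal mod_B,
        (* G is induced by F *)
        nat_iso (fcomp G (qfun CM_A)) (fcomp (qfun mod_B) (fcomp F (qfun CM_Ae))) &
        forall (S : suspension (CMe e)) (S' : suspension (mod_fg B)),
          triangle_equivalence S S' G].
Proof.
split; first exact: tord_Gorenstein.
exists (tq_Ae B), (tq_stable hB); split.
- exact: tq_Ae_exact_equivalence.
- exact: CM_stable_ideal.
- exact: mod_fg_stable_ideal.
- exact: tq_stable_induced.
- exact: tq_triangle_equivalence.
Qed.
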